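(* Let $q$ be a power of a prime number and let $G_q$ be an $\widetilde{A}_2$-group of order $q$. Then every homomorphism $h:G_q\to \operatorname{Diff}^{1+\alpha}_+(S^1)$ has finite image for $$\alpha > \dfrac{\dfrac{1}{2}\ln\big(2(q^2+q+1)(q+1)\big)-\ln(2)-\ln\left(\sqrt{1-\dfrac{\sqrt{q}}{q+1}}\right)}{\ln(q^2+q+1)+\ln(q+1)}.$$
   Context: For a group $G$ with a finite symmetric generating set $S=S^{-1}$ not containing the identity, the link graph $\mathcal{L}(S)$ has vertex set $S$, with $s,t\in S$ joined by an edge iff $s^{-1}t\in S$ (equivalently $t^{-1}s\in S$). The $\widetilde{A}_2$-group $G_q$ has a finite symmetric generating set $S$, not containing the identity, whose link graph $\mathcal{L}(S)$ is the incidence graph of the finite projective plane $\mathbf{P}^2(\mathbb{F}_q)$, i.e. the bipartite graph whose vertices are the $q^2+q+1$ points and the $q^2+q+1$ lines of $\mathbf{P}^2(\mathbb{F}_q)$, a point and a line being joined iff they are incident. For the purposes of this statement, ''an $\widetilde{A}_2$-group of order $q$'' means a group admitting such a generating set. $\operatorname{Diff}^{1+\alpha}_+(S^1)$ is the group of orientation-preserving diffeomorphisms of the circle of class $C^{1+\alpha}$ (i.e. $C^1$ with $\alpha$-Hölder continuous derivative). *)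

(* Defs.v *)
From mathcomp Require Import all_boot all_order all_algebra.
From mathcomp Require Import all_classical all_reals all_analysis.

Set Implicit Arguments.
Unset Strict Implicit.
Unset Printing Implicit Defensive.

Import Order.TTheory GRing.Theory Num.Theory.
Import numFieldNormedType.Exports.

Local Open Scope classical_set_scope.
Local Open Scope ring_scope.

Section ProjectivePlane.
Variable F : finFieldType.

Definition proj_point := {V : {vspace 'rV[F]_3} | \dim V == 1%N}.
Definition proj_line := {V : {vspace 'rV[F]_3} | \dim V == 2%N}.

Definition incident (P : proj_point) (L : proj_line) : bool :=
  (val P <= val L)%VS.

Definition incidence_edge (u v : proj_point + proj_line) : bool :=
  match u, v with
  | inl P, inr L => incident P L
  | inr L, inl P => incident P L
  | _, _ => false
  end.

End ProjectivePlane.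

(* [groupType] is the type of arbitrary, possibly infinite, groups. *)
Section LinkGraph.
Variable G : groupType.

Definition subgroup_set (H : set G) : Prop :=
  [/\ H 1%g,
      forall x y, H x -> H y -> H (x * y)%g
    & forall x, H x -> H (x^-1)%g].

Definition generating (S : set G) : Prop :=
  smallest subgroup_set S = [set: G].

Definition symmetric_set (S : set G) : Prop := forall s, S s -> S (s^-1)%g.

Definition link_edge (S : set G) (s t : G) : Prop := S (s^-1 * t)%g.

Definition link_iso_incidence (S : set G) (F : finFieldType) : Prop :=
  exists phi : proj_point F + proj_line F -> G,
    set_bij [set: proj_point F + proj_line F] S phi /\
    forall u v, incidence_edge u v <-> link_edge S (phi u) (phi v).

Definition A2tilde_group (q : nat) : Prop :=
  exists S : set G,
    [/\ finite_set S, symmetric_set S, ~ S 1%g, generating S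
      & exists F : finFieldType, #|F| = q /\ link_iso_incidence S F].

End LinkGraph.

Section Circle.
Variable R : realType.

Definition circle := {z : R * R | z.1 ^+ 2 + z.2 ^+ 2 == 1}.

Lemma circle_exp_subproof (t : R) :
  (cos t, sin t).1 ^+ 2 + (cos t, sin t).2 ^+ 2 == 1.
Proof. by rewrite /= cos2Dsin2. Qed.

Definition circle_exp (t : R) : circle :=
  exist _ (cos t, sin t) (circle_exp_subproof t).

Definition is_lift (f : circle -> circle) (F : R -> R) : Prop :=
  continuous F /\ forall t, f (circle_exp t) = circle_exp (F t).

(* Smoothness of a circle map is read off in the angular coordinate. The
   derivative of a differentiable lift is 2 pi-periodic, so the Hoelder
   condition on all of R is the one on the circle. *)
Definition C1holder (alpha : R) (f : circle -> circle) : Prop :=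
  exists F : R -> R,
    [/\ is_lift f F,
        forall t, derivable F t 1,
        continuous (derive1 F)
      & exists C : R, forall x y,
          `|derive1 F x - derive1 F y| <= C * `|x - y| `^ alpha].

Definition orientation_preserving (f : circle -> circle) : Prop :=
  exists F : R -> R, is_lift f F /\ {homo F : x y / x < y}.

(* Underlying set of Diff^{1+alpha}_+(S^1); the group law is composition. *)
Definition Diff_plus (alpha : R) : set (circle -> circle) :=
  [set f | exists g : circle -> circle,
     [/\ cancel f g, cancel g f, C1holder alpha f, C1holder alpha g
       & orientation_preserving f]].

(* Multiplicativity forces [h 1] to be an idempotent bijection, hence the
   identity, so preservation of the unit is not a separate clause. *)
Definition hom_to_Diff_plus (G : groupType) (alpha : R)
    (h : G -> circle -> circle) : Prop :=
  (forall g, Diff_plus alpha (h g)) /\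
  (forall g1 g2, h (g1 * g2)%g = h g1 \o h g2).

End Circle.

(* Main.v *)
(* Fix b < min(alpha, 1/2) and p = 1/b. Lifting the action to R, let g act on
   functions of pairs (x, y) by f |-> f(Fx, Fy) (F'x F'y)^b with F a lift of
   g^-1; the action is isometric for the L^p norm on a strip of width 2 pi. The
   truncation K of |y - x|^(-2b) to 0 < y - x < 1 is not in L^p, but, as b < alpha,
   the lifts move it by L^p functions. The spectral gap of the link, carried
   over from exponent 2 to exponent p by Jensen's inequality, makes averaging over
   the generators contract displacements by a factor theta < 1 as soon as b
   exceeds the threshold of the statement. Iterating from K gives functions X_n
   that stay within bounded L^p distance of K and whose displacements tend to 0.

   If a lift with a fixed point moves y upwards, let e be the limit of the orbit of
   y. The mass of X_n on a box between y and e along the line e is almost invariant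
   on one hand and additive along the orbit on the other, so it tends to 0; hence
   the mass of K on the corner at (e, e) is finite, which is false. So the lifts act
   freely on R, and by Hölder's argument they are either the powers of a single
   lift or commute. In the second case the image is an abelian quotient of the
   group; the same Poincaré inequality kills every real-valued cocycle of the link,
   so this quotient has finite exponent, while lifts of arbitrarily small
   displacement would have too large an order. *)
Require Import Defs.
From HB Require Import structures.
From mathcomp Require Import all_boot all_order all_algebra.
From mathcomp Require Import all_classical all_reals all_analysis.
From Stdlib Require Import Lia.
From mathcomp Require Import lra measurable_realfun.

Set Implicit Arguments.
Unset Strict Implicit.
Unset Printing Implicit Defensive.

Import Order.TTheory GRing.Theory Num.Theory.
Import numFieldNormedType.Exports.

Local Open Scope classical_set_scope.
Local Open Scope ring_scope.

(** * Change of variables *)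

(** With p b = 1 the weight of the action, raised to the power p, is the Jacobian: hence the
    isometry. K^p is (y - x)^-2, not integrable at the diagonal, while a lift with alpha-Hölder
    derivative changes K by O((y - x)^(alpha - 2b)), whose p-th power is integrable there exactly
    when b < alpha. So the regularity allows every p above 1/alpha, and the obstacle is to keep a
    contraction at such a p. At p = 2 it holds because the first eigenvalue 1 - sqrt q / (q + 1) of
    the link exceeds 1/2; passing to p costs the power p/2 - 1 of the number (q^2 + q + 1)(q + 1) of
    edges. The logarithm of this number is the denominator of the threshold, and solving for b = 1/p
    gives the numerator. No limit of the X_n is formed: the geometric decay of the displacements is
    enough, and pointwise convexity inequalities stand in for the triangle inequality of L^p. Lifts
    are chosen element by element, so they compose only up to multiples of 2 pi; functions invariant
    under the diagonal translation do not see this defect and carry a genuine action. *)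

Section Substitution.
Variable R : realType.
Notation mu := (@lebesgue_measure R).

Section Density.
Variables (F G : R -> R).
Hypotheses (incF : {homo F : x y / x < y}) (FK : cancel F G) (GK : cancel G F).
Hypotheses (dF : forall x, derivable F x 1) (cF' : continuous (derive1 F)).

Let F'ge0 x : 0 <= derive1 F x.
Proof.
apply: (@incr_derive1_ge0 _ _ setT) => //; first by move=> ? ? _ _; exact: incF.
by rewrite interiorT.
Qed.

Let cF : continuous F.
Proof. by move=> x; exact/differentiable_continuous/derivable1_diffP/dF. Qed.

Let mF : measurable_fun setT F. Proof. exact: continuous_measurable_fun. Qed.

Let mF' : measurable_fun setT (derive1 F). Proof. exact: continuous_measurable_fun. Qed.

Let mpre A : measurable A -> measurable (F @^-1` A).
Proof. by move=> mA; rewrite -[_ @^-1` _]setTI; exact: mF. Qed.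

Let m (A : set (measurableTypeR R)) : \bar R :=
  (\int[mu]_(y in F @^-1` A) (derive1 F y)%:E)%E.

Let m0 : m set0 = 0%E. Proof. by rewrite /m preimage_set0 integral_set0. Qed.

Let m_ge0 A : (0 <= m A)%E.
Proof. by apply: integral_ge0 => x _; rewrite lee_fin. Qed.

Let m_sigma_additive : semi_sigma_additive m.
Proof.
move=> /= A mA tA mUA; apply: cvg_toP.
  apply: ereal_nondecreasing_is_cvgn => n k nk.
  by apply: lee_sum_nneg_natr => // i _ _; exact: m_ge0.
rewrite /m preimage_bigcup ge0_integral_bigcup//=.
- by move=> i; apply: mpre; exact: mA.
- by apply/measurable_funTS; exact/measurable_EFinP.
- by move=> x _; rewrite lee_fin.
- apply/trivIsetP => i j _ _ ij; rewrite -preimage_setI.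
  by move/trivIsetP : tA => ->//; rewrite preimage_set0.
Qed.

HB.instance Definition _ := isMeasure.Build _ _ _ m m0 m_ge0 m_sigma_additive.

(** The preimage of ]a, b] is ]G a, G b], over which [derive1 F] integrates to b - a by the
    fundamental theorem of calculus; Lebesgue measure is determined by its values on such
    intervals. *)
Let mE A : measurable A -> m A = mu A.
Proof.
move=> mA; apply/esym; move: A mA.
apply: lebesgue_measure_unique => //= _ [[a b]] _ <-.
rewrite lebesgue_measure_itv/= lte_fin.
have GltE x y : (G x < G y) = (x < y).
  have incF' : {mono F : x y / x < y} by exact: leW_mono (le_mono incF).
  by rewrite -incF' !GK.
have -> : m `]a, b] = (\int[mu]_(y in `]G a, G b]) (derive1 F y)%:E)%E.
  congr (integral _ _ _); apply/seteqP; split=> y /=; rewrite !in_itv/=.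
    by move=> /andP[h1 h2]; rewrite -{1 2}(FK y) GltE h1/= leNgt GltE -leNgt.
  by rewrite -{1 2}(FK y) GltE leNgt GltE -leNgt.
case: ifPn => ab; last first.
  by rewrite set_itv_ge ?integral_set0// bnd_simp GltE.
rewrite integral_itv_obnd_cbnd; last by apply/measurable_funTS/measurable_EFinP.
rewrite -[in LHS](GK a) -[in LHS](GK b); apply/esym/continuous_FTC2.
- by rewrite GltE.
- exact: continuous_subspaceT.
- split=> [x _||]; first exact: dF.
    by apply: cvg_at_right_filter; exact: cF.
  by apply: cvg_at_left_filter; exact: cF.
- by [].
Qed.

Import HBNNSimple.

(** [mE] is the case of indicator functions; simple functions follow by linearity and the others by
    monotone convergence. *)
Lemma ge0_integral_substitution (h : measurableTypeR R -> \bar R) :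
  measurable_fun setT h -> (forall x, 0 <= h x)%E ->
  (\int[mu]_y (h (F y) * (derive1 F y)%:E) = \int[mu]_x h x)%E.
Proof.
move=> mh h0; have mF1 : measurable_fun [set: measurableTypeR R] (F : _ -> measurableTypeR R) by exact: mF.
pose h_ := nnsfun_approx measurableT mh.
have mhF n : measurable_fun setT (fun y => (h_ n (F y))%:E * (derive1 F y)%:E)%E.
  apply: emeasurable_funM; apply/measurable_EFinP => //.
  by apply: (measurableT_comp _ mF1); exact: measurable_funP.
transitivity (limn (fun n => \int[mu]_y ((h_ n (F y))%:E * (derive1 F y)%:E)))%E.
  rewrite -monotone_convergence//.
  - apply: eq_integral => y _; apply/esym/cvg_lim => //.
    rewrite muleC; under eq_fun do rewrite muleC.
    by apply: cvgeZl => //; exact: cvg_nnsfun_approx.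
  - by move=> n y _; rewrite mule_ge0// lee_fin.
  - move=> y _ i j ij; apply: lee_wpmul2r; first by rewrite lee_fin.
    have /lefP := nd_nnsfun_approx measurableT mh ij.
    by rewrite lee_fin; exact.
transitivity (limn (fun n => \int[mu]_x (h_ n x)%:E))%E; last first.
  rewrite -monotone_convergence//.
  - by apply: eq_integral => y _; apply/cvg_lim => //; exact: cvg_nnsfun_approx.
  - by move=> n; apply/measurable_EFinP; exact: measurable_funP.
  - by move=> n y _; rewrite lee_fin.
  - by move=> y _ i j ij; rewrite lee_fin; exact/lefP/nd_nnsfun_approx.
congr (limn _); apply/funext => n.
transitivity (\sum_(k \in range (h_ n))
    \int[mu]_y (k * \1_(h_ n @^-1` [set k]) (F y) * derive1 F y)%:E)%E.
  rewrite -ge0_integral_fsum//.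
  - apply: eq_integral => y _; rewrite fimfunE -fsumEFin// ge0_mule_fsuml//.
    by move=> k; exact: nnfun_muleindic_ge0.
  - move=> k; apply/measurable_EFinP; apply: measurable_funM => //.
    apply: measurable_funM => //; apply: (measurableT_comp _ mF1).
    by apply: measurable_indic; exact: measurable_sfunP.
  - by move=> k x _; rewrite lee_fin mulr_ge0//; have := nnfun_muleindic_ge0 (h_ n) k (F x); rewrite lee_fin.
under [RHS]eq_integral do rewrite fimfunE -fsumEFin//.
rewrite ge0_integral_fsum//; last 2 first.
- by move=> y; exact/measurable_EFinP/measurable_funM.
- by move=> y x _; rewrite nnfun_muleindic_ge0.
apply: eq_fsbigr => k _; rewrite integralZl_indic_nnsfun// integral_indic//= setIT.
rewrite -mE; last exact: measurable_sfunP.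
have [k0|k0] := ltP k 0.
  rewrite preimage_nnfun0// m0 mule0.
  by under eq_integral do rewrite indic0/= mulr0 mul0r; rewrite integral0.
under eq_integral do rewrite -mulrA EFinM.
rewrite ge0_integralZl//; last 2 first.
- apply/measurable_EFinP; apply: measurable_funM => //; apply: (measurableT_comp _ mF1).
  by apply: measurable_indic; exact: measurable_sfunP.
- by move=> x _; rewrite lee_fin mulr_ge0// ?indic_ge0.
congr (_ * _)%E; rewrite /m [RHS]integral_mkcond.
apply: eq_integral => y _; rewrite patchE indicE.
have -> : (y \in F @^-1` (h_ n @^-1` [set k])) = (F y \in h_ n @^-1` [set k]).
  by apply/idP/idP; rewrite !inE.
by case: (F y \in _); rewrite ?mul1r ?mul0r.
Qed.

End Density.
End Substitution.

(** * Integrals over the plane and over strips of pairs *)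

Section PlaneIntegrals.
Variable R : realType.
Notation mu := (@lebesgue_measure R).
Notation plane := (measurableTypeR R * measurableTypeR R)%type.
Notation mu2 := (mu \x mu)%E.

Section PlaneSubstitution.
Variables (F G : R -> R).
Hypotheses (incF : {homo F : x y / x < y}) (FK : cancel F G) (GK : cancel G F).
Hypotheses (dF : forall x, derivable F x 1) (cF' : continuous (derive1 F)).

Lemma measurable_pair_map (H : R -> R) :
  measurable_fun [set: measurableTypeR R] (H : _ -> measurableTypeR R) ->
  measurable_fun [set: plane] (fun z => (H z.1, H z.2) : plane).
Proof.
move=> mH; apply: measurable_fun_pair.
  exact: (measurableT_comp mH measurable_fst).
exact: (measurableT_comp mH measurable_snd).
Qed.

Lemma ge0_plane_substitution (g : plane -> \bar R) :
  measurable_fun [set: plane] g -> (forall z, 0 <= g z)%E ->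
  (\int[mu2]_z (g (F z.1, F z.2) * (derive1 F z.1 * derive1 F z.2)%:E) =
   \int[mu2]_z g z)%E.
Proof.
move=> mg g0.
have F'ge0 x : 0 <= derive1 F x.
  apply: (@incr_derive1_ge0 _ _ setT) => //; first by move=> ? ? _ _; exact: incF.
  by rewrite interiorT.
have mF : measurable_fun [set: measurableTypeR R] (F : _ -> measurableTypeR R).
  apply: continuous_measurable_fun => x.
  exact/differentiable_continuous/derivable1_diffP/dF.
have mF' : measurable_fun [set: measurableTypeR R] (derive1 F : _ -> R).
  exact: continuous_measurable_fun.
have mgF : measurable_fun [set: plane] (fun z => g (F z.1, F z.2)).
  exact: (measurableT_comp mg (measurable_pair_map mF)).
rewrite (fubini_tonelli1 (fun z : plane => g (F z.1, F z.2) * (derive1 F z.1 * derive1 F z.2)%:E)%E).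
- rewrite (fubini_tonelli1 g)//.
  rewrite -[RHS](ge0_integral_substitution incF FK GK dF cF').
  + apply: eq_integral => x _.
    rewrite /fubini_F /=.
    transitivity (\int[mu]_y ((derive1 F x)%:E * (g (F x, F y) * (derive1 F y)%:E)))%E.
      by apply: eq_integral => y _; rewrite EFinM muleCA.
    rewrite ge0_integralZl//.
    * rewrite muleC (ge0_integral_substitution incF FK GK dF cF' (h := fun y => g (F x, y)))//.
      exact: measurable_fun_pair2.
    * apply: emeasurable_funM; last exact/measurable_EFinP.
      exact: (measurable_fun_pair2 _ mgF).
    * by move=> y _; rewrite mule_ge0// lee_fin.
    * by rewrite lee_fin.
  + exact: measurable_fun_fubini_tonelli_F.
  + by move=> x; apply: integral_ge0.
- apply: emeasurable_funM => //; apply/measurable_EFinP; apply: measurable_funM.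
  + exact: (measurableT_comp mF' measurable_fst).
  + exact: (measurableT_comp mF' measurable_snd).
- by move=> z; rewrite mule_ge0// lee_fin mulr_ge0.
Qed.

End PlaneSubstitution.

(** A fundamental domain of the half-plane x < y for the diagonal translation by 2 pi; y is
    unbounded above. *)
Definition strip (a : R) : set (R * R) :=
  [set z | a <= z.1 < a + 2 * pi /\ z.1 < z.2].

Lemma measurable_gt_diag : measurable ([set z | z.1 < z.2] : set plane).
Proof.
rewrite (_ : [set z | _] = (fun z : plane => z.2 - z.1 : measurableTypeR R) @^-1` `]0, +oo[%classic).
  rewrite -[X in measurable X]setTI; apply: measurable_funB => //.
by apply/seteqP; split => z /=; rewrite in_itv/= andbT subr_gt0.
Qed.

Lemma measurable_strip a : measurable (strip a : set plane).
Proof.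
rewrite (_ : strip a = ([set` `[a, a + 2 * pi[] `*` setT) `&` [set z | z.1 < z.2]).
  apply: measurableI; last exact: measurable_gt_diag.
  exact: measurableX.
by apply/seteqP; split => z; rewrite /strip /= !in_itv/=; [move=> [-> ->]|move=> [[-> _] ->]].
Qed.

Section PlaneSubstitutionSet.
Variables (F G : R -> R).
Hypotheses (incF : {homo F : x y / x < y}) (FK : cancel F G) (GK : cancel G F).
Hypotheses (dF : forall x, derivable F x 1) (cF' : continuous (derive1 F)).

Lemma ge0_plane_substitution_set (D : set plane) (g : plane -> \bar R) :
  measurable D ->
  measurable_fun [set: plane] g -> (forall z, 0 <= g z)%E ->
  (\int[mu2]_(z in [set z | D (F z.1, F z.2)])
      (g (F z.1, F z.2) * (derive1 F z.1 * derive1 F z.2)%:E) =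
   \int[mu2]_(z in D) g z)%E.
Proof.
move=> mD mg g0; rewrite [RHS]integral_mkcond -(ge0_plane_substitution incF FK GK dF cF').
- rewrite [LHS]integral_mkcond; apply: eq_integral => z _.
  rewrite !patchE (_ : (z \in _) = ((F z.1, F z.2) \in D)).
    by case: (_ \in D) => //; rewrite mul0e.
  by apply/idP/idP; rewrite !inE.
- by apply/(measurable_restrictT _ mD); exact: measurable_funTS.
- by move=> z; rewrite patchE; case: ifP.
Qed.

End PlaneSubstitutionSet.

Lemma ge0_integral_plane_shift (c : R) (D : set plane) (g : plane -> \bar R) :
  measurable D ->
  measurable_fun [set: plane] g -> (forall z, 0 <= g z)%E ->
  (\int[mu2]_(z in [set z | D ((z.1 + c)%R, (z.2 + c)%R)]) g ((z.1 + c)%R, (z.2 + c)%R) =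
   \int[mu2]_(z in D) g z)%E.
Proof.
move=> mD mg g0.
have dE (x : R) : is_derive x (1 : R) (fun y : R => y + c) 1.
  by rewrite -[X in is_derive _ _ _ X]addr0; apply: is_deriveD.
have d1 x : derive1 (fun y : R => y + c) x = 1 by rewrite derive1E derive_val.
rewrite -(@ge0_plane_substitution_set (fun y => y + c) (fun y => y - c) _ _ _ _ _ D g)//.
- by apply: eq_integral => z _; rewrite !d1 mulr1 mule1.
- by move=> x y; rewrite ltrD2r.
- by move=> x; rewrite addrK.
- by move=> x; rewrite subrK.
- have -> : derive1 (fun y : R => y + c) = (fun=> 1 : R) by apply/funext.
  by move=> x; exact: cst_continuous.
Qed.

Definition diag_periodic {T} (g : R * R -> T) :=
  forall x y, g (x + 2 * pi, y + 2 * pi) = g (x, y).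

Lemma integral_stripS a (g : plane -> \bar R) :
  measurable_fun [set: plane] g -> (forall z, 0 <= g z)%E -> diag_periodic g ->
  (\int[mu2]_(z in strip (a + 2 * pi)%R) g z = \int[mu2]_(z in strip a) g z)%E.
Proof.
move=> mg g0 gP.
rewrite -(ge0_integral_plane_shift (2 * pi) (measurable_strip _) mg g0).
rewrite (_ : [set z | _] = strip a).
  by apply: eq_integral => -[x y] _; rewrite gP.
by apply/seteqP; split => z; rewrite /strip/= lerD2r !ltrD2r.
Qed.

(** For c <= d <= c + 2 pi the strips at c and d differ only by the parts x < d and x >= c + 2 pi,
    which the diagonal translation exchanges; larger distances are covered by whole periods. *)
Lemma integral_strip (a b : R) (g : plane -> \bar R) :
  measurable_fun [set: plane] g -> (forall z, 0 <= g z)%E -> diag_periodic g ->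
  (\int[mu2]_(z in strip b) g z = \int[mu2]_(z in strip a) g z)%E.
Proof.
move=> mg g0 gP.
have tau0 : 0 < 2 * pi :> R by rewrite mulr_gt0 ?pi_gt0.
have step (c d : R) : c <= d -> d <= c + 2 * pi ->
    (\int[mu2]_(z in strip d) g z = \int[mu2]_(z in strip c) g z)%E.
  move=> cd dc.
  pose A := strip c `&` [set z | z.1 < d]; pose B := strip c `&` [set z | d <= z.1].
  pose C := [set z : plane | A ((z.1 - 2 * pi)%R, (z.2 - 2 * pi)%R)].
  have mlt (u : R) : measurable ([set z | z.1 < u] : set plane).
    rewrite (_ : [set z | _] = [set` `]-oo, u[] `*` setT); first exact: measurableX.
    by apply/seteqP; split => z; rewrite /= in_itv/=; [move=> ->|case=> ->].
  have mge (u : R) : measurable ([set z | u <= z.1] : set plane).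
    rewrite (_ : [set z | _] = [set` `[u, +oo[] `*` setT); first exact: measurableX.
    by apply/seteqP; split => z; rewrite /= in_itv/= andbT; [move=> ->|case=> ->].
  have mA : measurable (A : set plane) by apply: measurableI (measurable_strip _) (mlt d).
  have mB : measurable (B : set plane) by apply: measurableI (measurable_strip _) (mge d).
  have CE : C = strip d `&` [set z | c + 2 * pi <= z.1].
    apply/seteqP; split => z; rewrite /C/A/strip/=.
      by move=> [[/andP[h1 h2] h3] h4]; split; [split; [apply/andP; split|]|]; lra.
    by move=> [[/andP[h1 h2] h3] h4]; split; [split; [apply/andP; split|]|]; lra.
  have BE : B = strip d `&` [set z | z.1 < c + 2 * pi].
    apply/seteqP; split => z; rewrite /B/strip/=.
      by move=> [[/andP[h1 h2] h3] h4]; split; [split; [apply/andP; split|]|]; lra.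
    by move=> [[/andP[h1 h2] h3] h4]; split; [split; [apply/andP; split|]|]; lra.
  have mC : measurable (C : set plane).
    by rewrite CE; apply: measurableI (measurable_strip _) (mge _).
  have -> : strip d = B `|` C.
    rewrite BE CE -setIUr; apply/esym/setIidPl => z _ /=.
    by case: (ltP z.1 (c + 2 * pi)); [left|right].
  have -> : strip c = B `|` A.
    rewrite /A /B -setIUr; apply/esym/setIidPl => z _ /=.
    by case: (ltP z.1 d); [right|left].
  rewrite !ge0_integral_setU//=.
  - congr (_ + _)%E.
    rewrite -(ge0_integral_plane_shift (- (2 * pi)) mA mg g0).
    by apply: eq_integral => -[x y] _; rewrite -[in LHS](subrK (2 * pi) x) -[in LHS](subrK (2 * pi) y) gP.
  - by apply: measurable_funTS.
  - by rewrite /A /B disj_set2E; apply/eqP/seteqP; split => // z /= [[_ +] [_ +]]; rewrite leNgt => /negP.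
  - by apply: measurable_funTS.
  - by rewrite BE CE disj_set2E; apply/eqP/seteqP; split => // z /= [[_ +] [_ +]]; rewrite leNgt => + /negP.
have stepn (n : nat) c : (\int[mu2]_(z in strip (c + n%:R * (2 * pi))%R) g z = \int[mu2]_(z in strip c) g z)%E.
  elim: n => [|n ih]; first by rewrite mul0r addr0.
  by rewrite -ih -[in RHS]integral_stripS// -addrA -[in LHS]natr1 mulrDl mul1r.
wlog ab : a b / a <= b.
  by move=> H; have [ab|/ltW ba] := leP a b; [exact: H|apply/esym/H].
pose n := Num.truncn ((b - a) / (2 * pi)).
have q0 : 0 <= (b - a) / (2 * pi) by rewrite divr_ge0 ?subr_ge0// ltW.
have := Num.Theory.truncn_itv q0; rewrite -/n => /andP[h1 h2].
rewrite -(stepn n a); apply: step.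
  by rewrite -lerBrDl -ler_pdivlMr.
move: h2; rewrite ltr_pdivrMr// -natr1 mulrDl mul1r => h2; lra.
Qed.

Section StripSubstitution.
Variables (F G : R -> R).
Hypotheses (incF : {homo F : x y / x < y}) (FK : cancel F G) (GK : cancel G F).
Hypotheses (dF : forall x, derivable F x 1) (cF' : continuous (derive1 F)).
Hypothesis FP : forall x, F (x + 2 * pi) = F x + 2 * pi.

(** A lift carries the strip at a onto the strip at F a, and all strips give the same integral. *)
Lemma integral_strip_substitution a (g : plane -> \bar R) :
  measurable_fun [set: plane] g -> (forall z, 0 <= g z)%E -> diag_periodic g ->
  (\int[mu2]_(z in strip a)
      (g (F z.1, F z.2) * (derive1 F z.1 * derive1 F z.2)%:E) =
   \int[mu2]_(z in strip a) g z)%E.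
Proof.
move=> mg g0 gP.
have Fle : {mono F : x y / x <= y} by exact: le_mono.
have Flt : {mono F : x y / x < y} by exact: leW_mono.
rewrite -[RHS](integral_strip a (F a))//.
rewrite -(ge0_plane_substitution_set incF FK GK dF cF' (measurable_strip (F a)) mg g0).
congr (integral _ _ _); apply/seteqP; split => z; rewrite /strip/=.
  by rewrite -FP Fle !Flt.
by rewrite -FP Fle !Flt.
Qed.

End StripSubstitution.
End PlaneIntegrals.

(** * Incidence in the projective plane *)

Section IncidenceCounting.
Variables (A B : finType) (I : A -> B -> bool) (q : nat).
Hypotheses (q0 : (0 < q)%N) (cardA : #|A| = (q ^ 2 + q + 1)%N).
Hypothesis card_row : forall L, #|[pred P | I P L]| = q.+1.
Hypothesis card_common : forall P Q, P != Q -> #|[pred L | I P L && I Q L]| = 1%N.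

(** Double counting of the pairs (L, Q) with Q distinct from P and both on L: each L through P has q
    such Q, and each of the q (q + 1) points Q determines one L. *)
Lemma card_pencil P : #|[pred L | I P L]| = q.+1.
Proof.
have : (\sum_(L | I P L) \sum_(Q | Q != P) (I Q L : nat) =
        \sum_(Q | Q != P) \sum_(L | I P L) (I Q L : nat))%N.
  exact: exchange_big.
have -> : (\sum_(L | I P L) \sum_(Q | Q != P) (I Q L : nat) =
    #|[pred L | I P L]| * q)%N.
  rewrite -sum_nat_const; apply: eq_bigr => L PL.
  have := card_row L; rewrite (cardD1 P) inE PL add1n => -[<-].
  rewrite -sum1_card big_mkcond [RHS]big_mkcond /=; apply: eq_bigr => Q _.
  by rewrite !inE; case: (Q == P) => //=; case: (I Q L).
have -> : (\sum_(Q | Q != P) \sum_(L | I P L) (I Q L : nat) = q * q.+1)%N.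
  transitivity (\sum_(Q | Q != P) 1)%N; last first.
    rewrite sum1_card; transitivity #|predC1 P|.
      by apply: fintype.eq_card => Q; rewrite !inE.
    by rewrite cardC1 cardA expnS expn1 addn1 mulnS addnC.
  apply: eq_bigr => Q; rewrite eq_sym => PQ; rewrite -(card_common PQ) -sum1_card.
  rewrite big_mkcond [RHS]big_mkcond /=; apply: eq_bigr => L _.
  by rewrite !inE; case: (I P L) => //=; case: (I Q L).
rewrite mulnC => /eqP; rewrite eqn_pmul2l ?q0// => /eqP ->.
by [].
Qed.

Lemma card_blocks : #|B| = (q ^ 2 + q + 1)%N.
Proof.
apply/eqP; rewrite -cardA -(eqn_pmul2r (ltn0Sn q)) -!sum_nat_const.
under eq_bigr => L _ do rewrite -(card_row L) -sum1_card big_mkcond.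
under [eqbRHS]eq_bigr => P _ do rewrite -(card_pencil P) -sum1_card big_mkcond.
by rewrite exchange_big.
Qed.

End IncidenceCounting.

Section FiniteSubspaces.
Import VectorInternalTheory.
Variables (F : finFieldType) (n : nat).
HB.instance Definition _ := [Countable of {vspace 'rV[F]_n} by <:].
HB.instance Definition _ := [Finite of {vspace 'rV[F]_n} by <:].
End FiniteSubspaces.
HB.instance Definition _ (F : finFieldType) := Finite.on (proj_point F).
HB.instance Definition _ (F : finFieldType) := Finite.on (proj_line F).

Section PlaneCounting.
Variable F : finFieldType.
Notation q := #|F|.
Notation V3 := 'rV[F]_3.

Lemma card_subspace (V : {vspace V3}) : #|V| = (q ^ \dim V)%N.
Proof.
pose f (c : {ffun 'I_(\dim V) -> F}) : V3 := \sum_i c i *: (vbasis V)`_i.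
have f_inj : injective f.
  move=> c d cd; apply/ffunP => i.
  have fr : free (vbasis V) := basis_free (vbasisP V).
  by rewrite -(coord_sum_free c i fr) -(coord_sum_free d i fr) -/(f c) -/(f d) cd.
transitivity #|{ffun 'I_(\dim V) -> F}|; last by rewrite card_ffun card_ord.
rewrite -(card_codom f_inj); apply: eq_card => v.
apply/idP/codomP => [vV|[c ->]].
  exists [ffun i => coord (vbasis V) i v]; rewrite /f [LHS](coord_vbasis vV).
  by apply: eq_bigr => i _; rewrite ffunE.
by apply: rpred_sum => i _; rewrite rpredZ// vbasis_mem// memt_nth.
Qed.

Lemma card_finField_gt1 : (1 < q)%N.
Proof. by apply/card_gt1P; exists 0, 1; split; rewrite ?inE// eq_sym oner_eq0. Qed.

Definition point_of (v : V3) (v0 : v != 0) : proj_point F.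
Proof. by exists <[v]>%VS; rewrite dim_vline v0. Defined.

Lemma mem_pointE (v : V3) (v0 : v != 0) (P : proj_point F) :
  (v \in val P) = (P == point_of v0).
Proof.
apply/idP/eqP => [vP|->]; last by rewrite /= memv_line.
apply/val_inj/eqP; rewrite eq_sym eqEdim /= -memvE vP dim_vline v0.
by have /= /eqP -> := valP P.
Qed.

(** Each nonzero vector of W spans exactly one point, and each point carries q - 1 nonzero
    vectors. *)
Lemma card_points_sub (W : {vspace V3}) :
  (#|[pred P : proj_point F | (val P <= W)%VS]| * q.-1 = (q ^ \dim W).-1)%N.
Proof.
have nz (U : {vspace V3}) : #|U|.-1 = #|[predD1 U & 0]|.
  by rewrite (cardD1 (0 : V3) U) (mem0v U).
rewrite -card_subspace nz.
transitivity (\sum_(P : proj_point F | (val P <= W)%VS)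
    \sum_(v : V3 | v != 0%R) (v \in val P : nat))%N.
  rewrite -sum_nat_const; apply: eq_bigr => P _.
  have -> : q.-1 = #|[predD1 (val P) & 0]|.
    by rewrite -nz card_subspace (eqP (valP P)) expn1.
  rewrite -sum1_card big_mkcond [RHS]big_mkcond/=; apply: eq_bigr => v _.
  by rewrite !inE; case: (v == 0%R :> V3) => //=; case: (v \in _).
rewrite exchange_big /= -sum1_card big_mkcond [RHS]big_mkcond /=.
apply: eq_bigr => v _; rewrite !inE; case: eqP => [//|/eqP v0] /=.
rewrite big_mkcond (bigD1 (point_of v0)) //= big1; last first.
  move=> P /negbTE; rewrite -(mem_pointE v0) => ->.
  by case: ifP.
by rewrite memv_line addn0 -memvE; case: ifP.
Qed.

Lemma card_points : #|{: proj_point F}| = (q ^ 2 + q + 1)%N.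
Proof.
have := card_points_sub fullv; rewrite -card_subspace.
have -> : #|(fullv : {vspace V3})| = (q ^ 3)%N.
  by rewrite -(card_mx F 1 3); apply: eq_card => v; rewrite memvf.
rewrite (eq_card (B := {: proj_point F})); last by move=> P; rewrite !inE subvf.
have := card_finField_gt1; case: q => [|[|n]]// _ /= h.
apply/eqP; rewrite -(eqn_pmul2r (ltn0Sn n)) h; apply/eqP; rewrite !expnS expn0.
lia.
Qed.

Lemma card_points_on_line (L : proj_line F) :
  #|[pred P : proj_point F | incident P L]| = q.+1.
Proof.
have := card_points_sub (val L); rewrite (eqP (valP L)) /incident.
have := card_finField_gt1; case: q => [|[|n]]// _ /= h.
apply/eqP; rewrite -(eqn_pmul2r (ltn0Sn n)) h; apply/eqP; rewrite !expnS expn0.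
lia.
Qed.

Lemma dim_addv_points (P Q : proj_point F) : P != Q -> \dim (val P + val Q) = 2%N.
Proof.
move=> PQ; apply/eqP; rewrite eqn_leq; apply/andP; split.
  by have := (dimv_add_leqif (val P) (val Q)).1; rewrite (eqP (valP P)) (eqP (valP Q)).
rewrite ltnNge; apply: contra PQ => d1; apply/eqP/val_inj/eqP.
have dP : \dim (val P) = 1%N by rewrite (eqP (valP P)).
have dQ : \dim (val Q) = 1%N by rewrite (eqP (valP Q)).
have h1 : (val P == val P + val Q)%VS by rewrite eqEdim addvSl dP.
have h2 : (val Q == val P + val Q)%VS by rewrite eqEdim addvSr dQ.
by rewrite {1}(eqP h1) eq_sym.
Qed.

Definition line_through (P Q : proj_point F) (PQ : P != Q) : proj_line F :=
  exist _ (val P + val Q)%VS (introT eqP (dim_addv_points PQ)).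

Lemma line_throughP (P Q : proj_point F) (PQ : P != Q) (L : proj_line F) :
  incident P L && incident Q L = (L == line_through PQ).
Proof.
apply/idP/eqP => [|->]; last by rewrite /incident /= addvSl addvSr.
rewrite /incident -subv_add => PQL; apply/val_inj/eqP => /=.
by rewrite eq_sym eqEdim PQL dim_addv_points// (eqP (valP L)).
Qed.

Lemma card_common_lines (P Q : proj_point F) : P != Q ->
  #|[pred L : proj_line F | incident P L && incident Q L]| = 1%N.
Proof.
move=> PQ; apply: (fintype.eq_card1 (x := line_through PQ)) => L.
by rewrite !inE (line_throughP PQ).
Qed.

Lemma card_lines_through (P : proj_point F) :
  #|[pred L : proj_line F | incident P L]| = q.+1.
Proof.
apply: (card_pencil _ card_points card_points_on_line card_common_lines).
exact: ltnW card_finField_gt1.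
Qed.

End PlaneCounting.

(** * Spectral gap and Poincaré inequality of the link *)

Section SpectralGap.
Variables (R : realType) (A B : finType) (I : A -> B -> bool) (q : nat).
Hypotheses (q0 : (0 < q)%N) (cardA : #|A| = (q ^ 2 + q + 1)%N).
Hypothesis card_row : forall L, #|[pred P | I P L]| = q.+1.
Hypothesis card_common : forall P Q, P != Q -> #|[pred L | I P L && I Q L]| = 1%N.

Definition bip_edge (x y : A + B) : bool :=
  match x, y with inl P, inr L => I P L | inr L, inl P => I P L | _, _ => false end.

Lemma sum_boolR (T : finType) (a : pred T) : \sum_x ((a x)%:R : R) = #|a|%:R.
Proof.
rewrite -sum1_card natr_sum [RHS]big_mkcond /=; apply: eq_bigr => x _.
by rewrite unfold_in; case: (a x).
Qed.

Lemma sum_incident_row L : \sum_P ((I P L)%:R : R) = q.+1%:R.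
Proof. by rewrite (sum_boolR (fun P => I P L)) -(card_row L). Qed.

Lemma sum_incident_col P : \sum_L ((I P L)%:R : R) = q.+1%:R.
Proof. by rewrite (sum_boolR (fun L => I P L)) -(card_pencil q0 cardA card_row card_common P). Qed.

Lemma sum_incident_common P Q :
  \sum_L ((I P L)%:R * (I Q L)%:R : R) = 1 + (P == Q)%:R * q%:R.
Proof.
under eq_bigr do rewrite -natrM mulnb.
rewrite (sum_boolR (fun L => I P L && I Q L)); case: eqP => [->|/eqP PQ].
  rewrite mul1r nat1r -(card_pencil q0 cardA card_row card_common Q).
  by congr (_%:R); apply: fintype.eq_card => L; rewrite !inE unfold_in andbb.
transitivity (#|[pred L | I P L && I Q L]|%:R : R).
  by congr (_%:R); apply: fintype.eq_card => L; rewrite !inE.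
by rewrite card_common// mul0r addr0.
Qed.

Section Bilinear.
Variables (u : A -> R) (v : B -> R).
Hypothesis uv0 : \sum_P u P + \sum_L v L = 0.

Let U := \sum_P u P.
Let w L := \sum_P (I P L)%:R * u P.
Let X := \sum_L v L * w L.
Let u2 := \sum_P u P ^+ 2.
Let v2 := \sum_L v L ^+ 2.

Let sum_w : \sum_L w L = q.+1%:R * U.
Proof.
rewrite exchange_big /= mulr_sumr; apply: eq_bigr => P _.
by rewrite -mulr_suml sum_incident_col.
Qed.

(** With M the incidence matrix, w = M u and M^T M = q I + J, J being the all-ones matrix, since two
    distinct points share exactly one line. *)
Let sum_w2 : \sum_L w L ^+ 2 = q%:R * u2 + U ^+ 2.
Proof.
transitivity (\sum_P \sum_Q u P * u Q * \sum_L ((I P L)%:R * (I Q L)%:R)).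
  under eq_bigr => L _ do rewrite expr2 mulr_suml.
  rewrite exchange_big; apply: eq_bigr => P _ /=.
  under eq_bigr => L _ do rewrite mulr_sumr.
  rewrite exchange_big; apply: eq_bigr => Q _ /=; rewrite mulr_sumr.
  by apply: eq_bigr => L _; lra.
rewrite [U ^+ 2]expr2 {1}/U mulr_suml /u2 mulr_sumr -big_split /=.
apply: eq_bigr => P _; rewrite /U mulr_sumr (bigD1 P)//= [in RHS](bigD1 P)//=.
rewrite sum_incident_common eqxx mul1r; set a := \sum_(i | _) _; set b := \sum_(i | _) _.
have -> : a = b; last by lra.
by apply: eq_bigr => Q QP; rewrite sum_incident_common eq_sym (negbTE QP) mul0r addr0 mulr1.
Qed.

Let n : R := #|B|%:R.

(** On functions of sum zero M has norm sqrt q, but only u and v together have sum zero here. The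
    square of s v - w is therefore corrected by a constant c proportional to the sum U of u, so that
    the terms in U^2 get a favourable sign. *)
Let cross_bound : 2 * Num.sqrt q%:R * X <= q%:R * (u2 + v2).
Proof.
have nE : n = q%:R ^+ 2 + q%:R + 1.
  by rewrite /n (card_blocks q0 cardA card_row card_common) !natrD natrX.
have q1 : 1 <= q%:R :> R by rewrite ler1n.
pose s : R := Num.sqrt q%:R.
have s2 : s ^+ 2 = q%:R by rewrite sqr_sqrtr.
have s0 : 0 <= s by rewrite sqrtr_ge0.
have n0 : 0 < n by rewrite nE; nra.
(* This t minimises 1 + n t^2 - 2 t (s + q + 1), the coefficient of U^2 in the sum of squares, and
   makes it 1 - t (s + q + 1), which is not positive. *)
pose t := (s + q%:R + 1) / n; pose c := t * U.
have tn : n * t = s + q%:R + 1 by rewrite /t mulrCA divff ?mulr1// gt_eqF.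
have vU : \sum_L v L = - U by move: uv0; rewrite -/U; lra.
have : 0 <= \sum_L (s * v L - w L + c) ^+ 2 by apply: sumr_ge0 => L _; exact: sqr_ge0.
have -> : \sum_L (s * v L - w L + c) ^+ 2 =
    s ^+ 2 * v2 + \sum_L w L ^+ 2 + n * c ^+ 2 - 2 * s * X + 2 * c * s * \sum_L v L
      - 2 * c * \sum_L w L.
  rewrite /v2 /X !mulr_sumr.
  have -> : n * c ^+ 2 = \sum_(L : B) c ^+ 2 by rewrite sumr_const /n mulr_natl.
  rewrite -!big_split -!sumrN -!big_split /=; apply: eq_bigr => L _; lra.
rewrite sum_w sum_w2 vU s2 -/s.
have q1E : q.+1%:R = q%:R + 1 :> R by rewrite natr1.
rewrite q1E.
have -> : n * c ^+ 2 = (n * t) * t * U ^+ 2 by rewrite /c; lra.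
rewrite tn.
have key : t * (s + q%:R + 1) >= 1.
  rewrite -(ler_pM2l n0) mulrA tn mulr1 nE; nra.
rewrite /c; have := sqr_ge0 U; nra.
Qed.

Lemma bipartite_gap :
  (q.+1%:R - Num.sqrt q%:R) * (u2 + v2) <=
  \sum_P \sum_L (I P L)%:R * (u P - v L) ^+ 2.
Proof.
have -> : \sum_P \sum_L (I P L)%:R * (u P - v L) ^+ 2 =
    q.+1%:R * (u2 + v2) - 2 * X.
  have -> : \sum_P \sum_L (I P L)%:R * (u P - v L) ^+ 2 =
     \sum_P \sum_L ((I P L)%:R * u P ^+ 2) + \sum_P \sum_L ((I P L)%:R * v L ^+ 2)
     - 2 * \sum_P \sum_L (I P L)%:R * u P * v L.
    rewrite mulr_sumr -sumrN -!big_split; apply: eq_bigr => P _ /=.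
    rewrite mulr_sumr -sumrN -!big_split; apply: eq_bigr => L _ /=; lra.
  rewrite mulrDr; congr (_ + _ - 2 * _).
  - rewrite mulr_sumr; apply: eq_bigr => P _.
    by rewrite -mulr_suml sum_incident_col.
  - rewrite exchange_big mulr_sumr; apply: eq_bigr => L _ /=.
    by rewrite -mulr_suml sum_incident_row.
  - rewrite exchange_big; apply: eq_bigr => L _ /=; rewrite mulr_sumr.
    by apply: eq_bigr => P _; lra.
rewrite mulrBl lerD2l lerN2.
have s0 : 0 < Num.sqrt q%:R :> R by rewrite sqrtr_gt0 ltr0n.
have s2 : Num.sqrt q%:R ^+ 2 = q%:R :> R by rewrite sqr_sqrtr.
have H : 2 * Num.sqrt q%:R * X <= Num.sqrt q%:R ^+ 2 * (u2 + v2).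
  by rewrite s2; exact: cross_bound.
by rewrite -(ler_pM2l s0); lra.
Qed.

End Bilinear.

(** The gap q + 1 - sqrt q of the graph Laplacian; the factor 1/2 compensates for each edge being
    counted in both directions. *)
Lemma bip_spectral_gap (f : A + B -> R) (m : R) :
  \sum_x f x = #|{: A + B}|%:R * m ->
  (q.+1%:R - Num.sqrt q%:R) * \sum_x (f x - m) ^+ 2 <=
  2^-1 * \sum_x \sum_y (bip_edge x y)%:R * (f x - f y) ^+ 2.
Proof.
move=> fm.
pose u P := f (inl P) - m; pose v L := f (inr L) - m.
have uv0 : \sum_P u P + \sum_L v L = 0.
  have : \sum_x (f x - m) = 0 by rewrite sumrB fm sumr_const mulr_natl subrr.
  by rewrite big_sumType.
have := bipartite_gap uv0; rewrite big_sumType /=.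
move=> /le_trans; apply.
rewrite big_sumType /=.
under [X in _ <= 2^-1 * (X + _)]eq_bigr => P _ do rewrite big_sumType /=.
under [X in _ <= 2^-1 * (_ + X)]eq_bigr => P _ do rewrite big_sumType /=.
rewrite !big_split /= [X in _ <= 2^-1 * (X + _ + _)]big1; last first.
  by move=> P _; apply: big1 => Q _; rewrite mul0r.
rewrite [X in _ <= 2^-1 * (_ + (_ + X))]big1; last first.
  by move=> P _; apply: big1 => Q _; rewrite mul0r.
rewrite [X in _ <= 2^-1 * (_ + (X + _))]exchange_big /=.
rewrite add0r addr0.
set a := \sum_P _; set b := \sum_P _; set c := \sum_P _.
have -> : b = a.
  by apply: eq_bigr => P _; apply: eq_bigr => L _; rewrite /u /v; lra.
have -> : c = a.
  by apply: eq_bigr => P _; apply: eq_bigr => L _; rewrite /u /v; lra.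
lra.
Qed.

End SpectralGap.

(** * Convexity inequalities for powers *)

Section PowerMeans.
Variable R : realType.

(** The graph of x^r lies above its tangent at m; this is Young's inequality for b and m^(r - 1)
    with conjugate exponents r and r / (r - 1). *)
Lemma powR_tangent (r b m : R) : 1 < r -> 0 <= b -> 0 <= m ->
  r * (b * m `^ (r - 1)) <= b `^ r + (r - 1) * m `^ r.
Proof.
move=> r1 b0 m0.
have r0 : 0 < r by lra.
have r10 : 0 < r - 1 by lra.
have h := @conjugate_powR R b (m `^ (r - 1)) r (r / (r - 1)) b0 (powR_ge0 _ _) r0.
have {}h := h (divr_gt0 r0 r10).
have e1 : r^-1 + (r / (r - 1))^-1 = 1.
  by rewrite invf_div -{1}[r^-1]mul1r -mulrDl addrC subrK divff// gt_eqF.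
have {}h := h e1.
have e2 : (m `^ (r - 1)) `^ (r / (r - 1)) = m `^ r.
  by rewrite -powRrM mulrCA divff ?mulr1// gt_eqF.
rewrite e2 invf_div in h.
have := ler_wpM2l (ltW r0) h => {}h; apply: (le_trans h).
rewrite mulrDr mulrCA divff ?gt_eqF// mulr1 lerD2l.
by rewrite mulrCA [r * _]mulrC mulfVK ?gt_eqF// mulrC.
Qed.

(** Sum of the tangent inequalities at the weighted mean m of the b i. The weights are not
    normalised, whence the power of their total. *)
Lemma powR_jensen (T : finType) (c b : T -> R) (r : R) : 1 < r ->
  (forall i, 0 <= c i) -> (forall i, 0 <= b i) ->
  (\sum_i c i * b i) `^ r <= (\sum_i c i) `^ (r - 1) * \sum_i c i * b i `^ r.
Proof.
move=> r1 c0 b0.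
set S := \sum_i c i * b i; set W := \sum_i c i.
have S0 : 0 <= S by apply: sumr_ge0 => i _; rewrite mulr_ge0.
have [W0|W0] := eqVneq W 0.
  have -> : S = 0.
    apply: big1 => i _; have := psumr_eq0P (fun i _ => c0 i) W0 => ->//.
    by rewrite mul0r.
  rewrite powR0 ?gt_eqF ?(lt_trans ltr01)// mulr_ge0 ?powR_ge0//.
  by apply: sumr_ge0 => i _; rewrite mulr_ge0// powR_ge0.
have Wp : 0 < W by rewrite lt_neqAle eq_sym W0 sumr_ge0.
pose m := S / W.
have m0 : 0 <= m by rewrite divr_ge0// ltW.
have SE : S = W * m by rewrite /m mulrCA divff ?mulr1.
have mr : m * m `^ (r - 1) = m `^ r.
  have [->|mn0] := eqVneq m 0; first by rewrite mul0r powR0// gt_eqF// (lt_trans ltr01).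
  by rewrite -{1}(powRr1 m0) -powRD ?mn0 ?implybT// addrC subrK.
have H : r * (S * m `^ (r - 1)) <= (\sum_i c i * b i `^ r) + (r - 1) * (W * m `^ r).
  have -> : r * (S * m `^ (r - 1)) = \sum_i c i * (r * (b i * m `^ (r - 1))).
    by rewrite /S mulr_suml mulr_sumr; apply: eq_bigr => i _; lra.
  have -> : (r - 1) * (W * m `^ r) = \sum_i c i * ((r - 1) * m `^ r).
    by rewrite /W -mulr_suml; lra.
  rewrite -big_split; apply: ler_sum => i _ /=.
  by rewrite -mulrDr ler_wpM2l//; exact: powR_tangent.
have {}H : W * m `^ r <= \sum_i c i * b i `^ r.
  by move: H; rewrite SE -mulrA mr; lra.
rewrite SE powRM ?(ltW Wp)//.
have -> : W `^ r = W `^ (r - 1) * W.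
  by rewrite -{3}(powRr1 (ltW Wp)) -powRD ?W0 ?implybT// subrK.
by rewrite -mulrA ler_wpM2l// powR_ge0.
Qed.

Lemma sum_powR_le (T : finType) (a : T -> R) (r : R) : 1 < r ->
  (forall i, 0 <= a i) -> \sum_i a i `^ r <= (\sum_i a i) `^ r.
Proof.
move=> r1 a0; set S := \sum_i a i.
have S0 : 0 <= S by exact: sumr_ge0.
have split (x : R) : 0 <= x -> x `^ r = x * x `^ (r - 1).
  move=> x0; have [->|xn0] := eqVneq x 0.
    by rewrite mul0r powR0// gt_eqF// (lt_trans ltr01).
  by rewrite -{2}(powRr1 x0) -powRD ?xn0 ?implybT// addrC subrK.
rewrite (split S)// {1}/S mulr_suml; apply: ler_sum => i _.
rewrite split// ler_wpM2l// ge0_ler_powR ?nnegrE ?subr_ge0 ?(ltW r1)//.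
by rewrite /S (bigD1 i)//= lerDl sumr_ge0.
Qed.

Lemma normr_powR_half (x p : R) : `|x| `^ p = (x ^+ 2) `^ (p / 2).
Proof.
by rewrite -real_normK ?num_real// -powR_mulrn// -powRrM mulrCA divff ?mulr1//.
Qed.

End PowerMeans.

(** * The Poincaré inequality of the link with exponent p *)

Section LinkPoincare.
Variables (R : realType) (A B : finType) (I : A -> B -> bool) (q : nat).
Hypotheses (q1 : (1 < q)%N) (cardA : #|A| = (q ^ 2 + q + 1)%N).
Hypothesis card_row : forall L, #|[pred P | I P L]| = q.+1.
Hypothesis card_common : forall P Q, P != Q -> #|[pred L | I P L && I Q L]| = 1%N.

Let lam : R := 1 - Num.sqrt q%:R / (q%:R + 1).
Let N : R := (q%:R ^+ 2 + q%:R + 1) * (q%:R + 1).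

(** With r = p / 2, the sum of |f - m|^p is at most the r-th power of the sum of squares; the
    spectral gap bounds the latter by a sum over ordered edges, and Jensen's inequality brings the
    r-th power inside at the cost of (2 N)^(r - 1), where [N] is the number of edges. *)
Lemma link_poincare (p : R) : 2 < p ->
  (p / 2 - 1) * ln N < p / 2 * ln (2 * lam) ->
  exists2 theta : R, 0 <= theta < 1 &
    forall (f : A + B -> R) (m : R), \sum_x f x = #|{: A + B}|%:R * m ->
    q.+1%:R * \sum_x `|f x - m| `^ p <=
      theta * \sum_x \sum_y (bip_edge I x y)%:R * `|f x - f y| `^ p.
Proof.
move=> p2; set r := p / 2 => hr.
have q0 : (0 < q)%N by exact: ltnW.
have Q2 : 2 <= q%:R :> R by rewrite ler_nat.
have r1 : 1 < r by rewrite /r; lra.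
pose s : R := Num.sqrt q%:R.
have s2 : s ^+ 2 = q%:R by rewrite sqr_sqrtr// ler0n.
have s0 : 0 <= s by rewrite sqrtr_ge0.
have N0 : 0 < N by rewrite /N; nra.
pose D := q.+1%:R - s.
have qE : q.+1%:R = q%:R + 1 :> R by rewrite natr1.
have D0 : 0 < D by rewrite /D qE; nra.
have DE : D = (q%:R + 1) * lam.
  by rewrite /D /lam -/s qE mulrBr mulr1 mulrCA divff ?mulr1// gt_eqF//; lra.
have lam0 : 0 < lam by rewrite -(@pmulr_rgt0 _ (q%:R + 1)) -?DE//; lra.
pose K := (2 * D)^-1 `^ r * (2 * N) `^ (r - 1).
have K0 : 0 <= K by rewrite mulr_ge0 ?powR_ge0.
exists (q.+1%:R * K).
  rewrite mulr_ge0 ?ler0n//=.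
  have K_gt0 : 0 < q.+1%:R * K.
    by rewrite mulr_gt0 ?ltr0n// mulr_gt0// powR_gt0 ?invr_gt0// mulr_gt0.
  rewrite -ltr_ln ?posrE// ln1 lnM ?posrE ?ltr0n//; last first.
    by rewrite mulr_gt0 ?powR_gt0 ?invr_gt0 ?mulr_gt0.
  rewrite /K lnM ?posrE ?powR_gt0 ?invr_gt0 ?mulr_gt0//.
  rewrite !ln_powR lnV ?posrE ?mulr_gt0// DE.
  have q10 : 0 < q%:R + 1 :> R by lra.
  rewrite (_ : 2 * ((q%:R + 1) * lam) = (q%:R + 1) * (2 * lam)); last by lra.
  rewrite lnM ?posrE// ?mulr_gt0// [ln (2 * N)]lnM ?posrE// qE.
  (* The logarithm of theta is (r - 1) ln N - r ln (2 lam), negative by hypothesis, plus (r - 1) (ln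
     2 - ln (q + 1)), which is at most 0. *)
  have l2 : ln 2 <= ln (q%:R + 1) :> R by rewrite ler_ln ?posrE//; lra.
  nra.
move=> f m fm.
rewrite -mulrA ler_wpM2l ?ler0n//.
under eq_bigr do rewrite normr_powR_half.
apply: (le_trans (sum_powR_le r1 (fun i => sqr_ge0 (f i - m)))).
have gap := bip_spectral_gap q0 cardA card_row card_common fm.
rewrite -/s -/D in gap.
set T := \sum_x \sum_y _ in gap.
have {}gap : \sum_x (f x - m) ^+ 2 <= (2 * D)^-1 * T.
  by rewrite invfM -mulrA [D^-1 * _]mulrC mulrA ler_pdivlMr// mulrC.
have T0 : 0 <= T.
  by apply: sumr_ge0 => x _; apply: sumr_ge0 => y _; rewrite mulr_ge0 ?ler0n ?sqr_ge0.
apply: (@le_trans _ _ (((2 * D)^-1 * T) `^ r)).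
  apply: ge0_ler_powR; rewrite ?nnegrE//; first by lra.
    by apply: sumr_ge0 => x _; exact: sqr_ge0.
  by rewrite mulr_ge0 ?invr_ge0 ?mulr_ge0// ltW.
rewrite powRM ?invr_ge0 ?mulr_ge0 ?(ltW D0)// /K -mulrA ler_wpM2l ?powR_ge0//.
have -> : T = \sum_(z : (A + B) * (A + B)) (bip_edge I z.1 z.2)%:R * (f z.1 - f z.2) ^+ 2.
  by rewrite /T pair_bigA.
rewrite pair_bigA /=.
have J := @powR_jensen R _ (fun z : (A + B) * (A + B) => (bip_edge I z.1 z.2)%:R)
   (fun z => (f z.1 - f z.2) ^+ 2) r r1.
have {}J := J (fun _ => ler0n _ _) (fun _ => sqr_ge0 _).
apply: (le_trans J).
rewrite le_eqVlt; apply/orP; left; apply/eqP; congr (_ * _); last first.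
  by apply: eq_bigr => z _; rewrite normr_powR_half.
congr (_ `^ _).
(* The total weight in Jensen's inequality is the number of ordered edges, 2 N. *)
rewrite -(pair_bigA _ (fun x y => (bip_edge I x y)%:R : R)) /= big_sumType /=.
under eq_bigr => P _ do
  rewrite big_sumType /= big1 ?add0r ?(sum_incident_col _ q0 cardA card_row card_common P)//.
under [X in _ + X]eq_bigr => L _ do
  rewrite big_sumType /= [X in _ + X]big1 ?addr0 ?(sum_incident_row _ card_row L)//.
rewrite !sumr_const cardA (card_blocks q0 cardA card_row card_common).
rewrite -!(mulr_natr (q.+1%:R : R)) !natrD natrX /N qE; lra.
Qed.

End LinkPoincare.

(** * Contraction by averaging over the generators *)

Section PowerEnergy.
Context d (T : measurableType d) (R : realType) (mu : {measure set T -> \bar R}).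
Variables (D : set T) (mD : measurable D) (p : R).

(** The p-th power of the L^p norm over D, kept in the extended reals so that it makes sense for
    functions outside L^p, such as [kern]. *)
Definition pow_energy (f : T -> R) : \bar R :=
  (\int[mu]_(z in D) (`|f z| `^ p)%:E)%E.

Lemma pow_energy_ge0 f : (0 <= pow_energy f)%E.
Proof. by apply: integral_ge0 => z _; rewrite lee_fin powR_ge0. Qed.

Lemma pow_energyN f g : (forall z, f z = - g z) -> pow_energy f = pow_energy g.
Proof. by move=> fg; apply: eq_integral => z _; rewrite fg normrN. Qed.

Lemma pow_energy0 f : p != 0 -> (forall z, f z = 0) -> pow_energy f = 0%E.
Proof.
by move=> p0 f0; apply: integral0_eq => z _; rewrite f0 normr0 powR0.
Qed.

Lemma measurable_norm_powR (f : T -> R) : measurable_fun setT f ->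
  measurable_fun setT (fun z => `|f z| `^ p).
Proof.
move=> mf; apply: (measurableT_comp (measurable_powR p)).
exact: (measurableT_comp (@normr_measurable R setT)).
Qed.

(** Comparisons of energies below are obtained by integrating a pointwise inequality between
    weighted p-th powers. *)
Lemma pow_energy_sum_le (J K : finType) (c : J -> R) (e : K -> R)
    (f : J -> T -> R) (g : K -> T -> R) :
  (forall j, 0 <= c j) -> (forall k, 0 <= e k) ->
  (forall j, measurable_fun setT (f j)) -> (forall k, measurable_fun setT (g k)) ->
  (forall z, \sum_j c j * `|f j z| `^ p <= \sum_k e k * `|g k z| `^ p) ->
  (\sum_j (c j)%:E * pow_energy (f j) <= \sum_k (e k)%:E * pow_energy (g k))%E.
Proof.
move=> c0 e0 mf mg H.
have sumE (L : finType) (b : L -> R) (h : L -> T -> R) :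
    (forall j, 0 <= b j) -> (forall j, measurable_fun setT (h j)) ->
    (\sum_j (b j)%:E * pow_energy (h j) =
     \int[mu]_(z in D) (\sum_j b j * `|h j z| `^ p)%:E)%E.
  move=> b0 mh.
  under [RHS]eq_integral do rewrite -sumEFin.
  rewrite ge0_integral_sum//; last 2 first.
  - move=> j; apply/measurable_EFinP; apply: measurable_funM => //.
    by apply: measurable_funTS; exact: measurable_norm_powR.
  - by move=> j z _; rewrite lee_fin mulr_ge0// powR_ge0.
  apply: eq_bigr => j _; under [RHS]eq_integral do rewrite EFinM.
  rewrite ge0_integralZl//.
  - by apply/measurable_EFinP/measurable_funTS; exact: measurable_norm_powR.
  - by rewrite lee_fin; exact: b0.
have msum (L : finType) (b : L -> R) (h : L -> T -> R) :
    (forall j, measurable_fun setT (h j)) ->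
    measurable_fun D (fun z => (\sum_j b j * `|h j z| `^ p)%:E).
  move=> mh; apply/measurable_EFinP/measurable_funTS.
  apply: measurable_sum => j; apply: measurable_funM => //.
  exact: measurable_norm_powR.
rewrite !sumE//; apply: ge0_le_integral => //.
- by move=> z _; rewrite lee_fin sumr_ge0// => j _; rewrite mulr_ge0// powR_ge0.
- exact: msum.
- exact: msum.
- by move=> z _; rewrite lee_fin.
Qed.

Lemma pow_energy_le (K : finType) (e : K -> R) (f : T -> R) (g : K -> T -> R) :
  (forall k, 0 <= e k) ->
  measurable_fun setT f -> (forall k, measurable_fun setT (g k)) ->
  (forall z, `|f z| `^ p <= \sum_k e k * `|g k z| `^ p) ->
  (pow_energy f <= \sum_k (e k)%:E * pow_energy (g k))%E.
Proof.
move=> e0 mf mg H.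
have := @pow_energy_sum_le unit K (fun _ => 1) e (fun _ => f) g.
rewrite big_const card_unit /= mul1e adde0; apply => // z.
by rewrite big_const card_unit /= mul1r addr0.
Qed.

Hypothesis p2 : 2 < p.

Lemma normr_powR_half_sum (x y : R) :
  `|2^-1 * (x + y)| `^ p <= 2^-1 * `|x| `^ p + 2^-1 * `|y| `^ p.
Proof.
have p1 : 1 < p by move: p2 => ?; lra.
have p0 : 0 <= p by lra.
have := @powR_jensen R bool (fun _ => 2^-1) (fun b => if b then `|x| else `|y|) p p1.
rewrite !big_bool /= => H.
apply: (@le_trans _ _ ((2^-1 * `|x| + 2^-1 * `|y|) `^ p)).
  apply: ge0_ler_powR; rewrite ?nnegrE ?normr_ge0 ?addr_ge0 ?mulr_ge0 ?invr_ge0//.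
  rewrite normrM ger0_norm ?invr_ge0// -mulrDr ler_wpM2l ?invr_ge0//.
  exact: ler_normD.
apply: (le_trans (H _ _)); [by move=> _; rewrite invr_ge0|by case|].
have -> : 2^-1 + 2^-1 = 1 :> R by rewrite -[2^-1]mul1r -mulrDl divff// pnatr_eq0.
by rewrite powR1 mul1r.
Qed.

(** Jensen's inequality for x / l and y / (1 - l) with weights l and 1 - l. It serves as a triangle
    inequality; with l close to 1 the factor in front of x is as close to 1 as desired, at the
    expense of that of y. *)
Lemma normr_powR_mix (l x y : R) : 0 < l < 1 ->
  `|x + y| `^ p <= l `^ (1 - p) * `|x| `^ p + (1 - l) `^ (1 - p) * `|y| `^ p.
Proof.
move=> /andP[l0 l1]; have p1 : 1 < p by move: p2 => ?; lra.
have p0 : 0 <= p by lra.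
have l1' : 0 < 1 - l by lra.
have := @powR_jensen R bool (fun b => if b then l else 1 - l)
  (fun b => if b then l^-1 * `|x| else (1 - l)^-1 * `|y|) p p1.
have e1 : l + (1 - l) = 1 by rewrite addrC subrK.
rewrite !big_bool /= e1 powR1 mul1r !mulrA !divff ?gt_eqF// !mul1r => H.
apply: (@le_trans _ _ ((`|x| + `|y|) `^ p)).
  apply: ge0_ler_powR; rewrite ?nnegrE ?normr_ge0 ?addr_ge0//.
  exact: ler_normD.
apply: (le_trans (H _ _)).
- by case; exact: ltW.
- by case; rewrite mulr_ge0// invr_ge0 ltW.
have E (a b : R) : 0 < a -> a * (a^-1 * `|b|) `^ p = a `^ (1 - p) * `|b| `^ p.
  move=> a0; rewrite powRM ?invr_ge0 ?(ltW a0)// mulrA; congr (_ * _).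
  by rewrite -{1}(powRr1 (ltW a0)) -powR_inv1 ?(ltW a0)// -powRrM mulN1r -powRD// (gt_eqF a0) implybT.
by rewrite !E.
Qed.

End PowerEnergy.

Section LinkCounting.
Variables (G : groupType) (V : finType) (phi : V -> G) (e : rel V) (i : V -> V) (k : nat).
Hypothesis phi_inj : injective phi.
Hypothesis phi_inv : forall v, phi (i v) = ((phi v)^-1)%g.
Hypothesis link : forall u v, e u v <-> exists x, phi x = ((phi u)^-1 * phi v)%g.
Hypothesis degree : forall v, #|[pred u | e u v]| = k.+1.

Lemma link_invK : involutive i.
Proof. by move=> v; apply: phi_inj; rewrite !phi_inv invgK. Qed.

Lemma link_label_ex (v0 : V) : exists psi : G -> V, cancel phi psi.
Proof.
exists (fun g => if pselect (exists v, phi v = g) is left h then projT1 (cid h) else v0).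
move=> v; case: pselect => [h|[]]; last by exists v.
by apply: phi_inj; exact: (projT2 (cid h)).
Qed.

(* The triangles of the Cayley graph: an oriented edge of the link at 1 is the
   same as a relation phi x * phi v = phi y, and each v occurs in k+1 of them. *)
Lemma link_sum (M : nmodType) (A : V -> V -> M) (a : V -> M) :
  (forall x y v, phi v = ((phi x)^-1 * phi y)%g -> A x y = a v) ->
  \sum_x \sum_(y | e x y) A x y = (\sum_v a v) *+ k.+1.
Proof.
move=> Aa.
have [V0|/card_gt0P[v0 _]] := posnP #|V|.
  by rewrite !big1 ?mul0rn// => v; have := card0_eq V0 v; rewrite inE.
have [psi psiK] := link_label_ex v0.
(* The substitution v = x^-1 y turns the neighbours y of x into the neighbours v of x^-1. *)
have step1 x : \sum_(y | e x y) A x y = \sum_(v | e (i x) v) a v.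
  rewrite (reindex_onto (fun v => psi (phi x * phi v)%g) (fun y => psi ((phi x)^-1 * phi y)%g)) /=.
    apply: eq_big => [v|v]; last first.
      move=> /andP[/link[u phiu] /eqP psiv]; apply: Aa => //.
      by rewrite -{1}psiv -phiu psiK.
    apply/andP/idP => [[/link[u phiu] /eqP psiv]|].
      apply/link; exists (psi (phi x * phi v)%g).
      by rewrite phi_inv invgK -[in RHS]psiv -phiu psiK phiu mulVKg.
    move=> /link[u]; rewrite phi_inv invgK => phiu.
    by rewrite -phiu psiK phiu mulKg psiK; split=> //; apply/link; exists v; rewrite phiu mulKg.
  by move=> y /link[u phiu]; rewrite -phiu psiK phiu mulVKg psiK.
under eq_bigr => x _ do rewrite step1 big_mkcond.
rewrite exchange_big /= -sumrMnl; apply: eq_bigr => v _.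
rewrite (reindex_inj (inv_inj link_invK)) /=; under eq_bigr do rewrite link_invK.
by rewrite -big_mkcond /= sumr_const degree.
Qed.

End LinkCounting.

(** * The averaging operator and its iterates *)

Section Contraction.
Context d (T : measurableType d) (R : realType) (mu : {measure set T -> \bar R}).
Variables (D : set T) (mD : measurable D) (p : R).
Hypothesis p2 : 2 < p.
Variables (G : groupType) (sigma : G -> T -> T) (w : G -> T -> R).
(** The functions on which the weighted compositions form a genuine isometric action; later, the
    measurable ones invariant under the diagonal translation by 2 pi. *)
Variable good : set (T -> R).

Definition wcomp (g : G) (f : T -> R) : T -> R := fun z => f (sigma g z) * w g z.

Notation N := (pow_energy mu D p).

Hypothesis good_measurable : forall f, good f -> measurable_fun setT f.
Hypothesis good_linear : forall (a b : R) f g, good f -> good g ->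
  good (fun z => a * f z + b * g z).
Hypothesis good_wcomp : forall g f, good f -> good (wcomp g f).
Hypothesis wcomp1 : forall f, good f -> wcomp 1%g f = f.
Hypothesis wcompM : forall g h f, good f -> wcomp (g * h)%g f = wcomp g (wcomp h f).
Hypothesis energy_wcomp : forall g f, good f -> N (wcomp g f) = N f.

Variables (V : finType) (phi : V -> G) (e : rel V) (i : V -> V) (k : nat).
Hypothesis phi_inj : injective phi.
Hypothesis phi_inv : forall v, phi (i v) = ((phi v)^-1)%g.
Hypothesis link : forall u v, e u v <-> exists x, phi x = ((phi u)^-1 * phi v)%g.
Hypothesis degree : forall v, #|[pred u | e u v]| = k.+1.
Hypothesis V0 : (0 < #|V|)%N.

Variable theta : R.
Hypothesis theta01 : 0 <= theta < 1.
Hypothesis poincare : forall (f : V -> R) (m : R), \sum_x f x = #|V|%:R * m ->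
    k.+1%:R * \sum_x `|f x - m| `^ p <=
      theta * \sum_x \sum_y (e x y)%:R * `|f x - f y| `^ p.

Definition orbit_mean (f : T -> R) : T -> R :=
  fun z => #|V|%:R^-1 * \sum_v wcomp (phi v) f z.
Definition half_step (f : T -> R) : T -> R :=
  fun z => 2^-1 * (f z + orbit_mean f z).
Definition displacement (f : T -> R) : \bar R :=
  (\sum_v N (fun z => wcomp (phi v) f z - f z)%R)%E.

Let good_sub f g : good f -> good g -> good (fun z => f z - g z).
Proof.
move=> gf gg; have := good_linear 1 (-1) gf gg; congr good.
by apply/funext => z; rewrite mul1r mulN1r.
Qed.

Let good0 f : good f -> good (fun=> 0).
Proof.
move=> gf; have := good_sub gf gf; congr good.
by apply/funext => z; rewrite subrr.
Qed.

Let good_sum (F : V -> T -> R) (a : R) f : good f -> (forall v, good (F v)) ->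
  good (fun z => a * \sum_v F v z).
Proof.
move=> gf gF.
suff H (s : seq V) : good (fun z => \sum_(v <- s) F v z).
  have := good_linear a 0 (H (index_enum V)) gf; congr good.
  by apply/funext => z; rewrite mul0r addr0.
elim: s => [|v s ih].
  by have := good0 gf; congr good; apply/funext => z; rewrite big_nil.
have := good_linear 1 1 (gF v) ih; congr good.
by apply/funext => z; rewrite big_cons !mul1r.
Qed.

Let good_mean f : good f -> good (orbit_mean f).
Proof. by move=> gf; apply: (good_sum _ gf) => v; exact: good_wcomp. Qed.

Let good_step f : good f -> good (half_step f).
Proof.
move=> gf; have := good_linear 2^-1 2^-1 gf (good_mean gf); congr good.
by apply/funext => z; rewrite /half_step mulrDr.
Qed.

Let energy_diff x y v f : good f -> phi v = ((phi x)^-1 * phi y)%g ->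
  N (fun z => wcomp (phi x) f z - wcomp (phi y) f z)%R =
  N (fun z => wcomp (phi v) f z - f z)%R.
Proof.
move=> gf phiv.
have gd := good_sub gf (good_wcomp (phi v) gf).
rewrite (@pow_energyN _ _ _ _ _ _ (fun z => wcomp (phi v) f z - f z) (fun z => f z - wcomp (phi v) f z)).
  rewrite -(energy_wcomp (phi x) gd); congr (N _); apply/funext => z.
  have -> : phi y = (phi x * phi v)%g by rewrite phiv mulVKg.
  by rewrite wcompM// /wcomp mulrBl.
by move=> z; rewrite opprB.
Qed.

Let iK : involutive i.
Proof. exact: (link_invK phi_inj phi_inv). Qed.

Let edge_sum f : good f ->
  (\sum_x \sum_(y | e x y) N (fun z => wcomp (phi x) f z - wcomp (phi y) f z)%R =
   k.+1%:R%:E * displacement f)%E.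
Proof.
move=> gf; rewrite (link_sum phi_inj phi_inv link degree
  (a := fun v => N (fun z => wcomp (phi v) f z - f z)%R)) ?mule_natl//.
by move=> x y v; exact: energy_diff.
Qed.

Definition deviation f v : T -> R := fun z => wcomp (phi v) f z - orbit_mean f z.

Let good_dev f v : good f -> good (deviation f v).
Proof. by move=> gf; apply: good_sub; [exact: good_wcomp|exact: good_mean]. Qed.

Let nV0 : #|V|%:R != 0 :> R.
Proof. by rewrite pnatr_eq0 -lt0n. Qed.

(** The Poincaré inequality is applied at each point z to the function v |-> [wcomp (phi v) f z] on
    the link. After integration an edge x, y contributes the displacement of f by x^-1 y, because
    the action is isometric, and [link_sum] counts each generator k + 1 times; this cancels the
    factor k + 1 on the left. *)
Lemma deviation_le f : good f ->
  (\sum_v N (deviation f v) <= theta%:E * displacement f)%E.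
Proof.
move=> gf; have k0 : 0 < k.+1%:R :> R by rewrite ltr0n.
have th0 : 0 <= theta by case/andP: theta01.
pose c (z : V * V) := theta / k.+1%:R * (e z.1 z.2)%:R.
have H := @pow_energy_sum_le _ _ _ mu _ mD p V (V * V)%type (fun=> 1) c (deviation f)
  (fun z t => wcomp (phi z.1) f t - wcomp (phi z.2) f t).
apply: (@le_trans _ _ (\sum_v 1%:E * N (deviation f v))%E).
  by under [leRHS]eq_bigr do rewrite mul1e.
apply: (le_trans (H _ _ _ _ _)) => {H}.
- by [].
- by move=> z; rewrite /c mulr_ge0 ?divr_ge0 ?ler0n ?(ltW k0).
- by move=> v; apply: good_measurable; exact: good_dev.
- by move=> z; apply/good_measurable/good_sub; exact: good_wcomp.
- move=> t; under eq_bigr do rewrite mul1r.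
  have := @poincare (fun v => wcomp (phi v) f t) (orbit_mean f t).
  rewrite /orbit_mean mulrA divff// mul1r => /(_ erefl) P.
  rewrite -(ler_pM2l k0); apply: (le_trans P).
  rewrite pair_bigA /= !mulr_sumr ler_sum// => z _.
  by rewrite /c !mulrA [k.+1%:R * theta]mulrC mulfK// gt_eqF.
rewrite (_ : theta%:E * displacement f = (theta / k.+1%:R)%:E * (k.+1%:R%:E * displacement f))%E; last first.
  by rewrite muleA -EFinM mulfVK// gt_eqF.
rewrite -edge_sum// pair_big_dep /= ge0_sume_distrr; last first.
  by move=> z _; exact: pow_energy_ge0.
rewrite [leRHS]big_mkcond; apply: lee_sum => z _.
rewrite /c; case: (e z.1 z.2); first by rewrite mulr1.
by rewrite mulr0 mul0e.
Qed.

(** Writing m for the mean, the displacement is half of (v f - m) - (f - v m), and f - v m is v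
    applied to the deviation at v^-1. This is what the weight 1/2 on the identity in [half_step] is
    for. *)
Lemma half_step_dev f v z : good f ->
  wcomp (phi v) (half_step f) z - half_step f z =
  2^-1 * (deviation f v z + - wcomp (phi v) (deviation f (i v)) z).
Proof.
move=> gf.
have E : wcomp (phi v) (deviation f (i v)) z = f z - wcomp (phi v) (orbit_mean f) z.
  have <- : wcomp (phi v) (wcomp (phi (i v)) f) z = f z.
    by rewrite -wcompM// phi_inv mulgV wcomp1.
  by rewrite /deviation /wcomp mulrBl.
by rewrite E /half_step /deviation /wcomp; lra.
Qed.

(** By convexity the energy of the half sum in [half_step_dev] is at most the mean of two energies.
    The action is isometric and inversion permutes the generators, so both add up to the total
    deviation. *)
Lemma displacement_half_step f : good f ->
  (displacement (half_step f) <= theta%:E * displacement f)%E.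
Proof.
move=> gf; apply: le_trans (deviation_le gf).
have mdev v : measurable_fun setT (deviation f v) by exact/good_measurable/good_dev.
have h2 : 0 <= 2^-1 :> R by rewrite invr_ge0.
have H v : (N (fun z => wcomp (phi v) (half_step f) z - half_step f z)%R <=
    2^-1%:E * N (deviation f v) + 2^-1%:E * N (deviation f (i v)))%E.
  have := @pow_energy_le _ _ _ mu _ mD p bool (fun=> 2^-1)
    (fun z => wcomp (phi v) (half_step f) z - half_step f z)
    (fun b => if b then deviation f v else wcomp (phi v) (deviation f (i v))).
  rewrite big_bool /= energy_wcomp; last exact: good_dev.
  apply => //.
  - by apply/good_measurable/good_sub; [apply: good_wcomp|]; exact: good_step.
  - case=> //; apply/good_measurable/good_wcomp; exact: good_dev.
  move=> z; rewrite big_bool /= half_step_dev//.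
  by apply: (le_trans (normr_powR_half_sum p2 _ _)); rewrite normrN.
apply: (@le_trans _ _ (\sum_v (2^-1%:E * N (deviation f v) + 2^-1%:E * N (deviation f (i v))))%E).
  by apply: lee_sum => v _; exact: H.
rewrite big_split /= [X in (_ + X)%E](_ : _ = \sum_v 2^-1%:E * N (deviation f v))%E.
  rewrite -!ge0_sume_distrr; last by move=> v _; exact: pow_energy_ge0.
  set X := (\sum_v _)%E; have X0 : (0 <= X)%E by apply: sume_ge0 => v _; exact: pow_energy_ge0.
  rewrite -ge0_muleDl ?lee_fin// -EFinD.
  by rewrite (_ : 2^-1 + 2^-1 = 1) ?mul1e// -[2^-1]mul1r -mulrDl divff// pnatr_eq0.
rewrite (reindex_inj (inv_inj iK)) /=; by under eq_bigr do rewrite iK.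
Qed.

Lemma half_step_diff f : good f ->
  (N (fun z => half_step f z - f z)%R <= displacement f)%E.
Proof.
move=> gf.
have p1 : 1 < p by move: p2 => ?; lra.
have n0 : 0 < #|V|%:R :> R by rewrite ltr0n.
have n1 : 1 <= #|V|%:R :> R by rewrite ler1n.
pose c : R := (2 * #|V|%:R)^-1.
have c0 : 0 <= c by rewrite invr_ge0 mulr_ge0.
have c1 : c <= 1 by rewrite invf_le1 ?mulr_gt0//; lra.
have := @pow_energy_le _ _ _ mu _ mD p V (fun=> 1)
    (fun z => half_step f z - f z) (fun v z => wcomp (phi v) f z - f z).
under eq_bigr do rewrite mul1e.
apply => //.
- by apply/good_measurable/good_sub => //; exact: good_step.
- by move=> v; apply/good_measurable/good_sub => //; exact: good_wcomp.
move=> z.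
have -> : half_step f z - f z = \sum_v c * (wcomp (phi v) f z - f z).
  rewrite -mulr_sumr sumrB sumr_const -[f z *+ _]mulr_natl /half_step /orbit_mean /c invfM.
  set s := \sum_v _; rewrite [in RHS]mulrBr -!mulrA mulKf//; lra.
have J := @powR_jensen R V (fun=> c) (fun v => `|wcomp (phi v) f z - f z|) p p1.
apply: (@le_trans _ _ ((\sum_v c * `|wcomp (phi v) f z - f z|) `^ p)).
  apply: ge0_ler_powR; rewrite ?nnegrE ?normr_ge0 ?(le_trans ler01 (ltW p1))//.
    by apply: sumr_ge0 => v _; rewrite mulr_ge0.
  apply: (le_trans (ler_norm_sum _ _ _)); apply: ler_sum => v _.
  by rewrite normrM ger0_norm.
apply: (le_trans (J _ _)) => //.
apply: (@le_trans _ _ (1 * \sum_v c * `|wcomp (phi v) f z - f z| `^ p)).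
  rewrite ler_wpM2r//; first by apply: sumr_ge0 => v _; rewrite mulr_ge0// powR_ge0.
  rewrite sumr_const; apply: (@le_trans _ _ (1 `^ (p - 1))); last by rewrite powR1.
  apply: ge0_ler_powR; rewrite ?nnegrE ?subr_ge0 ?(ltW p1)//.
    by rewrite mulrn_wge0.
  by rewrite -mulr_natl /c invfM mulrCA divff ?gt_eqF// mulr1 invf_le1// ler1n.
rewrite mul1r; apply: ler_sum => v _; rewrite ler_wpM2r// powR_ge0//.
Qed.

Section Iteration.
Hypothesis generated : forall H : set G, subgroup_set H -> (forall v, H (phi v)) ->
  forall g, H g.
Variable f0 : T -> R.
Hypothesis good_f0 : good f0.
Hypothesis displacement_f0 : (displacement f0 < +oo)%E.

Definition half_step_iter n := iter n half_step f0.

Lemma good_iter n : good (half_step_iter n).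
Proof. by elim: n => [//|n ih]; exact: good_step. Qed.

Let E0 := fine (displacement f0).

Let E0E : displacement f0 = E0%:E.
Proof.
rewrite fineK// ge0_fin_numE//; apply: sume_ge0 => v _; exact: pow_energy_ge0.
Qed.

Let E00 : 0 <= E0.
Proof. by apply: fine_ge0; apply: sume_ge0 => v _; exact: pow_energy_ge0. Qed.

Lemma displacement_iter n : (displacement (half_step_iter n) <= (E0 * theta ^+ n)%:E)%E.
Proof.
have th0 : 0 <= theta by case/andP: theta01.
elim: n => [|n ih]; first by rewrite expr0 mulr1 -E0E.
apply: (le_trans (displacement_half_step (good_iter n))).
rewrite exprS mulrCA EFinM; exact: lee_wpmul2l.
Qed.

(** The elements displacing the iterates by O(theta^n), with a constant depending on the element,
    form a subgroup that contains the generators. *)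
Lemma almost_invariant g : exists2 C : R, 0 <= C &
  forall n, (N (fun z => wcomp g (half_step_iter n) z - half_step_iter n z)%R <= (C * theta ^+ n)%:E)%E.
Proof.
have th0 : 0 <= theta by case/andP: theta01.
pose H : set G := [set g | exists2 C : R, 0 <= C & forall n,
  (N (fun z => wcomp g (half_step_iter n) z - half_step_iter n z)%R <= (C * theta ^+ n)%:E)%E].
suff : H g by [].
apply: generated; last first.
  move=> v; exists E0 => // n; apply: le_trans (displacement_iter n).
  rewrite /displacement (bigD1 v)//= leeDl// sume_ge0// => u _; exact: pow_energy_ge0.
split.
- exists 0 => // n; rewrite mul0r.
  rewrite pow_energy0//; first by move: p2 => ?; rewrite gt_eqF//; lra.
  by move=> z; rewrite (wcomp1 (good_iter n)) subrr.
- move=> a b [C C0 HC] [C' C'0 HC'].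
  exists (2^-1 `^ (1 - p) * C' + 2^-1 `^ (1 - p) * C).
    by rewrite addr_ge0 ?mulr_ge0 ?powR_ge0.
  move=> n; have gx := good_iter n; set x := half_step_iter n in gx *.
  have gd := good_sub (good_wcomp b gx) gx.
  have := @pow_energy_le _ _ _ mu _ mD p bool (fun=> 2^-1 `^ (1 - p))
    (fun z => wcomp (a * b)%g x z - x z)
    (fun c => if c then wcomp a (fun z => wcomp b x z - x z) else (fun z => wcomp a x z - x z)).
  rewrite big_bool /= energy_wcomp// => H1; apply: (le_trans (H1 _ _ _ _)) => {H1}.
  + by move=> _; exact: powR_ge0.
  + by apply/good_measurable/good_sub => //; exact: good_wcomp.
  + by case; apply/good_measurable; [exact: good_wcomp|apply: good_sub => //; exact: good_wcomp].
  + move=> z; rewrite big_bool /=.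
    have -> : wcomp (a * b)%g x z - x z =
        wcomp a (fun z => wcomp b x z - x z) z + (wcomp a x z - x z).
      by rewrite wcompM// /wcomp; lra.
    have := @normr_powR_mix R p p2 2^-1; rewrite (_ : 1 - 2^-1 = 2^-1); last by lra.
    apply; apply/andP; split; [by rewrite invr_gt0|by rewrite invf_lt1// ltr1n].
  + rewrite mulrDl EFinD -!mulrA !EFinM; apply: leeD.
      by rewrite lee_wpmul2l ?lee_fin ?powR_ge0// -EFinM; exact: HC'.
    by rewrite lee_wpmul2l ?lee_fin ?powR_ge0// -EFinM; exact: HC.
- move=> a [C C0 HC]; exists C => // n; apply: le_trans (HC n).
  have gx := good_iter n; set x := half_step_iter n in gx *.
  rewrite -(energy_wcomp a); last by apply: good_sub => //; exact: good_wcomp.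
  rewrite le_eqVlt; apply/orP; left; apply/eqP; apply: pow_energyN => z.
  have -> : wcomp a (fun z0 => wcomp a^-1%g x z0 - x z0) z =
     wcomp a (wcomp a^-1%g x) z - wcomp a x z by rewrite /wcomp mulrBl.
  by rewrite -wcompM// mulgV wcomp1// opprB.
Qed.

Lemma normr_powR_telescope (l : R) : 0 < l < 1 -> forall n (u : nat -> R),
  `|u n - u 0%N| `^ p <= (1 - l) `^ (1 - p) *
     \sum_(j < n) (l `^ (1 - p)) ^+ j * `|u j.+1 - u j| `^ p.
Proof.
move=> l01; elim=> [|n ih] u.
  rewrite big_ord0 mulr0 subrr normr0 powR0// gt_eqF//.
  by move: p2 => ?; lra.
rewrite big_ord_recl expr0 mul1r mulrDr.
have -> : u n.+1 - u 0%N = (u n.+1 - u 1%N) + (u 1%N - u 0%N) by lra.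
apply: (le_trans (normr_powR_mix p2 _ _ l01)).
rewrite addrC lerD2l; have := ih (fun j => u j.+1).
move=> /(ler_wpM2l (powR_ge0 l (1 - p))) /le_trans; apply.
rewrite mulrCA ler_wpM2l ?powR_ge0// mulr_sumr.
by apply: ler_sum => j _; rewrite lift0 exprS mulrA.
Qed.

Lemma iter_bounded : exists C : R, forall n,
  (N (fun z => half_step_iter n z - f0 z)%R <= C%:E)%E.
Proof.
have [th0 th1] := andP theta01.
have p1 : 0 < p - 1 by move: p2 => ?; lra.
(* With l^(1 - p) = 1 / rho the telescoping weights grow like rho^-j. As the j-th increment has
   energy O(theta^j) and theta < rho < 1, the bound is a convergent geometric series of ratio theta
   / rho. *)
pose rho := (1 + theta) / 2.
have rho0 : 0 < rho by rewrite /rho; lra.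
have rho1 : rho < 1 by rewrite /rho; lra.
pose l := rho `^ (p - 1)^-1.
have l0 : 0 < l by rewrite powR_gt0.
have l1 : l < 1.
  have := @gt0_ltr_powR R (p - 1)^-1 (_ : 0 < (p - 1)^-1) rho 1.
  by rewrite powR1; apply; rewrite ?invr_gt0// nnegrE// ltW.
have BE : l `^ (1 - p) = rho^-1.
  rewrite /l -powRrM (_ : (p - 1)^-1 * (1 - p) = -1).
    by rewrite powR_inv1// ltW.
  by rewrite -[1 - p]opprB mulrN mulVf// gt_eqF.
pose r := rho^-1 * theta.
have r0 : 0 <= r by rewrite mulr_ge0// invr_ge0 ltW.
have r1 : r < 1 by rewrite /r mulrC ltr_pdivrMr// mul1r /rho; lra.
exists ((1 - l) `^ (1 - p) * (E0 / (1 - r))) => n.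
have B0 : 0 <= l `^ (1 - p) by exact: powR_ge0.
have A0 : 0 <= (1 - l) `^ (1 - p) by exact: powR_ge0.
have := @pow_energy_le _ _ _ mu _ mD p 'I_n (fun j => (1 - l) `^ (1 - p) * (l `^ (1 - p)) ^+ j)
  (fun z => half_step_iter n z - f0 z)
  (fun j z => half_step_iter j.+1 z - half_step_iter j z).
move=> H1; apply: (le_trans (H1 _ _ _ _)) => {H1}.
- by move=> j; rewrite mulr_ge0// exprn_ge0.
- by apply/good_measurable/good_sub => //; exact: good_iter.
- by move=> j; apply/good_measurable/good_sub; exact: good_iter.
- move=> z; under eq_bigr do rewrite -mulrA.
  rewrite -mulr_sumr; apply: (normr_powR_telescope _ n (fun j => half_step_iter j z)).
  by rewrite l0.
apply: (@le_trans _ _ (\sum_(j < n) ((1 - l) `^ (1 - p) * (E0 * r ^+ j))%:E)%E).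
  apply: lee_sum => j _.
  apply: (@le_trans _ _ (((1 - l) `^ (1 - p) * (l `^ (1 - p)) ^+ j)%:E * (E0 * theta ^+ j)%:E)%E).
    apply: lee_wpmul2l; first by rewrite lee_fin mulr_ge0// exprn_ge0.
    apply: le_trans (displacement_iter j); apply: half_step_diff; exact: good_iter.
  by rewrite -EFinM lee_fin BE /r exprMn -mulrA ler_wpM2l// mulrCA.
rewrite sumEFin lee_fin -mulr_sumr ler_wpM2l// -mulr_sumr ler_wpM2l//.
have r10 : 0 < 1 - r by rewrite subr_gt0.
rewrite -(ler_pM2l r10) divff ?gt_eqF//.
have := subrX1 r n; have := exprn_ge0 n r0.
set s := \sum_(j < n) _; set t := r ^+ n; lra.
Qed.

End Iteration.
End Contraction.

(** * The kernel and the action on pairs of points *)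

Section PowerIntegrability.
Variable R : realType.
Notation mu := (@lebesgue_measure R).
Notation plane := (measurableTypeR R * measurableTypeR R)%type.
Notation mu2 := (mu \x mu)%E.

Lemma continuous_powR_pos (c x : R) : 0 < x -> {for x, continuous (@powR R ^~ c)}.
Proof.
move=> x0; apply/differentiable_continuous/derivable1_diffP.
by apply: derivable_powR; rewrite in_itv/= andbT.
Qed.

Lemma integral_powR_itv_le (c a L : R) : -1 < c -> 0 < a -> a < L ->
  (\int[mu]_(t in `[a, L]) (t `^ c)%:E <= (L `^ (c + 1) / (c + 1))%:E)%E.
Proof.
move=> c1 a0 aL.
have c10 : 0 < c + 1 by lra.
pose F t : R := (c + 1)^-1 * t `^ (c + 1).
have dF (t : R) : 0 < t -> is_derive t (1 : R) F (t `^ c).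
  move=> t0; have D := is_derive1_powR (c + 1) t0.
  have := @is_deriveZ R R R (@powR R ^~ (c + 1)) (c + 1)^-1 t 1 _ D.
  by rewrite /GRing.scale /= addrK mulKf// gt_eqF.
have derF (t : R) : 0 < t -> derivable F t 1 by move=> t0; have [] := dF t t0.
have cF (t : R) : 0 < t -> {for t, continuous F}.
  by move=> t0; apply/differentiable_continuous/derivable1_diffP; exact: derF.
rewrite (@continuous_FTC2 _ _ F _ _ aL).
- rewrite -EFinB lee_fin /F mulrC lerBlDr lerDl mulr_ge0 ?powR_ge0// invr_ge0 ltW//.
- apply: continuous_in_subspaceT => t; rewrite inE/= in_itv/= => /andP[h _].
  by apply: continuous_powR_pos; exact: lt_le_trans h.
- split.
  + move=> t; rewrite in_itv/= => /andP[h _].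
    by apply: derF; exact: lt_trans h.
  + by apply: cvg_at_right_filter; exact: cF.
  + by apply: cvg_at_left_filter; apply: cF; exact: lt_trans aL.
- move=> t; rewrite in_itv/= => /andP[h _].
  have D := dF t (lt_trans a0 h).
  by rewrite derive1E derive_val.
Qed.

Lemma measurable_powR_pos (c : R) (A : set (measurableTypeR R)) : measurable A ->
  measurable_fun A (fun t : measurableTypeR R => (t `^ c)%:E).
Proof. by move=> mA; apply/measurable_EFinP/measurable_funTS; exact: measurable_powR. Qed.

Lemma integral_powR_lty (c L : R) : -1 < c -> 0 < L ->
  (\int[mu]_(t in `]0%R, L]) (t `^ c)%:E <= (L `^ (c + 1) / (c + 1))%:E)%E.
Proof.
move=> c1 L0.
(* The denominator n + 2 keeps the left end strictly below L already for n = 0. *)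
pose F (n : nat) : set (measurableTypeR R) := `[L / n.+2%:R, L]%classic.
have FE : \bigcup_n F n = `]0%R, L]%classic.
  apply/seteqP; split => t /=.
    move=> [n _]; rewrite /F /= !in_itv/= => /andP[h1 ->]; rewrite andbT.
    by apply: lt_le_trans h1; rewrite divr_gt0.
  rewrite in_itv/= => /andP[t0 tL].
  exists (Num.truncn (L / t)) => //; rewrite /F/= in_itv/= tL andbT.
  rewrite ler_pdivrMr// mulrC -ler_pdivrMr// ltW//.
  apply: lt_le_trans (truncnS_gt _) _; rewrite ler_nat; exact: leqnSn.
rewrite -FE.
have Fnd : nondecreasing_seq F.
  move=> m n mn; rewrite subsetEset => t; rewrite /F /= !in_itv/= => /andP[h ->].
  rewrite andbT (le_trans _ h)// ler_pM2l// lef_pV2 ?posrE// ler_nat ltnS.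
  exact: mn.
have mF n : measurable (F n : set (measurableTypeR R)) by exact: measurable_itv.
have mf n : measurable_fun (F n : set (measurableTypeR R)) (fun t : measurableTypeR R => (t `^ c)%:E).
  by apply: measurable_powR_pos.
have f0 n x : F n x -> (0 <= (x `^ c)%:E)%E by rewrite lee_fin powR_ge0.
have cvg := @ge0_nondecreasing_set_cvg_integral _ _ _ F (fun t : measurableTypeR R => (t `^ c)%:E) mu Fnd mF mf f0.
rewrite -(cvg_lim _ cvg)//; apply: lime_le; first by apply/cvg_ex; eexists; exact: cvg.
apply: nearW => n; apply: integral_powR_itv_le => //; first by rewrite divr_gt0.
by rewrite ltr_pdivrMr// ltr_pMr// ltr1n.
Qed.

Lemma ge0_integral_shift (c : R) (h : measurableTypeR R -> \bar R) :
  measurable_fun setT h -> (forall x, 0 <= h x)%E ->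
  (\int[mu]_y h (y + c)%R = \int[mu]_y h y)%E.
Proof.
move=> mh h0.
have dE (x : R) : is_derive x (1 : R) (fun y : R => y + c) 1.
  by rewrite -[X in is_derive _ _ _ X]addr0; apply: is_deriveD.
have d1 x : derive1 (fun y : R => y + c) x = 1 by rewrite derive1E derive_val.
rewrite -(@ge0_integral_substitution R (fun y => y + c) (fun y => y - c) _ _ _ _ _ h)//.
- by apply: eq_integral => z _; rewrite d1 mule1.
- by move=> x y; rewrite ltrD2r.
- by move=> x; rewrite addrK.
- by move=> x; rewrite subrK.
- have -> : derive1 (fun y : R => y + c) = (fun=> 1 : R) by apply/funext.
  by move=> x; exact: cst_continuous.
Qed.

(** By Tonelli and the shift t = y - x, the integral is 2 pi times that of C t^c over ]0, L]. *)
Lemma integral_strip_powR_lty (a C c L : R) : -1 < c -> 0 < L -> 0 <= C ->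
  (\int[mu2]_(z in strip a)
     (if z.2 - z.1 <= L then C * (z.2 - z.1) `^ c else 0)%:E < +oo)%E.
Proof.
move=> c1 L0 C0.
pose g (t : R) : R := if (0 < t) && (t <= L) then C * t `^ c else 0.
have g0 t : 0 <= g t by rewrite /g; case: ifP => // _; rewrite mulr_ge0// powR_ge0.
have mg : measurable_fun [set: measurableTypeR R] (g : measurableTypeR R -> R).
  rewrite /g; apply: measurable_fun_ifT => //.
    by apply: measurable_and; apply: measurable_fun_ltr || apply: measurable_fun_ler.
  by apply: measurable_funM => //; exact: measurable_powR.
pose h (z : plane) : \bar R := (g (z.2 - z.1) * \1_(`[a, a + 2 * pi[ : set R) z.1)%:E.
have mh : measurable_fun [set: plane] h.
  apply/measurable_EFinP; apply: measurable_funM.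
    apply: (measurableT_comp mg); exact: measurable_funB.
  apply: (measurableT_comp _ measurable_fst); exact: measurable_indic.
have -> : (\int[mu2]_(z in strip a) (if z.2 - z.1 <= L then C * (z.2 - z.1) `^ c else 0)%:E =
   \int[mu2]_z h z)%E.
  rewrite integral_mkcond; apply: eq_integral => -[x y] _; rewrite patchE /h /g /= subr_gt0 indicE.
  case: ifPn => H.
    move: H; rewrite inE /strip /= => -[H ->] /=.
    by rewrite mem_set ?mulr1//= in_itv.
  case: ifPn => H2; last by rewrite mul0r.
  rewrite memNset ?mulr0//= in_itv/=; apply/negP; apply: contra H => H3.
  by rewrite inE /strip /=; split=> //; case/andP: H2.
have h0 z : (0 <= h z)%E by rewrite /h lee_fin mulr_ge0.
rewrite fubini_tonelli1//=.
pose J := (\int[mu]_t (g t)%:E)%E.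
have mg' : measurable_fun [set: measurableTypeR R] (fun t : measurableTypeR R => (g t)%:E).
  exact/measurable_EFinP.
have inner (x : measurableTypeR R) :
    (fubini_F mu h x = (\1_(`[a, a + 2 * pi[ : set (measurableTypeR R)) x)%:E * J)%E.
  transitivity (\int[mu]_y ((\1_(`[a, a + 2 * pi[ : set (measurableTypeR R)) x)%:E * (g (y - x))%:E))%E.
    by apply: eq_integral => y _; rewrite /h /= mulrC EFinM.
  have mgx : measurable_fun [set: measurableTypeR R] (fun y : measurableTypeR R => (g (y - x))%:E).
    apply/measurable_EFinP; apply: (measurableT_comp mg); exact: measurable_funB.
  have gx0 (y : measurableTypeR R) : setT y -> (0 <= (g (y - x))%:E)%E by rewrite lee_fin.
  have i0 : (0 <= (\1_(`[a, a + 2 * pi[ : set (measurableTypeR R)) x)%:E :> \bar R)%E.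
    by rewrite lee_fin.
  apply: (etrans (@ge0_integralZl _ _ _ mu setT measurableT _ mgx _ gx0 i0)); congr (_ * _)%E.
  by rewrite (@ge0_integral_shift (- x) _ mg')// => t; rewrite lee_fin.
under eq_integral do rewrite inner.
have J0 : (0 <= J)%E by apply: integral_ge0 => t _; rewrite lee_fin.
have mi : measurable_fun [set: measurableTypeR R]
    (fun x => (\1_(`[a, a + 2 * pi[ : set (measurableTypeR R)) x)%:E : \bar R).
  by apply/measurable_EFinP; apply: measurable_indic; exact: measurable_itv.
have i1 (x : measurableTypeR R) : setT x ->
    (0 <= (\1_(`[a, a + 2 * pi[ : set (measurableTypeR R)) x)%:E :> \bar R)%E.
  by rewrite lee_fin.
rewrite (@ge0_integralZr _ _ _ mu setT measurableT _ mi _ i1 J0).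
rewrite integral_indic// setIT.
apply: lte_mul_pinfty => //.
- by rewrite ge0_fin_numE ?measure_ge0//= lebesgue_measure_itv/=; case: ifP => _; rewrite ltry.
have -> : J = (\int[mu]_(t in `]0%R, L]) (C * t `^ c)%:E)%E.
  rewrite /J [RHS]integral_mkcond; apply: eq_integral => t _.
  rewrite patchE /g; case: ifPn => H; first by rewrite mem_set//= in_itv.
  rewrite memNset//= in_itv/=; exact/negP.
under eq_integral do rewrite EFinM.
rewrite ge0_integralZl//.
- by apply: lte_mul_pinfty => //; apply: le_lt_trans (integral_powR_lty c1 L0) _; rewrite ltry.
- exact: measurable_powR_pos.
- by move=> t _; rewrite lee_fin powR_ge0.
Qed.
End PowerIntegrability.

(** * Lifts of circle diffeomorphisms and their effect on the kernel *)

Section CircleLifts.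
Variable R : realType.
Notation tau := (2 * @pi R).

Lemma tau_gt0 : 0 < tau.
Proof. by rewrite mulr_gt0 ?pi_gt0. Qed.

Definition translates (F : R -> R) := forall x, F (x + tau) = F x + tau.

Lemma translates_int (F : R -> R) : translates F ->
  forall (k : int) x, F (x + tau * k%:~R) = F x + tau * k%:~R.
Proof.
move=> FP.
have nat_case (n : nat) x : F (x + tau * n%:R) = F x + tau * n%:R.
  elim: n x => [|n ih] x; first by rewrite mulr0 !addr0.
  by rewrite -[n.+1%:R]natr1 mulrDr mulr1 addrA FP ih addrA.
case=> n x; first exact: nat_case.
rewrite NegzE mulrNz mulrN; apply: (addIr (tau * n.+1%:R)).
by rewrite -nat_case !subrK.
Qed.

Lemma periodic_int (T : Type) (f : R -> T) : (forall x, f (x + tau) = f x) ->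
  forall (k : int) x, f (x + tau * k%:~R) = f x.
Proof.
move=> fP.
have nat_case (n : nat) x : f (x + tau * n%:R) = f x.
  elim: n x => [|n ih] x; first by rewrite mulr0 !addr0.
  by rewrite -[n.+1%:R]natr1 mulrDr mulr1 addrA fP ih.
case=> n x; first exact: nat_case.
by rewrite NegzE mulrNz mulrN -[LHS](nat_case n.+1) subrK.
Qed.

Lemma reduce_mod_tau (a x : R) : exists k : int, a <= x + tau * k%:~R < a + tau.
Proof.
exists (- Num.floor ((x - a) / tau)).
have /andP[h1 h2] := Num.Theory.floor_itv ((x - a) / tau).
move: h1 h2; set z := Num.floor _.
rewrite ler_pdivlMr ?tau_gt0// ltr_pdivrMr ?tau_gt0// mulrNz mulrN.
rewrite (_ : (z + 1)%:~R = z%:~R + 1); last by rewrite intrD.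
by move: tau z%:~R => T Z h1 h2; apply/andP; split; nra.
Qed.

Lemma periodic_positive_bounds (f : R -> R) : continuous f -> (forall x, f (x + tau) = f x) ->
  (forall x, 0 < f x) ->
  exists m M : R, [/\ 0 < m, 1 <= M & forall x, m <= f x <= M].
Proof.
move=> cf fP f0.
have t0 : 0 <= tau by exact/ltW/tau_gt0.
have [a _ Ha] := EVT_min t0 (continuous_subspaceT cf).
have [b _ Hb] := EVT_max t0 (continuous_subspaceT cf).
exists (f a), (Num.max 1 (f b)); split => //; first by rewrite le_max lexx.
move=> x; have [k /andP[k1 k2]] := reduce_mod_tau 0 x.
rewrite -(periodic_int fP k x); rewrite add0r in k2.
have kI : x + tau * k%:~R \in `[0, tau] by rewrite in_itv/= k1 ltW.
by rewrite Ha// le_max Hb// orbT.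
Qed.

Record c1_lift (F : R -> R) : Prop := C1Lift {
  lift_incr : {homo F : x y / x < y};
  lift_derivable : forall x, derivable F x 1;
  lift_derive_cont : continuous (derive1 F);
  lift_derive_gt0 : forall x, 0 < derive1 F x;
  lift_translates : translates F }.

Lemma lift_continuous F : c1_lift F -> continuous F.
Proof. by move=> HF x; exact/differentiable_continuous/derivable1_diffP/(lift_derivable HF). Qed.

Lemma is_derive_addr_cst (c x : R) : is_derive x (1 : R) (fun y : R => y + c) 1.
Proof. by rewrite -[X in is_derive _ _ _ X]addr0; apply: is_deriveD. Qed.

Lemma derive1_shift (F : R -> R) (c x : R) : derivable F (x + c) 1 ->
  derive1 (fun y => F (y + c)) x = derive1 F (x + c).
Proof.
move=> dF; have dE := is_derive_addr_cst c x.
have d : derivable (fun y : R => y + c) x 1 by case: dE.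
by have := derive1_comp d dF; rewrite [derive1 (fun y => y + c) x]derive1E derive_val mulr1.
Qed.

Lemma derive1_addr (F : R -> R) (c x : R) : derivable F x 1 ->
  derive1 (fun y => F y + c) x = derive1 F x.
Proof.
move=> dF; rewrite !derive1E.
have D : is_derive x 1 F ('D_1 F x) by exact: DeriveDef.
have := @is_deriveD _ _ _ F (cst c) x 1 _ 0 D (is_derive_cst _ _ _).
by rewrite addr0 => H; rewrite (@derive_val _ _ _ _ _ _ _ H).
Qed.

Lemma derive1_periodic (F : R -> R) : translates F -> (forall x, derivable F x 1) ->
  forall x, derive1 F (x + tau) = derive1 F x.
Proof.
move=> FP dF x; rewrite -derive1_shift//.
by rewrite (_ : (fun y => _) = (fun y => F y + tau)) ?derive1_addr//; exact/funext.
Qed.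

Lemma lift_mvt F x y : c1_lift F -> x < y ->
  exists2 c, x < c < y & F y - F x = derive1 F c * (y - x).
Proof.
move=> HF xy.
have [z _||c] := @MVT _ F (derive1 F) x y xy.
- by rewrite derive1E; apply: DeriveDef => //; exact: lift_derivable.
- exact/continuous_subspaceT/lift_continuous.
by rewrite in_itv/= => cI FE; exists c.
Qed.

(** For 0 < b <= 1 the power u^b lies between 1 and u. *)
Lemma normr_powR_sub1_le (b u : R) : 0 < b <= 1 -> 0 < u -> `|u `^ b - 1| <= `|u - 1|.
Proof.
move=> /andP[b0 b1] u0.
have [u1|u1] := leP 1 u.
  have h1 : 1 <= u `^ b by rewrite -[leLHS](powRr0 u) ler_powR// ltW.
  have h2 : u `^ b <= u by rewrite -[leRHS](powRr1 (ltW u0)) ler_powR.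
  by rewrite !ger0_norm ?subr_ge0// lerD2r.
have h1 : u `^ b <= 1.
  have := @ge0_ler_powR R b (ltW b0) u 1; rewrite powR1; apply; rewrite ?nnegrE ?ltW//.
have h2 : u <= u `^ b.
  rewrite /powR gt_eqF// -[leLHS]lnK ?posrE// ler_expR.
  by have := ln_le0 (ltW u1); nra.
have u1' := ltW u1.
by rewrite !ler0_norm ?subr_le0// lerN2 lerD2r.
Qed.

(* The p-th power of [kern b] is (y - x)^-2 when p b = 1, which is not integrable
   near the diagonal. *)
Definition kern (b : R) (z : R * R) : R :=
  if 0 < z.2 - z.1 < 1 then (z.2 - z.1) `^ (- (2 * b)) else 0.

Definition pull (b : R) (F : R -> R) (f : R * R -> R) : R * R -> R :=
  fun z => f (F z.1, F z.2) * (derive1 F z.1 * derive1 F z.2) `^ b.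

Lemma kern_ge0 b z : 0 <= kern b z.
Proof. by rewrite /kern; case: ifP => // _; exact: powR_ge0. Qed.

(** Here c is a mean value point, so that F y - F x = F'(c) (y - x). With t = y - x and u, v, w the
    derivatives at x, y, c, the difference is t^(-2b) ((u v / w^2)^b - 1), and u v - w^2 = (u - w) v
    + w (v - w) is O(t^a) by the Hölder condition. *)
Lemma pull_kern_near (b m M a C x y c : R) (F : R -> R) :
  0 < b <= 1 -> 0 < a -> 0 < m -> 0 <= C -> x < y -> x < c < y ->
  m <= derive1 F x <= M -> m <= derive1 F y <= M -> m <= derive1 F c <= M ->
  (forall s t, `|derive1 F s - derive1 F t| <= C * `|s - t| `^ a) ->
  `|(derive1 F c * (y - x)) `^ (- (2 * b)) * (derive1 F x * derive1 F y) `^ b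
     - (y - x) `^ (- (2 * b))| <=
  2 * M * C / m ^+ 2 * (y - x) `^ (a - 2 * b).
Proof.
move=> b01 a0 m0 C0 xy /andP[xc cy] /andP[mx Mx] /andP[my My] /andP[mc Mc] hol.
set t := y - x; have t0 : 0 < t by rewrite subr_gt0.
set u := derive1 F x in mx Mx *; set v := derive1 F y in my My *; set w := derive1 F c in mc Mc *.
have u0 : 0 < u by lra.
have v0 : 0 < v by lra.
have w0 : 0 < w by lra.
have b0 : 0 < b by case/andP: b01.
have w2 : w `^ (- (2 * b)) = ((w ^+ 2)^-1) `^ b.
  rewrite -powR_inv1 ?sqr_ge0// -powR_mulrn ?(ltW w0)// -!powRrM; congr (_ `^ _); lra.
have -> : (w * t) `^ (- (2 * b)) * (u * v) `^ b - t `^ (- (2 * b)) =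
    t `^ (- (2 * b)) * ((u * v / w ^+ 2) `^ b - 1).
  rewrite powRM ?(ltW w0) ?(ltW t0)// w2 [(u * v / _) `^ b]powRM ?invr_ge0 ?sqr_ge0 ?mulr_ge0 ?(ltW u0) ?(ltW v0)//.
  by lra.
have uvw0 : 0 < u * v / w ^+ 2 by rewrite divr_gt0 ?mulr_gt0// exprn_gt0.
rewrite normrM ger0_norm ?powR_ge0//.
have ta : t `^ (a - 2 * b) = t `^ (- (2 * b)) * t `^ a.
  by rewrite -powRD 1?addrC// (gt_eqF t0) implybT.
rewrite ta mulrCA; apply: ler_wpM2l; first exact: powR_ge0.
apply: (le_trans (normr_powR_sub1_le b01 uvw0)).
have le1 : `|u - w| <= C * t `^ a.
  apply: (le_trans (hol x c)); apply: ler_wpM2l => //.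
  apply: ge0_ler_powR; rewrite ?nnegrE ?(ltW a0) ?(ltW t0)//.
  by rewrite distrC ger0_norm /t; lra.
have le2 : `|v - w| <= C * t `^ a.
  apply: (le_trans (hol y c)); apply: ler_wpM2l => //.
  apply: ge0_ler_powR; rewrite ?nnegrE ?(ltW a0) ?(ltW t0)//.
  by rewrite ger0_norm /t; lra.
have -> : u * v / w ^+ 2 - 1 = (u * v - w ^+ 2) / w ^+ 2.
  by rewrite mulrBl divff// expf_neq0// gt_eqF.
have -> : u * v - w ^+ 2 = (u - w) * v + w * (v - w) by lra.
rewrite normrM normfV [`|w ^+ 2|]ger0_norm ?sqr_ge0//.
have num : `|(u - w) * v + w * (v - w)| <= 2 * M * C * t `^ a.
  apply: (le_trans (ler_normD _ _)).
  rewrite !normrM (ger0_norm (ltW v0)) (ger0_norm (ltW w0)).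
  have := normr_ge0 (u - w); have := normr_ge0 (v - w); nra.
have mw : m ^+ 2 <= w ^+ 2 by rewrite !expr2; nra.
have m20 : 0 < m ^+ 2 by rewrite exprn_gt0.
have w20 : 0 < w ^+ 2 by rewrite exprn_gt0.
rewrite ler_pdivrMr//; apply: (le_trans num).
have ta0 : 0 <= t `^ a by exact: powR_ge0.
have K0 : 0 <= 2 * M * C * t `^ a by rewrite !mulr_ge0//; lra.
rewrite (_ : 2 * M * C / m ^+ 2 * t `^ a * w ^+ 2 =
  2 * M * C * t `^ a * (w ^+ 2 / m ^+ 2)); last by lra.
by rewrite ler_peMr// ler_pdivlMr// mul1r.
Qed.

(** Let m and M bound the derivative and t = y - x. For t > L = max(1, 1/m) both kernels are
    truncated to 0; for t < 1/M neither is truncated and [pull_kern_near] applies. In between, both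
    are O(t^(-2b)), and 1 <= (M t)^a supplies the missing factor t^a. *)
Lemma pull_kern_estimate (b a C : R) (F : R -> R) :
  c1_lift F -> 0 < b <= 1 -> 0 < a ->
  (forall s t, `|derive1 F s - derive1 F t| <= C * `|s - t| `^ a) ->
  exists K L : R, [/\ 0 <= K, 0 < L & forall x y, x < y ->
    `|pull b F (kern b) (x, y) - kern b (x, y)| <=
      if y - x <= L then K * (y - x) `^ (a - 2 * b) else 0].
Proof.
move=> HF b01 a0 hol; have /andP[b0 b1] := b01.
have C0 : 0 <= C.
  have := hol 1 0; rewrite subr0 normr1 powR1 mulr1; exact: le_trans.
have [m [M [m0 M1 mM]]] := periodic_positive_bounds (lift_derive_cont HF)
  (derive1_periodic (lift_translates HF) (lift_derivable HF)) (lift_derive_gt0 HF).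
have M0 : 0 < M by lra.
pose K1 := 2 * M * C / m ^+ 2.
pose K2 := (1 + (m `^ (- (2 * b)) * (M * M) `^ b)) * M `^ a.
have K10 : 0 <= K1 by rewrite divr_ge0 ?sqr_ge0// !mulr_ge0// ltW.
have K20 : 0 <= K2 by rewrite mulr_ge0 ?powR_ge0// addr_ge0 ?mulr_ge0 ?powR_ge0.
pose L := Num.max 1 m^-1.
have L0 : 0 < L by rewrite lt_max ltr01.
exists (K1 + K2), L; split => //; first exact: addr_ge0.
move=> x y xy; set t := y - x; have t0 : 0 < t by rewrite subr_gt0.
have [c cI FE] := lift_mvt HF xy.
have /andP[mc Mc] := mM c; have /andP[mx Mx] := mM x; have /andP[my My] := mM y.
have F0 : 0 < F y - F x by rewrite subr_gt0; exact: lift_incr.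
rewrite /pull /kern /= -/t t0 /= F0 /= FE -/t.
set u := derive1 F x in mx Mx *; set v := derive1 F y in my My *; set w := derive1 F c in mc Mc *.
have P0 : 0 <= t `^ (a - 2 * b) by exact: powR_ge0.
have [tL|Lt] := leP t L; last first.
  have t1 : (t < 1) = false.
    by apply/negbTE; rewrite -leNgt; apply: le_trans (ltW Lt); rewrite le_max lexx.
  have wt1 : (w * t < 1) = false.
    apply/negbTE; rewrite -leNgt; apply: (@le_trans _ _ (m * t)).
      rewrite -ler_pdivrMl// mulr1; apply: le_trans (ltW Lt); rewrite le_max lexx orbT//.
    by rewrite ler_pM2r.
  by rewrite t1 wt1 mul0r subrr normr0.
have [tM|Mt] := ltP t M^-1.
  have t1 : t < 1 by apply: (lt_le_trans tM); rewrite invf_le1.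
  have wt1 : w * t < 1.
    apply: (@le_lt_trans _ _ (M * t)); first by rewrite ler_pM2r.
    by rewrite -ltr_pdivlMl// mulr1.
  rewrite t1 wt1; apply: (@le_trans _ _ (K1 * t `^ (a - 2 * b))).
    by apply: pull_kern_near => //; rewrite ?mx ?my ?mc.
  by rewrite ler_wpM2r// lerDl.
apply: (@le_trans _ _ (K2 * t `^ (a - 2 * b))); last by rewrite ler_wpM2r// lerDr.
have tb0 : 0 <= t `^ (- (2 * b)) by exact: powR_ge0.
have E1 : 0 <= (if w * t < 1 then (w * t) `^ (- (2 * b)) else 0) * (u * v) `^ b
    <= t `^ (- (2 * b)) * (m `^ (- (2 * b)) * (M * M) `^ b).
  apply/andP; split.
    by rewrite mulr_ge0 ?powR_ge0//; case: ifP => // _; exact: powR_ge0.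
  apply: (@le_trans _ _ ((w * t) `^ (- (2 * b)) * (u * v) `^ b)).
    by rewrite ler_wpM2r ?powR_ge0//; case: ifP => // _; exact: powR_ge0.
  have w0 : 0 < w by lra.
  rewrite [(w * t) `^ _]powRM ?(ltW w0) ?(ltW t0)// mulrAC mulrC; apply: ler_wpM2l => //.
  apply: ler_pM; rewrite ?powR_ge0//.
    rewrite !powRN lef_pV2 ?posrE ?powR_gt0//.
    by apply: ge0_ler_powR; rewrite ?nnegrE ?mulr_ge0 ?(ltW b0) ?(ltW w0) ?(ltW m0).
  apply: ge0_ler_powR; rewrite ?nnegrE ?mulr_ge0 ?(ltW b0) ?(ltW M0)//; try lra.
  by apply: ler_pM; lra.
have E2 : 0 <= (if t < 1 then t `^ (- (2 * b)) else 0) <= t `^ (- (2 * b)).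
  by case: ifP; rewrite ?lexx ?tb0.
have E3 : t `^ (- (2 * b)) <= M `^ a * t `^ (a - 2 * b).
  rewrite (_ : a - 2 * b = - (2 * b) + a); last by lra.
  rewrite powRD ?(gt_eqF t0) ?implybT// mulrCA ler_peMr// -powRM ?(ltW M0) ?(ltW t0)//.
  apply: (@le_trans _ _ (1 `^ a)); first by rewrite powR1.
  apply: ge0_ler_powR; rewrite ?nnegrE ?mulr_ge0 ?(ltW a0) ?(ltW M0) ?(ltW t0)//.
  by rewrite -ler_pdivrMl// mulr1.
set X := _ * (u * v) `^ b in E1 *; set Y := (if t < 1 then _ else _) in E2 *.
have /andP[X0 X1] := E1; have /andP[Y0 Y1] := E2.
apply: (@le_trans _ _ ((1 + (m `^ (- (2 * b)) * (M * M) `^ b)) * t `^ (- (2 * b)))).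
  rewrite ler_norml; apply/andP; split.
    apply: (@le_trans _ _ (- Y)); last by lra.
    rewrite lerN2; apply: (le_trans Y1); rewrite ler_peMl// lerDl mulr_ge0 ?powR_ge0//.
  by rewrite mulrDl mul1r [_ * t `^ _]mulrC; lra.
by rewrite /K2 -mulrA ler_wpM2l// addr_ge0 ?mulr_ge0 ?powR_ge0.
Qed.

End CircleLifts.

(** * The isometric action on functions of pairs *)

Section LiftedAction.
Variable R : realType.
Notation mu := (@lebesgue_measure R).
Notation plane := (measurableTypeR R * measurableTypeR R)%type.
Notation mu2 := (mu \x mu)%E.
Notation tau := (2 * @pi R).

Variables (G : groupType) (F : G -> R -> R).
Hypothesis HF : forall g, c1_lift (F g).
Hypothesis FM : forall g h, exists k : int, forall x,
  F (g * h)%g x = F g (F h x) + tau * k%:~R.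

Lemma lift_one : exists k : int, forall x, F 1%g x = x + tau * k%:~R.
Proof.
have [k Hk] := FM 1%g 1%g; exists (- k) => x.
have inj : injective (F 1%g).
  by apply: inc_inj; exact: le_mono (lift_incr (HF _)).
apply: inj; rewrite mulrNz mulrN -mulrN -mulrNz (translates_int (lift_translates (HF _))).
by have := Hk x; rewrite mulg1 => {2}->; rewrite mulrNz mulrN addrK.
Qed.

Lemma lift_inv g : exists k : int, forall x, F (g^-1)%g (F g x) = x + tau * k%:~R.
Proof.
have [k Hk] := FM (g^-1)%g g; have [k0 Hk0] := lift_one.
exists (k0 - k) => x; have := Hk x; rewrite mulVg Hk0 => H.
by rewrite intrB mulrBr addrA H addrK.
Qed.

Lemma lift_bij g : exists H : R -> R, cancel (F g) H /\ cancel H (F g).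
Proof.
have [j Hj] := lift_inv g; have [j2 Hj2] := lift_inv (g^-1)%g.
rewrite invgK in Hj2.
pose H y := F (g^-1)%g y - tau * j%:~R.
have HK : cancel (F g) H by move=> x; rewrite /H Hj addrK.
exists H; split => // y.
have <- : F g (F (g^-1)%g y - tau * j2%:~R) = y.
  by rewrite -mulrN -mulrNz (translates_int (lift_translates (HF _))) Hj2 mulrNz mulrN addrK.
by rewrite HK.
Qed.

Variables (b p : R).
Hypotheses (b0 : 0 < b) (pE : p = b^-1).

Definition lift_map (g : G) (z : plane) : plane := (F (g^-1)%g z.1, F (g^-1)%g z.2).
Definition lift_weight (g : G) (z : plane) : R :=
  (derive1 (F (g^-1)%g) z.1 * derive1 (F (g^-1)%g) z.2) `^ b.
Definition periodic_mfun : set (plane -> R) :=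
  [set f | measurable_fun [set: plane] f /\ @diag_periodic R R f].

Notation U := (wcomp lift_map lift_weight).

Lemma lift_measurable g : measurable_fun [set: measurableTypeR R] (F g : _ -> measurableTypeR R).
Proof. exact: continuous_measurable_fun (lift_continuous (HF g)). Qed.

Lemma measurable_lift_weight g : measurable_fun [set: plane] (lift_weight g).
Proof.
have mF' : measurable_fun [set: measurableTypeR R] (derive1 (F (g^-1)%g) : _ -> R).
  exact: continuous_measurable_fun (lift_derive_cont (HF _)).
apply: (measurableT_comp (measurable_powR b)); apply: measurable_funM.
  exact: (measurableT_comp mF' measurable_fst).
exact: (measurableT_comp mF' measurable_snd).
Qed.

Lemma periodic_mfun_linear (s t : R) f g : periodic_mfun f -> periodic_mfun g ->
  periodic_mfun (fun z => s * f z + t * g z).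
Proof.
move=> [mf pf] [mg pg]; split; last by move=> x y; rewrite pf pg.
by apply: measurable_funD; apply: measurable_funM.
Qed.

Lemma periodic_mfun_sub f g : periodic_mfun f -> periodic_mfun g -> periodic_mfun (fun z => f z - g z).
Proof.
move=> gf gg; have := periodic_mfun_linear 1 (-1) gf gg; congr periodic_mfun.
by apply/funext => z; rewrite mul1r mulN1r.
Qed.

Lemma periodic_mfun_wcomp g f : periodic_mfun f -> periodic_mfun (U g f).
Proof.
move=> [mf pf]; split.
  apply: measurable_funM; last exact: measurable_lift_weight.
  apply: (measurableT_comp mf); apply: measurable_pair_map; exact: lift_measurable.
move=> x y; rewrite /wcomp /lift_map /lift_weight /= !(lift_translates (HF _)) pf.
by rewrite !(derive1_periodic (lift_translates (HF _)) (lift_derivable (HF _))).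
Qed.

Lemma diag_periodic_int (f : R * R -> R) : diag_periodic f ->
  forall (k : int) x y, f (x + tau * k%:~R, y + tau * k%:~R) = f (x, y).
Proof.
move=> pf.
have nat_case (n : nat) x y : f (x + tau * n%:R, y + tau * n%:R) = f (x, y).
  elim: n x y => [|n ih] x y; first by rewrite mulr0 !addr0.
  by rewrite -[n.+1%:R]natr1 mulrDr mulr1 !addrA pf ih.
case=> n x y; first exact: nat_case.
by rewrite NegzE mulrNz mulrN -[LHS](nat_case n.+1) !subrK.
Qed.

(** The chain rule gives the weights; the multiple of 2 pi by which the lifts fail to compose
    disappears in the diagonally periodic f. *)
Lemma lift_wcompM g h f : periodic_mfun f -> U (g * h)%g f = U g (U h f).
Proof.
move=> [mf pf]; apply/funext => -[x y]; rewrite /wcomp /lift_map /lift_weight /=.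
have [k Hk] := FM (h^-1)%g (g^-1)%g; rewrite -invgM in Hk.
have D z : derive1 (F ((g * h)^-1)%g) z =
    derive1 (F (h^-1)%g) (F (g^-1)%g z) * derive1 (F (g^-1)%g) z.
  rewrite (_ : F _ = (fun x => (F (h^-1)%g \o F (g^-1)%g) x + tau * k%:~R)); last first.
    by apply/funext => t; rewrite Hk.
  have d1 : derivable (F (g^-1)%g) z 1 by exact: lift_derivable.
  have d2 : derivable (F (h^-1)%g) (F (g^-1)%g z) 1 by exact: lift_derivable.
  have d3 : derivable (F (h^-1)%g \o F (g^-1)%g) z 1.
    by apply/derivable1_diffP; apply: differentiable_comp; apply/derivable1_diffP.
  rewrite (derive1_addr (F := F (h^-1)%g \o F (g^-1)%g) _ d3); exact: (derive1_comp d1 d2).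
rewrite !Hk (diag_periodic_int pf) !D mulrACA -!mulrA; congr (_ * _).
by rewrite -powRM ?mulr_ge0 ?(ltW (lift_derive_gt0 (HF _) _))// mulrA.
Qed.

Lemma lift_wcomp1 f : periodic_mfun f -> U 1%g f = f.
Proof.
move=> [mf pf]; apply/funext => -[x y]; rewrite /wcomp /lift_map /lift_weight /= invg1.
have [k Hk] := lift_one.
have D z : derive1 (F 1%g) z = 1.
  rewrite (_ : F _ = (fun x => x + tau * k%:~R)); last by apply/funext.
  by have := is_derive_addr_cst (tau * k%:~R) z => H; rewrite derive1E derive_val.
by rewrite !Hk (diag_periodic_int pf) !D mulr1 powR1 mulr1.
Qed.

Lemma measurable_pow_norm (f : plane -> R) : measurable_fun [set: plane] f ->
  measurable_fun [set: plane] (fun z => (`|f z| `^ p)%:E).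
Proof.
by move=> mf; apply/measurable_EFinP; exact: measurable_norm_powR.
Qed.

(** Since p b = 1, the p-th power of the weight is the Jacobian of the map on pairs. *)
Lemma wcomp_powE g f z : (`|U g f z| `^ p)%:E =
  ((`|f (lift_map g z)| `^ p)%:E * (derive1 (F (g^-1)%g) z.1 * derive1 (F (g^-1)%g) z.2)%:E)%E.
Proof.
have d0 : 0 <= derive1 (F (g^-1)%g) z.1 * derive1 (F (g^-1)%g) z.2.
  by rewrite mulr_ge0 ?(ltW (lift_derive_gt0 (HF _) _)).
rewrite /wcomp /lift_weight normrM powRM// [`|_ `^ b|]ger0_norm ?powR_ge0// -powRrM pE divff ?gt_eqF//.
by rewrite powRr1// EFinM.
Qed.

Notation N := (pow_energy mu2 (strip 0) p).

Lemma lift_energy_wcomp g f : periodic_mfun f -> N (U g f) = N f.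
Proof.
move=> [mf pf]; rewrite /pow_energy.
have [H [K1 K2]] := lift_bij (g^-1)%g.
have HFg := HF (g^-1)%g.
rewrite -(integral_strip_substitution (lift_incr HFg) K1 K2 (lift_derivable HFg)
  (lift_derive_cont HFg) (lift_translates HFg) 0 (measurable_pow_norm mf)).
- by apply: eq_integral => z _; rewrite wcomp_powE.
- by move=> z; rewrite lee_fin powR_ge0.
- by move=> x y; rewrite pf.
Qed.

Lemma measurable_kern : measurable_fun [set: plane] (kern b : plane -> R).
Proof.
rewrite /kern; apply: measurable_fun_ifT => //.
  apply: measurable_and; apply: measurable_fun_ltr => //; exact: measurable_funB.
apply: (measurableT_comp (measurable_powR _)); exact: measurable_funB.
Qed.

Lemma periodic_mfun_kern : periodic_mfun (kern b).
Proof.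
split; first exact: measurable_kern.
by move=> x y; rewrite /kern /= opprD addrACA subrr addr0.
Qed.

Variable a : R.
Hypotheses (ba : b < a) (b1 : b <= 1).
Hypothesis hol : forall g, exists C : R, forall s t,
  `|derive1 (F g) s - derive1 (F g) t| <= C * `|s - t| `^ a.

(** The kernel moves by O((y - x)^(a - 2b)), and p (a - 2b) = a / b - 2 exceeds -1 because b < a. *)
Lemma kern_energy_lty g : (N (fun z => U g (kern b) z - kern b z)%R < +oo)%E.
Proof.
have a0 : 0 < a by apply: lt_trans ba.
have b01 : 0 < b <= 1 by rewrite b0.
have p0 : 0 < p by rewrite pE invr_gt0.
have [C HC] := hol (g^-1)%g.
have [K [L [K0 L0 H]]] := pull_kern_estimate (HF (g^-1)%g) b01 a0 HC.
have c1 : -1 < p * (a - 2 * b).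
  have -> : p * (a - 2 * b) = a / b - 2.
    by rewrite pE mulrBr mulrC; congr (_ - _); rewrite mulrCA mulVf ?mulr1// gt_eqF.
  have : 1 < a / b by rewrite ltr_pdivlMr// mul1r.
  by move: (a / b) => q; lra.
have Kp0 : 0 <= K `^ p by exact: powR_ge0.
apply: le_lt_trans (integral_strip_powR_lty 0 c1 L0 Kp0).
apply: ge0_le_integral.
- exact: measurable_strip.
- by move=> z _; rewrite lee_fin powR_ge0.
- apply: measurable_funTS; apply: measurable_pow_norm.
  apply: measurable_funB; last exact: measurable_kern.
  by have [] := periodic_mfun_wcomp g periodic_mfun_kern.
- apply/measurable_EFinP/measurable_funTS; apply: measurable_fun_ifT => //.
    by apply: measurable_fun_ler => //; exact: measurable_funB.
  apply: measurable_funM => //; apply: (measurableT_comp (measurable_powR _)); exact: measurable_funB.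
move=> [x y] [_ /= xy]; rewrite lee_fin.
have H1 : `|U g (kern b) (x, y) - kern b (x, y)| <=
  if y - x <= L then K * (y - x) `^ (a - 2 * b) else 0 := H x y xy.
move: H1; case: (y - x <= L) => H1.
  have t0 : 0 < y - x by rewrite subr_gt0.
  have -> : K `^ p * (y - x) `^ (p * (a - 2 * b)) = (K * (y - x) `^ (a - 2 * b)) `^ p.
    by rewrite powRM ?powR_ge0// -powRrM [p * _]mulrC.
  by apply: (ge0_ler_powR (ltW p0) _ _ H1); rewrite nnegrE// mulr_ge0 ?powR_ge0.
by rewrite (_ : `|_| = 0) ?powR0 ?gt_eqF//; apply/eqP; rewrite eq_le normr_ge0 andbT.
Qed.

End LiftedAction.

(** * Fixed points of lifts *)

Section Freeness.
Variable R : realType.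
Notation mu := (@lebesgue_measure R).
Notation plane := (measurableTypeR R * measurableTypeR R)%type.
Notation mu2 := (mu \x mu)%E.
Notation tau := (2 * @pi R).

Variables (Phi H : R -> R).
Hypothesis HPhi : c1_lift Phi.
Hypotheses (PhiK : cancel Phi H) (HK : cancel H Phi).
Variables (b p : R).
Hypotheses (b0 : 0 < b) (pE : p = b^-1) (p2 : 2 < p).

Notation E D f := (pow_energy mu2 D p f).

Variable X : nat -> plane -> R.
Hypothesis goodX : forall n, periodic_mfun (X n).
Variables (theta C C' : R).
Hypothesis theta01 : 0 <= theta < 1.
Hypothesis C0 : 0 <= C.
Hypothesis almost_fixed : forall n,
  (E (strip 0) (fun z => pull b Phi (X n) z - X n z)%R <= (C * theta ^+ n)%:E)%E.
Hypothesis near_kern : forall n,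
  (E (strip 0) (fun z => X n z - kern b z)%R <= C'%:E)%E.

Let mX n : measurable_fun [set: plane] (X n). Proof. by case: (goodX n). Qed.

Let mkern : measurable_fun [set: plane] (kern b : plane -> R).
Proof. exact: measurable_kern. Qed.

Lemma pow_energy_subset (D D' : set plane) f : measurable D -> measurable D' ->
  measurable_fun [set: plane] f -> D `<=` D' -> (E D f <= E D' f)%E.
Proof.
move=> mD mD' mf DD'; apply: ge0_subset_integral => //.
by apply: measurable_funTS; exact: measurable_pow_norm.
Qed.

Lemma pow_energy_strip (a : R) f : periodic_mfun f -> E (strip a) f = E (strip 0) f.
Proof.
move=> [mf pf]; apply: integral_strip.
- exact: measurable_pow_norm.
- by move=> z; rewrite lee_fin powR_ge0.
- by move=> x y; rewrite pf.
Qed.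

Lemma pow_energy_mix (D : set plane) (f g : plane -> R) (l : R) : measurable D ->
  measurable_fun [set: plane] f -> measurable_fun [set: plane] g -> 0 < l < 1 ->
  (E D f <= (l `^ (1 - p))%:E * E D g
            + ((1 - l) `^ (1 - p))%:E * E D (fun z => f z - g z)%R)%E.
Proof.
move=> mD mf mg l01.
have := @pow_energy_le _ _ _ mu2 _ mD p bool
  (fun c => if c then l `^ (1 - p) else (1 - l) `^ (1 - p)) f
  (fun c => if c then g else fun z => f z - g z).
rewrite big_bool /=; apply => //.
- by case; exact: powR_ge0.
- by case => //; exact: measurable_funB.
move=> z; rewrite big_bool /=.
have -> : f z = g z + (f z - g z) by rewrite addrC subrK.
by apply: (le_trans (normr_powR_mix p2 _ _ l01)); rewrite [g z + _]addrC subrK.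
Qed.

Let mpull n : measurable_fun [set: plane] (pull b Phi (X n) : plane -> R).
Proof.
have mPhi : measurable_fun [set: measurableTypeR R] (Phi : _ -> measurableTypeR R).
  exact: continuous_measurable_fun (lift_continuous HPhi).
have mPhi' : measurable_fun [set: measurableTypeR R] (derive1 Phi : _ -> R).
  exact: continuous_measurable_fun (lift_derive_cont HPhi).
apply: measurable_funM.
  exact: (measurableT_comp (mX n) (measurable_pair_map mPhi)).
apply: (measurableT_comp (measurable_powR b)); apply: measurable_funM.
  exact: (measurableT_comp mPhi' measurable_fst).
exact: (measurableT_comp mPhi' measurable_snd).
Qed.

Let good_pull_diff n : periodic_mfun (fun z => pull b Phi (X n) z - X n z).
Proof.
split; first exact: measurable_funB.
move=> x y; have [_ pX] := goodX n.
rewrite /pull /= !(lift_translates HPhi) !pX.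
by rewrite !(derive1_periodic (lift_translates HPhi) (lift_derivable HPhi)).
Qed.

Lemma pow_energy_pull (D : set plane) n : measurable D ->
  E [set z | D (Phi z.1, Phi z.2)] (pull b Phi (X n)) = E D (X n).
Proof.
move=> mD; rewrite /pow_energy.
rewrite -(ge0_plane_substitution_set (lift_incr HPhi) PhiK HK (lift_derivable HPhi)
   (lift_derive_cont HPhi) mD (measurable_pow_norm p (mX n))); last first.
  by move=> z; rewrite lee_fin powR_ge0.
apply: eq_integral => z _; rewrite /pull.
have d0 : 0 <= derive1 Phi z.1 * derive1 Phi z.2.
  by rewrite mulr_ge0 ?(ltW (lift_derive_gt0 HPhi _)).
rewrite normrM powRM// [`|_ `^ b|]ger0_norm ?powR_ge0// -powRrM pE divff ?gt_eqF//.
by rewrite powRr1// EFinM.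
Qed.

Section Corner.
Variables (x0 e y : R).
Hypotheses (fix0 : Phi x0 = x0) (fixe : Phi e = e).
Hypotheses (x0y : x0 <= y) (ex0 : e <= x0 + tau).

(** The second factor runs between two consecutive translates of the fixed point e, so [Phi] maps it
    onto itself and moves only the first one. For abscissas below e, such a box can approach the
    diagonal only at the corner (e, e). *)
Let box (s t : R) : set plane := `]s, t]%classic `*` `[e, e + tau]%classic.
Let cbox (t : R) : set plane := `[x0, t]%classic `*` `[e, e + tau]%classic.

Let mbox s t : measurable (box s t). Proof. by apply: measurableX. Qed.
Let mcbox t : measurable (cbox t). Proof. by apply: measurableX. Qed.

Let PhileE u v : (Phi u <= Phi v) = (u <= v).
Proof. exact: (le_mono (lift_incr HPhi)). Qed.

Let cbox_strip t : t < e -> cbox t `<=` strip x0.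
Proof.
move=> te z [/=]; rewrite !in_itv/= => /andP[h1 h2] /andP[h3 h4]; split=> /=.
  by rewrite h1/=; apply: le_lt_trans h2 _; exact: lt_le_trans te ex0.
by apply: le_lt_trans h2 _; exact: lt_le_trans te h3.
Qed.

Let cbox_kern_lty t : t < e -> exists B : R, (E (cbox t) (kern b) <= B%:E)%E.
Proof.
move=> te; have et : 0 < e - t by rewrite subr_gt0.
pose M := (e - t) `^ (- (2 * b)).
have M0 : 0 <= M by exact: powR_ge0.
have p0 : 0 <= p by rewrite pE invr_ge0 ltW.
have mu_fin : (mu2 (cbox t) < +oo)%E.
  rewrite product_measure1E//; apply: lte_mul_pinfty => //.
    by rewrite ge0_fin_numE ?measure_ge0//= lebesgue_measure_itv/=; case: ifP => _; rewrite ltry.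
  by rewrite /= lebesgue_measure_itv/=; case: ifP => _; rewrite ltry.
exists (M `^ p * fine (mu2 (cbox t))).
rewrite EFinM fineK ?ge0_fin_numE ?measure_ge0// -integral_cst//.
apply: ge0_le_integral => //.
- by apply: measurable_funTS; exact: measurable_pow_norm.
move=> z [/=]; rewrite !in_itv/= => /andP[h1 h2] /andP[h3 h4].
rewrite lee_fin; apply: ge0_ler_powR; rewrite ?nnegrE//.
rewrite ger0_norm ?kern_ge0// /kern; case: ifP => // /andP[z0 z1].
rewrite /M !powRN lef_pV2 ?posrE ?powR_gt0//.
apply: ge0_ler_powR; rewrite ?nnegrE ?mulr_ge0 ?(ltW b0) ?(ltW z0) ?(ltW et)//.
lra.
Qed.

Let half01 : 0 < (2^-1 : R) < 1.
Proof. by rewrite invr_gt0 ltr0n invf_lt1// ltr1n. Qed.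

Let K := 2^-1 `^ (1 - p).
Let K0 : 0 <= K. Proof. exact: powR_ge0. Qed.
Let half_compl : 1 - 2^-1 = 2^-1 :> R. Proof. lra. Qed.

(** For t < e the box stays away from the corner, so [kern b] is bounded on it, and [X n] is at
    bounded distance from [kern b]. The bound depends on t but not on n. *)
Let cbox_bounded t : t < e -> exists2 B : R, 0 <= B & forall n, (E (cbox t) (X n) <= B%:E)%E.
Proof.
move=> te; have [B HB] := cbox_kern_lty te.
exists (Num.max 0 (K * B + K * C')); first by rewrite le_max lexx.
move=> n; apply: (@le_trans _ _ (K * B + K * C')%:E); last by rewrite lee_fin le_max lexx orbT.
apply: (le_trans (pow_energy_mix (mcbox t) (mX n) mkern half01)).
rewrite half_compl -/K EFinD !EFinM; apply: leeD; apply: lee_wpmul2l; rewrite ?lee_fin//.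
apply: le_trans (near_kern n).
rewrite -(pow_energy_strip x0); last first.
  by apply: periodic_mfun_sub => //; exact: periodic_mfun_kern.
apply: pow_energy_subset => //; first exact: measurable_strip.
  exact: measurable_funB.
exact: cbox_strip.
Qed.

Let energy_setU (D D' : set plane) f : measurable D -> measurable D' -> [disjoint D & D'] ->
  measurable_fun [set: plane] f -> E (D `|` D') f = (E D f + E D' f)%E.
Proof.
move=> mD mD' DD' mf; rewrite /pow_energy ge0_integral_setU//.
by apply: measurable_funTS; exact: measurable_pow_norm.
Qed.

(* [Phi] maps the box over [x0, s] onto the box over [x0, Phi s]: as [X n] is almost
   invariant, the two have almost the same mass. *)
Let box_le s n (l B : R) : x0 <= s -> s <= Phi s -> Phi s < e -> 0 < l < 1 ->
  (E (cbox s) (X n) <= B%:E)%E ->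
  (E (box s (Phi s)) (X n) <=
    ((l `^ (1 - p) - 1) * B + (1 - l) `^ (1 - p) * (C * theta ^+ n))%:E)%E.
Proof.
move=> x0s sPhi Phie l01 HB.
have se : s < e by exact: le_lt_trans Phie.
have p1 : 1 - p <= 0 by move: p2 => ?; lra.
have l1 : 1 <= l `^ (1 - p).
  have /andP[l0 l1] := l01.
  rewrite -opprB powRN invf_ge1 ?powR_gt0//.
  have p10 : 0 <= p - 1 by move: p1; lra.
  have := @ge0_ler_powR R (p - 1) p10 l 1; rewrite powR1; apply.
  - by rewrite nnegrE ltW.
  - by rewrite nnegrE.
  - exact: ltW.
have E1 : E (cbox (Phi s)) (X n) = (E (cbox s) (X n) + E (box s (Phi s)) (X n))%E.
  rewrite -energy_setU//; last first.
    rewrite disj_set2E; apply/eqP/seteqP; split => // z [[/= + _] [/= + _]].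
    by rewrite !in_itv/= => /andP[_ h1] /andP[h2 _]; move: (le_lt_trans h1 h2); rewrite ltxx.
  congr (E _ _); apply/seteqP; split => z; rewrite /cbox /box /= !in_itv/=.
    move=> [/andP[h1 h2] h3]; have [h4|h4] := leP z.1 s; [left|right]; split=> //.
      by rewrite h1.
  move=> [[/andP[h1 h2] h3]|[/andP[h1 h2] h3]]; split=> //.
    by rewrite h1/=; exact: le_trans sPhi.
  by rewrite h2 andbT; apply: ltW; exact: le_lt_trans h1.
have E2 : E (cbox (Phi s)) (X n) = E (cbox s) (pull b Phi (X n)).
  rewrite -pow_energy_pull//; congr (E _ _).
  have eT : Phi (e + tau) = e + tau by rewrite (lift_translates HPhi) fixe.
  apply/seteqP; split => z; rewrite /cbox /= !in_itv/=.
    by rewrite -{1}fix0 -{1}fixe -{1}eT !PhileE.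
  by rewrite -{2}fix0 -{3}fixe -{2}eT !PhileE.
have := pow_energy_mix (mcbox s) (mpull n) (mX n) l01.
rewrite -E2 E1.
have D1 : (E (cbox s) (fun z => pull b Phi (X n) z - X n z)%R <= (C * theta ^+ n)%:E)%E.
  apply: le_trans (almost_fixed n); rewrite -(pow_energy_strip x0)//.
  apply: pow_energy_subset => //; first exact: measurable_strip.
    exact: measurable_funB.
  exact: cbox_strip.
have : E (cbox s) (X n) \is a fin_num.
  by rewrite ge0_fin_numE ?pow_energy_ge0//; apply: le_lt_trans HB _; rewrite ltry.
move: HB D1; case: (E (cbox s) (X n)) => // A HB D1 _.
set Q := E (box s _) _; set W := E (cbox s) _ in D1 *.
have W0 : (0 <= W)%E by exact: pow_energy_ge0.
move=> H1.
have {}H1 : (A%:E + Q <= (l `^ (1 - p) * A + (1 - l) `^ (1 - p) * (C * theta ^+ n))%:E)%E.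
  apply: (le_trans H1); rewrite EFinD !EFinM; apply: leeD => //.
  by rewrite -EFinM; apply: lee_wpmul2l => //; rewrite lee_fin powR_ge0.
rewrite lee_fin in HB.
rewrite -(leeD2lE (x := A%:E))//; apply: (le_trans H1); rewrite -EFinD lee_fin.
have := ler_wpM2l (_ : 0 <= l `^ (1 - p) - 1) HB; rewrite subr_ge0 => /(_ l1).
move: (l `^ (1 - p)) ((1 - l) `^ (1 - p) * _) => u v; lra.
Qed.

Let theta_small (D eps : R) : 0 < eps -> 0 <= D -> exists n0 : nat, forall n, (n0 <= n)%N ->
  D * theta ^+ n <= eps.
Proof.
move=> eps0 D0; have [t0 t1] := andP theta01.
have : theta ^+ n @[n --> \oo] --> (0 : R) by apply: cvg_expr; rewrite ger0_norm.
have D10 : 0 < D + 1 by lra.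
move/cvgrPdist_lt => /(_ (eps / (D + 1)) (divr_gt0 eps0 D10)) [n0 _ H1].
exists n0 => n n0n; have := H1 n n0n.
rewrite /= sub0r normrN ger0_norm ?exprn_ge0// ltr_pdivlMr// => H2.
have := exprn_ge0 n t0; nra.
Qed.

(** The parameter l is fixed first, close enough to 1 to make the term (l^(1 - p) - 1) B of [box_le]
    small; the factor (1 - l)^(1 - p) is then a constant, beaten by theta^n. *)
Let box_small s (eps : R) : x0 <= s -> s <= Phi s -> Phi s < e -> 0 < eps ->
  exists n0 : nat, forall n, (n0 <= n)%N -> (E (box s (Phi s)) (X n) <= eps%:E)%E.
Proof.
move=> x0s sPhi Phie eps0.
have [B B0 HB] := cbox_bounded (le_lt_trans sPhi Phie).
pose d := eps / 2 / (B + 1).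
have B10 : 0 < B + 1 by lra.
have d0 : 0 < d by rewrite !divr_gt0.
have p1 : 0 < p - 1 by move: p2 => ?; lra.
pose l := (1 + d) `^ (- (p - 1)^-1).
have d1 : 0 < 1 + d by lra.
have l01 : 0 < l < 1.
  rewrite powR_gt0//= /l powRN invf_lt1 ?powR_gt0//.
  have := @gt0_ltr_powR R (p - 1)^-1 (_ : 0 < (p - 1)^-1) 1 (1 + d).
  by rewrite powR1; apply; rewrite ?invr_gt0 ?nnegrE//; lra.
have lE : l `^ (1 - p) = 1 + d.
  rewrite /l -powRrM (_ : - (p - 1)^-1 * (1 - p) = 1) ?powRr1 ?(ltW d1)//.
  by rewrite -[1 - p]opprB mulrN mulNr opprK mulVf// gt_eqF.
have e20 : 0 < eps / 2 by lra.
have D0 : 0 <= (1 - l) `^ (1 - p) * C by rewrite mulr_ge0 ?powR_ge0.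
have [n0 Hn0] := theta_small e20 D0.
exists n0 => n n0n; apply: (le_trans (box_le x0s sPhi Phie l01 (HB n))).
have {}Hn0 := Hn0 n n0n.
have dE : 1 + d - 1 = d by rewrite addrC addKr.
rewrite lee_fin lE dE mulrA.
have dB : d * B <= eps / 2.
  rewrite /d mulrAC ler_pdivrMr// ler_wpM2l ?(ltW e20)//; lra.
lra.
Qed.

Hypothesis y_adv : y < Phi y.
Notation yy j := (iter j Phi y).
Hypothesis orbit_lt : forall j, yy j < e.

Let yy_inc j : yy j <= yy j.+1.
Proof. by elim: j => [|j ih]; [exact: ltW|rewrite !iterS PhileE]. Qed.

Let yy_ge j : y <= yy j.
Proof. by elim: j => [|j ih] //; exact: le_trans (yy_inc j). Qed.

Let box_split s t u : s <= t -> t <= u -> box s u = box s t `|` box t u.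
Proof.
move=> st tu; apply/seteqP; split => z; rewrite /box /= !in_itv/=.
  move=> [/andP[h1 h2] h3]; have [h4|h4] := leP z.1 t; [left|right]; split=> //.
  by rewrite h1.
move=> [[/andP[h1 h2] h3]|[/andP[h1 h2] h3]]; split=> //.
  by rewrite h1/=; exact: le_trans tu.
by rewrite h2 andbT; exact: le_lt_trans h1.
Qed.

Let box_disj s t u : [disjoint box s t & box t u].
Proof.
rewrite disj_set2E; apply/eqP/seteqP; split => // z [[/= + _] [/= + _]].
by rewrite !in_itv/= => /andP[_ h1] /andP[h2 _]; move: (le_lt_trans h1 h2); rewrite ltxx.
Qed.

Let orbit_box_small j (eps : R) : 0 < eps ->
  exists n0 : nat, forall n, (n0 <= n)%N -> (E (box y (yy j)) (X n) <= eps%:E)%E.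
Proof.
elim: j eps => [|j ih] eps eps0.
  exists 0%N => n _; rewrite /= /box set_itvoc0 set0X /pow_energy integral_set0.
  by rewrite lee_fin ltW.
have e20 : 0 < eps / 2 by lra.
have [n1 H1] := ih _ e20.
have [n2 H2] := box_small (le_trans x0y (yy_ge j)) (yy_inc j) (orbit_lt j.+1) e20.
exists (maxn n1 n2) => n; rewrite geq_max => /andP[/H1 {}H1 /H2 {}H2].
rewrite (box_split (yy_ge j) (yy_inc j)) energy_setU//.
apply: (le_trans (leeD H1 H2)); rewrite -EFinD lee_fin; lra.
Qed.

(** The index [n0] depends on j but the bound does not: [X n0] has energy at most 1 on the box, and
    its distance to [kern b] is bounded uniformly. *)
Let orbit_box_kern j : (E (box y (yy j)) (kern b) <= (K + K * C')%:E)%E.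
Proof.
have [n0 Hn] := orbit_box_small j ltr01.
apply: (le_trans (pow_energy_mix (mbox y (yy j)) mkern (mX n0) half01)).
rewrite half_compl -/K EFinD EFinM; apply: leeD.
  by rewrite -[leRHS]mule1; apply: lee_wpmul2l; rewrite ?lee_fin//; exact: Hn.
apply: lee_wpmul2l; rewrite ?lee_fin//; apply: le_trans (near_kern n0).
have -> : E (box y (yy j)) (fun z => kern b z - X n0 z)%R =
    E (box y (yy j)) (fun z => X n0 z - kern b z)%R.
  by apply: pow_energyN => z; rewrite opprB.
rewrite -(pow_energy_strip x0); last by apply: periodic_mfun_sub => //; exact: periodic_mfun_kern.
apply: pow_energy_subset => //; first exact: measurable_strip.
  exact: measurable_funB.
apply: subset_trans (cbox_strip (orbit_lt j)).
move=> z [/=]; rewrite !in_itv/= => /andP[h1 h2] h3; split; rewrite /= in_itv/=//.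
by rewrite h2 andbT; apply: le_trans x0y _; exact: ltW.
Qed.

(* On a square of side r/2 with a corner near (e, e), [kern b] to the power p is at
   least (3r/2)^-2, whatever r. *)
Let corner_mass s : y < s -> s < e -> e - s < 2^-1 ->
  ((9^-1)%:E <= E (box s (e - (e - s) / 2)) (kern b))%E.
Proof.
move=> ys se es; set r := e - s.
have r0 : 0 < r by rewrite subr_gt0.
have tpi : 2 <= tau by have := pi_ge2 R; lra.
pose S : set plane := `]s, e - r / 2]%classic `*` `[e, e + r / 2]%classic.
have mS : measurable S by apply: measurableX.
have SB : S `<=` box s (e - r / 2).
  move=> z [/= h1]; rewrite in_itv/= => /andP[h2 h3]; split => //=.
  by rewrite in_itv/= h2/=; apply: le_trans h3 _; rewrite lerD2l /r; lra.
apply: le_trans (pow_energy_subset mS (mbox _ _) mkern SB).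
pose c := (3 / 2 * r) `^ (- (2 * b)).
have -> : (9^-1)%:E = ((c `^ p)%:E * mu2 S)%E :> \bar R.
  rewrite product_measure1E//= !lebesgue_measure_itv/= !lte_fin.
  rewrite ifT; last by rewrite /r; lra.
  rewrite ifT; last by lra.
  rewrite -!EFinB -!EFinM; congr EFin.
  have -> : c `^ p = (3 / 2 * r) ^- 2.
    rewrite /c -powRrM (_ : - (2 * b) * p = - 2%:R); last first.
      by rewrite mulNr -mulrA pE divff ?gt_eqF// mulr1.
    by rewrite powRN powR_mulrn// mulr_ge0 ?(ltW r0)//; lra.
  have -> : (e - r / 2 - s) * (e + r / 2 - e) = r ^+ 2 / 4 by rewrite /r; lra.
  rewrite exprMn invfM -mulrA (mulrA (r ^+ 2)^-1) mulVf ?expf_neq0 ?gt_eqF//; lra.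
rewrite -integral_cst//; apply: ge0_le_integral => //.
- by move=> z _; rewrite lee_fin powR_ge0.
- by apply: measurable_funTS; exact: measurable_pow_norm.
move=> z [/=]; rewrite !in_itv/= => /andP[h1 h2] /andP[h3 h4]; rewrite lee_fin.
have z0 : 0 < z.2 - z.1 by lra.
have z3 : z.2 - z.1 <= 3 / 2 * r by rewrite /r in h2 h4 *; lra.
have z1 : z.2 - z.1 < 1 by rewrite /r in z3; lra.
rewrite ger0_norm ?kern_ge0// /kern; case: ifP => [_|/negP[]]; last by apply/andP.
apply: ge0_ler_powR; rewrite ?nnegrE ?powR_ge0//; first by rewrite pE invr_ge0 ltW.
rewrite /c !powRN lef_pV2 ?posrE ?powR_gt0//; last lra.
apply: ge0_ler_powR; rewrite ?nnegrE ?mulr_ge0 ?(ltW b0) ?(ltW z0)//; lra.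
Qed.

(** Each halving of the distance from s to e adds a disjoint box of mass at least 1/9. *)
Let kern_mass_unbounded (I : nat) : exists s, [/\ y < s, s < e &
  ((I%:R / 9)%:E <= E (box y s) (kern b))%E].
Proof.
suff step (J : nat) : exists s, [/\ y < s, s < e, e - s < 2^-1 &
    ((J%:R / 9)%:E <= E (box y s) (kern b))%E].
  by have [s [? ? _ ?]] := step I; exists s.
elim: J => [|J [s [ys se es ih]]].
  have ye : y < e := orbit_lt 0.
  pose r := Num.min ((e - y) / 2) 4^-1.
  have r0 : 0 < r by rewrite lt_min; apply/andP; split; lra.
  have ry : r <= (e - y) / 2 by rewrite ge_min lexx.
  have r4 : r <= 4^-1 by rewrite ge_min lexx orbT.
  exists (e - r); split; [lra|lra|lra|].
  by rewrite mul0r pow_energy_ge0.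
exists (e - (e - s) / 2); split; [lra|lra|lra|].
rewrite (@box_split y s); [|lra|lra].
rewrite energy_setU// -natr1 mulrDl mul1r EFinD; apply: leeD => //.
exact: corner_mass.
Qed.

Hypothesis orbit_cvg : forall s, s < e -> exists j, s < yy j.

Lemma advance_between_fixed_absurd : False.
Proof.
pose B := K + K * C'.
have [s [ys se]] := kern_mass_unbounded (Num.truncn (9 * B)).+1.
have [j sj] := orbit_cvg se.
apply/negP; rewrite -ltNge; apply: le_lt_trans (_ : (B%:E < _)%E).
  apply: le_trans (orbit_box_kern j); apply: pow_energy_subset => //.
  move=> z [/=]; rewrite !in_itv/= => /andP[h1 h2] h3; split; rewrite /= in_itv/=//.
  by rewrite h1/=; apply: le_trans h2 _; exact: ltW.
rewrite lte_fin ltr_pdivlMr// mulrC; exact: truncnS_gt.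
Qed.

End Corner.
End Freeness.

(** * Circle maps and their lifts *)

Section CircleExp.
Variable R : realType.
Notation tau := (2 * @pi R).

Lemma tauE : tau = pi *+ 2.
Proof. by rewrite mulr_natl. Qed.

Lemma circle_expS (x : R) : circle_exp (x + tau) = circle_exp x.
Proof. by apply: val_inj; rewrite /= tauE cosD2pi sinD2pi. Qed.

Lemma circle_exp_int (x : R) (k : int) : circle_exp (x + tau * k%:~R) = circle_exp x.
Proof. exact: (periodic_int circle_expS). Qed.

Lemma cos_eq1_int (x : R) : cos x = 1 -> exists k : int, x = tau * k%:~R.
Proof.
move=> cx; have [k /andP[r0]] := reduce_mod_tau 0 x; rewrite add0r => r1.
set r := x + _ in r0 r1.
have cr : cos r = 1.
  by have := congr1 (fun z => (val z).1) (circle_exp_int x k); rewrite /= cx.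
suff rE : r = 0 by exists (- k); apply/eqP; rewrite -subr_eq0 mulrNz mulrN opprK -/r rE.
have pi0 : 0 <= @pi R by exact: pi_ge0.
have [rpi|pir] := leP r pi.
  by apply: cos_inj; rewrite ?in_itv/= ?r0 ?rpi ?lexx ?cr ?cos0.
(* For r beyond pi, the reflection 2 pi - r falls in [0, pi], where cos is injective. *)
have E : cos (tau - r) = cos 0.
  by rewrite cos0 -cosN opprB -(cosD2pi (r - tau)) -tauE subrK.
have H1 : tau - r \in `[0, pi] by rewrite in_itv/=; apply/andP; split; lra.
have H2 : 0 \in `[0, @pi R] by rewrite in_itv/= lexx.
have := cos_inj H1 H2 E; lra.
Qed.

Lemma circle_exp_inj_int (x y : R) : circle_exp x = circle_exp y ->
  exists k : int, x = y + tau * k%:~R.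
Proof.
move=> /(congr1 val) /= [cxy sxy].
have [|k Hk] := @cos_eq1_int (x - y); first by rewrite cosB cxy sxy -!expr2 cos2Dsin2.
by exists k; rewrite -Hk addrC subrK.
Qed.

Lemma circle_exp_surj (z : circle R) : exists t, circle_exp t = z.
Proof.
case: z => -[x y] xy; have /= /eqP xy1 := xy.
have x1 : -1 <= x <= 1 by have y2 := sqr_ge0 y; rewrite !expr2 in xy1 y2; apply/andP; split; nra.
have ca : cos (acos x) = x by rewrite acosK// in_itv.
have sa : sin (acos x) = `|y|.
  by rewrite sin_acos// (_ : 1 - x ^+ 2 = y ^+ 2) ?sqrtr_sqr//; lra.
have [y0|y0] := leP 0 y.
  by exists (acos x); apply: val_inj; rewrite /= ca sa ger0_norm.
by exists (- acos x); apply: val_inj; rewrite /= cosN sinN ca sa ltr0_norm// opprK.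
Qed.

(** Between two distinct values the intermediate value theorem would produce an odd multiple of
    pi. *)
Lemma continuous_tau_int (u : R -> R) : continuous u ->
  (forall t, exists k : int, u t = tau * k%:~R) -> forall s t, u s = u t.
Proof.
move=> cu uZ.
have key s t : u s < u t -> s <= t \/ t <= s -> False.
  move=> ust st; have [ks Hks] := uZ s; have [kt Hkt] := uZ t.
  have t0 := tau_gt0 R.
  have kst : ks%:~R + 1 <= kt%:~R :> R.
    move: ust; rewrite Hks Hkt (ltr_pM2l t0) ltr_int => h.
    by rewrite -[1]/(1%:~R) -intrD ler_int lezD1.
  have [c Hc] : exists c, u c = u s + tau / 2.
    have h1 : u s <= u s + tau / 2 <= u t.
      by rewrite Hks Hkt; apply/andP; split; nra.
    case: st => st.
      have [c _ Hc] := @IVT _ u s t (u s + tau / 2) st (continuous_subspaceT cu)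
         (ltac:(by rewrite (min_idPl (ltW ust)) (max_idPr (ltW ust)))).
      by exists c.
    have [c _ Hc] := @IVT _ u t s (u s + tau / 2) st (continuous_subspaceT cu)
       (ltac:(by rewrite (min_idPr (ltW ust)) (max_idPl (ltW ust)))).
    by exists c.
  have [kc Hkc] := uZ c; move: Hc; rewrite Hkc Hks => E.
  have E2 : (kc%:~R - ks%:~R) * 2 = 1 :> R by apply: (mulfI (lt0r_neq0 t0)); lra.
  have E3 : ((kc - ks) * 2)%:~R = 1%:~R :> R by rewrite intrM intrB.
  have {E3} := intr_inj E3; move: (kc - ks)%R => [n|n].
    by case: n => [|[|n]].
  by rewrite NegzE; case: n.
move=> s t; apply/eqP; rewrite eq_le; apply/andP; split; rewrite leNgt; apply/negP => h.
  by apply: (key _ _ h); have [|/ltW] := leP t s; [left|right].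
by apply: (key _ _ h); have [|/ltW] := leP s t; [left|right].
Qed.

Lemma lifts_differ (f : circle R -> circle R) (F F' : R -> R) :
  is_lift f F -> is_lift f F' -> exists k : int, forall t, F t = F' t + tau * k%:~R.
Proof.
move=> [cF fF] [cF' fF'].
have E t : exists k : int, F t - F' t = tau * k%:~R.
  have [|k Hk] := @circle_exp_inj_int (F t) (F' t); first by rewrite -fF -fF'.
  by exists k; rewrite Hk addrC addKr.
have [k Hk] := E 0; exists k => t.
have cd : continuous (fun t => F t - F' t) by move=> u; apply: cvgB; [exact: cF|exact: cF'].
by have := continuous_tau_int cd E t 0; rewrite Hk => <-; rewrite addrC subrK.
Qed.

(** The lift advances by 2 pi k over a period, with k > 0 by monotonicity. If k were at least 2, the
    value F 0 + 2 pi would be taken strictly inside the period, against the injectivity of f. *)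
Lemma increasing_lift_translates (f : circle R -> circle R) (F : R -> R) :
  injective f -> is_lift f F -> {homo F : x y / x < y} -> translates F.
Proof.
move=> finj fF incF; have [cF fFE] := fF.
have FS : is_lift f (fun t => F (t + tau)).
  split; last by move=> t; rewrite -fFE circle_expS.
  by move=> t; apply: continuous_comp; [apply: cvgD; [exact: cvg_id|exact: cvg_cst]|exact: cF].
have [k Hk] := lifts_differ FS fF.
have t0 := tau_gt0 R.
suff k1 : k = 1 by move=> t; rewrite Hk k1 mulr1.
have kp : (0 : R) < k%:~R.
  have := incF 0 (0 + tau); rewrite ltrDl => /(_ t0); rewrite Hk ltrDl.
  by rewrite pmulr_rgt0.
apply/eqP; rewrite eq_le; apply/andP; split; last by rewrite -gtz0_ge1 -(ltr_int R).
rewrite leNgt; apply/negP => k2.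
have k2R : 1 < k%:~R :> R by rewrite -[1]/(1%:~R) ltr_int.
have [c] : exists2 c, c \in `[0, tau] & F c = F 0 + tau.
  apply: IVT; [exact: ltW|exact: continuous_subspaceT|].
  have := Hk 0; rewrite add0r => ->.
  rewrite ge_min le_max; apply/andP; split; apply/orP; [left|right]; nra.
rewrite in_itv/= => /andP[c0 ct] Fc.
have : circle_exp c = circle_exp 0 by apply: finj; rewrite !fFE Fc circle_expS.
move=> /circle_exp_inj_int[j]; rewrite add0r => cj.
have j0 : 0 <= j%:~R :> R by move: c0; rewrite cj pmulr_rge0.
have j1 : j%:~R <= 1 :> R by move: ct; rewrite cj -[leRHS]mulr1 ler_pM2l.
have {j0 j1} : j = 0 \/ j = 1.
  move: j0 j1; rewrite -[0]/(0%:~R) -[1]/(1%:~R) !ler_int.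
  by case: j {cj} => [[|[|n]]|n] //; [left|right].
case=> jE; rewrite jE ?mulr0 ?mulr1 in cj.
  by move: Fc; rewrite cj => Fc; lra.
have := Hk 0; rewrite add0r => E; rewrite cj E in Fc.
have /(mulfI (lt0r_neq0 t0)) kE : tau * k%:~R = tau * 1 by lra.
by move: k2R; rewrite kE ltxx.
Qed.

(** The differentiable lift and the increasing one differ by a constant, so the former is increasing
    too. Composed with a differentiable lift of the inverse it gives a translation, and the chain
    rule then excludes a zero of the derivative. *)
Lemma diff_c1_lift (alpha : R) (f : circle R -> circle R) : Diff_plus alpha f ->
  exists F : R -> R, [/\ c1_lift F, forall t, f (circle_exp t) = circle_exp (F t) &
    exists C : R, forall s t, `|derive1 F s - derive1 F t| <= C * `|s - t| `^ alpha].
Proof.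
move=> [g [fK gK [F [fF dF cF' hF]] [H [gH dH cH' hH]] [F1 [fF1 incF1]]]].
have [k Hk] := lifts_differ fF fF1.
have incF : {homo F : x y / x < y} by move=> x y xy; rewrite !Hk ltrD2r; exact: incF1.
exists F; split => //; last by case: fF.
have idL : @is_lift R id id by split; [move=> ?; exact: cvg_id|].
have gfL : is_lift id (H \o F).
  have [cF fFE] := fF; have [cH gHE] := gH.
  split; first by move=> t; apply: continuous_comp; [exact: cF|exact: cH].
  by move=> t /=; rewrite -gHE -fFE fK.
have [j Hj] := lifts_differ gfL idL.
have D x : derive1 H (F x) * derive1 F x = 1.
  rewrite -(derive1_comp (dF x) (dH (F x))).
  have -> : H \o F = (fun t => t + tau * j%:~R) by apply/funext => t; rewrite Hj.
  have dd := is_derive_addr_cst (tau * j%:~R) x.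
  by rewrite derive1E derive_val.
split=> //.
- move=> x; rewrite lt_neqAle; apply/andP; split.
    by apply/eqP => E; move: (D x); rewrite -E mulr0 => /eqP; rewrite eq_sym oner_eq0.
  apply: (@incr_derive1_ge0 _ _ setT) => //; first by move=> ? ? _ _; exact: incF.
  by rewrite interiorT.
- exact: increasing_lift_translates (can_inj fK) fF incF.
Qed.

End CircleExp.

(** * Abelian quotients *)

(** The set of values of h is made into an abelian group through representatives, the first
    hypothesis being the well-definedness of the product. This allows values in a type without group
    structure, such as maps of the circle. *)
Lemma abelian_image (G : groupType) (T : Type) (h : G -> T) :
  (forall x y x' y', h x = h x' -> h y = h y' -> h (x * y)%g = h (x' * y')%g) ->
  (forall x y, h (x * y)%g = h (y * x)%g) ->
  exists (A : zmodType) (b : G -> A),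
    (forall x y, b (x * y)%g = b x + b y) /\ (forall x y, b x = b y -> h x = h y).
Proof.
move=> cong comm; pose B := {t | exists g, h g = t}.
pose rep (z : B) : G := proj1_sig (cid (proj2_sig z)).
have repE z : h (rep z) = sval z := proj2_sig (cid (proj2_sig z)).
pose b g : B := exist _ (h g) (ex_intro _ g erefl).
have bE x y : h x = h y -> b x = b y by move=> xy; exact: eq_exist.
have brep z : b (rep z) = z by case: z => t tE; apply: eq_exist; rewrite repE.
pose add (y z : B) := b (rep y * rep z)%g.
have addb x y : add (b x) (b y) = b (x * y)%g by apply: bE; apply: cong; rewrite repE.
have addA : associative add.
  by move=> x y z; rewrite -(brep x) -(brep y) -(brep z) !addb mulgA.
have addC : commutative add by move=> x y; apply: bE; exact: comm.
have add0 : left_id (b 1%g) add by move=> x; rewrite -(brep x) addb mul1g.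
have addN : left_inverse (b 1%g) (fun z => b (rep z)^-1%g) add.
  by move=> x; rewrite -{2}(brep x) addb mulVg.
pose B1 : choiceType := HB.pack B (gen_eqMixin B) (gen_choiceMixin B).
pose A : zmodType := HB.pack B1 (GRing.isZmodule.Build B1 addA addC add0 addN).
exists A, b; split=> [x y|x y /(congr1 sval)//].
by rewrite -addb.
Qed.

Section AbelianQuotients.
Variables (R : realType) (p : R) (theta : R).
Variables (G : groupType) (V : finType) (phi : V -> G) (e : rel V) (i : V -> V) (k : nat).
Hypothesis phi_inj : injective phi.
Hypothesis phi_inv : forall v, phi (i v) = ((phi v)^-1)%g.
Hypothesis link : forall u v, e u v <-> exists x, phi x = ((phi u)^-1 * phi v)%g.
Hypothesis degree : forall v, #|[pred u | e u v]| = k.+1.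
Hypothesis theta01 : 0 <= theta < 1.
Hypothesis poincare : forall (f : V -> R) (m : R), \sum_x f x = #|V|%:R * m ->
    k.+1%:R * \sum_x `|f x - m| `^ p <=
      theta * \sum_x \sum_y (e x y)%:R * `|f x - f y| `^ p.

(** One triangle z = w v read in two ways. For a cocycle x the two relations give x z = x v - x
    (w^-1) and x v = x z - x w, hence x (w^-1) = - x w. *)
Lemma link_triangle w : exists v z,
  phi z = ((phi (i w))^-1 * phi v)%g /\ phi v = ((phi w)^-1 * phi z)%g.
Proof.
have : (0 < #|[pred u | e u (i w)]|)%N by rewrite degree.
move=> /card_gt0P[u]; rewrite inE => /link[x Hx]; rewrite phi_inv in Hx.
by exists u, (i x); rewrite !phi_inv !invgK Hx invgM !invgK mulKg.
Qed.

(** By antisymmetry x has mean zero. The difference of x along an edge is, up to sign, its value at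
    a generator, so the edge sum is k + 1 times the sum S of the |x v|^p; the Poincaré inequality
    becomes S <= theta S. *)
Lemma link_cocycle0 (x : V -> R) :
  (forall u v w, phi w = ((phi u)^-1 * phi v)%g -> x w = x v - x u) -> forall v, x v = 0.
Proof.
move=> xc.
have xi w : x (i w) = - x w.
  have [v [z [Hz Hv]]] := link_triangle w.
  by have h1 := xc _ _ _ Hz; have h2 := xc _ _ _ Hv; move: (x z) (x v) (x w) (x (i w)) h1 h2 => a b c d; lra.
have s0 : \sum_v x v = 0.
  have : \sum_v x v = - \sum_v x v.
    rewrite {1}(reindex_inj (inv_inj (link_invK phi_inj phi_inv))) /= -sumrN.
    by apply: eq_bigr => v _; rewrite xi.
  by move: (\sum_v x v) => s sE; lra.
have P := @poincare x 0; rewrite mulr0 s0 in P; have {}P := P erefl.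
pose S := \sum_v `|x v| `^ p.
have E : \sum_u \sum_v (e u v)%:R * `|x u - x v| `^ p = S *+ k.+1.
  rewrite -(link_sum phi_inj phi_inv link degree (A := fun u v => `|x u - x v| `^ p)).
    apply: eq_bigr => u _; rewrite [RHS]big_mkcond; apply: eq_bigr => v _.
    by case: (e u v); rewrite ?mul1r ?mul0r.
  by move=> u v w /xc ->; rewrite distrC.
have e0 : \sum_v `|x v - 0| `^ p = S by apply: eq_bigr => v _; rewrite subr0.
rewrite E e0 -(mulr_natl S) in P.
have S0 : 0 <= S by apply: sumr_ge0 => v _; exact: powR_ge0.
have k0 : (0 : R) < k.+1%:R by rewrite ltr0n.
have {P} SE : S = 0.
  have [_ t1] := andP theta01; move: P; rewrite mulrCA ler_pM2l// => P; nra.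
move=> v; have : `|x v| `^ p = 0.
  by apply: (psumr_eq0P _ SE) => // u _; exact: powR_ge0.
by move=> /powR_eq0_eq0 /eqP; rewrite normr_eq0 => /eqP.
Qed.

Lemma common_denominator (T : finType) (b : T -> rat) :
  exists (d : nat) (c : T -> int), (0 < d)%N /\ forall t, (c t)%:~R = d%:R * b t.
Proof.
exists (\prod_t `|denq (b t)|)%N, (fun t => (\prod_(s | s != t) `|denq (b s)|)%N%:Z * numq (b t)).
split; first by apply/prodn_gt0 => t; rewrite absz_gt0 denq_neq0.
move=> t.
have -> : (\prod_s `|denq (b s)| = `|denq (b t)| * \prod_(s | s != t) `|denq (b s)|)%N.
  by rewrite (bigD1 t).
rewrite natrM intrM.
have -> : (`|denq (b t)|%N)%:R = (denq (b t))%:~R :> rat.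
  by rewrite -[RHS](congr1 intr (gez0_abs (ltW (denq_gt0 (b t))))).
by rewrite numqE -pmulrn mulrC [b t * _]mulrC mulrAC.
Qed.

(* The relations have no real solution but 0, so their integer matrix has a
   right inverse over the rationals. *)
Lemma link_exponent : exists2 d : nat, (0 < d)%N &
  forall (A : zmodType) (b : V -> A),
    (forall u v w, phi w = ((phi u)^-1 * phi v)%g -> b w = b v - b u) ->
  forall v, b v *+ d = 0.
Proof.
pose T : finType := (V * V * V)%type.
pose rel3 (t : T) := `[< phi t.2 = ((phi t.1.1)^-1 * phi t.1.2)%g >].
pose coef (t : T) (v : V) : int :=
  if rel3 t then (v == t.2)%:R - (v == t.1.2)%:R + (v == t.1.1)%:R else 0.
have sum_delta (A : zmodType) (b : V -> A) u : \sum_v b v *~ ((v == u)%:R : int) = b u.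
  rewrite (bigD1 u)//= eqxx mulr1z big1 ?addr0// => v /negbTE ->.
  by rewrite mulr0z.
have sum_coef (A : zmodType) (b : V -> A) (t : T) : rel3 t ->
    \sum_v b v *~ coef t v = b t.2 - b t.1.2 + b t.1.1.
  move=> tr; rewrite /coef tr.
  under eq_bigr do rewrite mulrzDr mulrzBr.
  by rewrite big_split /= sumrB !sum_delta.
pose M : 'M[rat]_(#|V|, #|T|) :=
  \matrix_(a, c) (coef (enum_val c) (enum_val a))%:~R.
have ME a t : M a (enum_rank t) = (coef t (enum_val a))%:~R by rewrite mxE enum_rankK.
have : row_free M.
  rewrite -kermx_eq0; apply/eqP/row_matrixP => r; rewrite row0.
  set y := row r _.
  have yM : y *m M = 0 by apply/sub_kermxP; exact: row_sub.
  (* A rational row vector annihilated by M, read in R, satisfies all the relations, so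
     [link_cocycle0] applies to it. *)
  pose x v : R := ratr (y 0 (enum_rank v)).
  have x0 := @link_cocycle0 x.
  apply/rowP => a; rewrite [RHS]mxE.
  have : x (enum_val a) = 0.
    apply: x0 => u v w uvw; pose t : T := (u, v, w).
    have tr : rel3 t by apply/asboolP.
    have /rowP/(_ (enum_rank t)) := yM; rewrite [LHS]mxE [RHS]mxE.
    under eq_bigr => c _ do rewrite ME mulrzr.
    rewrite (reindex_onto enum_rank enum_val) /=; last by move=> c _; rewrite enum_valK.
    under eq_bigl do rewrite enum_rankK eqxx.
    under eq_bigr do rewrite enum_rankK.
    rewrite (sum_coef _ (fun v => y 0 (enum_rank v)) t tr) /= => E.
    have := congr1 (@ratr R) E; rewrite raddfD raddfB /= rmorph0 -!/(x _).
    by rewrite /x; lra.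
  by rewrite /x enum_valK => /eqP; rewrite fmorph_eq0 => /eqP.
move=> /row_freeP[B MB].
(* Clearing denominators in the right inverse B writes d times each generator as an integer
   combination of the relations, which vanish in A. *)
have [d [c [d0 Hc]]] := common_denominator (fun z : V * T => B (enum_rank z.2) (enum_rank z.1)).
exists d => // A b bc v.
have dE u : d%:R * (u == v)%:R = \sum_t coef t u * c (v, t) :> int.
  apply: (@intr_inj rat); rewrite rmorph_sum /= rmorphM /= !rmorph_nat.
  have := congr1 (fun X : 'M[rat]_#|V| => X (enum_rank u) (enum_rank v)) MB.
  rewrite [LHS]mxE [RHS]mxE (inj_eq enum_rank_inj) => <-.
  rewrite mulr_sumr (reindex_onto enum_rank enum_val) /=; last by move=> z _; rewrite enum_valK.
  under eq_bigl do rewrite enum_rankK eqxx.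
  apply: eq_bigr => t _; rewrite ME !enum_rankK rmorphM /= Hc /=.
  by rewrite mulrCA.
have : \sum_u b u *~ (d%:R * (u == v)%:R) = 0.
  under eq_bigr => u _ do rewrite dE mulrz_sumr.
  rewrite exchange_big big1 // => t _ /=.
  under eq_bigr do rewrite mulrzA.
  rewrite -mulrz_suml; case: (boolP (rel3 t)) => tr.
    rewrite sum_coef//; have := bc t.1.1 t.1.2 t.2 => ->; last exact/asboolP.
    by rewrite addrAC subrK subrr mul0rz.
  rewrite big1 ?mul0rz// => u _; rewrite /coef (negbTE tr); exact: mulr0z.
under eq_bigr do rewrite mulrC mulrzA.
by rewrite -mulrz_suml sum_delta natz -pmulrn.
Qed.

Hypothesis generated : forall H : set G, subgroup_set H -> (forall v, H (phi v)) ->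
  forall g, H g.

Lemma abelian_image_exponent : exists2 d : nat, (0 < d)%N &
  forall (T : Type) (h : G -> T),
    (forall x y x' y', h x = h x' -> h y = h y' -> h (x * y)%g = h (x' * y')%g) ->
    (forall x y, h (x * y)%g = h (y * x)%g) ->
  forall g, h (g ^+ d)%g = h 1%g.
Proof.
have [d d0 Hd] := link_exponent; exists d => // T h cong comm.
have [A [b [bM bh]]] := abelian_image cong comm.
have b1 : b 1%g = 0 by apply: (addIr (b 1%g)); rewrite -bM mulg1 add0r.
have bV x : b (x^-1)%g = - b x by apply: (addIr (b x)); rewrite -bM mulVg addNr.
have bX n x : b (x ^+ n)%g = b x *+ n.
  by elim: n => [|n ih]; rewrite ?expg0 ?mulr0n// expgS bM ih mulrS.
have bphi v : b (phi v) *+ d = 0.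
  apply: (Hd A (fun v => b (phi v))) => x y w /= ->.
  by rewrite bM bV addrC.
have bd : forall g, b g *+ d = 0.
  apply: (generated (H := [set g | b g *+ d = 0])) => //; split => /=.
  - by rewrite b1 mul0rn.
  - by move=> x y hx hy; rewrite bM mulrnDl hx hy addr0.
  - by move=> x hx; rewrite bV mulNrn hx oppr0.
by move=> g; apply: bh; rewrite bX bd b1.
Qed.

End AbelianQuotients.

(** * Hölder's theorem on free actions *)

Lemma orbit_limit (R : realType) (f : R -> R) (y B : R) : continuous f ->
  {homo f : s t / s < t} -> y < f y -> (forall j, iter j f y <= B) ->
  exists e, [/\ f e = e, e <= B, forall j, iter j f y < e
    & forall s, s < e -> exists j, s < iter j f y].
Proof.
move=> cf incf yf orbB.
have inc j : iter j f y < iter j.+1 f y by elim: j => // j /incf.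
pose S := range (fun j => iter j f y).
have S0 : S !=set0 by exists y, 0%N.
have ubS : ubound S B by move=> _ [j _ <-].
have supS : has_sup S by split=> //; exists B.
have orb_le j : iter j f y <= sup S by apply: ub_le_sup; [exists B|exists j].
have orb_lt j : iter j f y < sup S := lt_le_trans (inc j) (orb_le j.+1).
have approx s : s < sup S -> exists j, s < iter j f y.
  by move=> /sup_gt -/(_ S0)[_ [j _ <-]]; exists j.
exists (sup S); split => //; last exact: ge_sup.
apply/eqP; rewrite eq_le; apply/andP; split; last first.
  by apply: ge_sup => // _ [j _ <-]; apply: ltW; apply: lt_trans (inc j) _;
    exact: (incf _ _ (orb_lt j)).
rewrite leNgt; apply/negP => sf.
have /nbhs_ballP[/= r r0 Hr] : \forall s \near sup S, sup S < f s by exact: cvgr_gt (cf _) _ sf.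
have [j Hj] : exists j, sup S - r / 2 < iter j f y by apply: approx; lra.
have : sup S < f (iter j f y).
  apply: Hr; rewrite /ball /=; have := orb_lt j => h.
  by rewrite gtr0_norm; [lra|rewrite subr_gt0].
by apply/negP; rewrite -leNgt; exact: (orb_le j.+1).
Qed.

Section HolderGroups.
Variables (R : realType) (T : R) (A : set (R -> R)).
Hypothesis T0 : 0 < T.
Hypothesis A_shift : A (fun x => x + T).
Hypothesis A_comp : forall f g, A f -> A g -> A (f \o g).
Hypothesis A_inv : forall f, A f -> exists g, [/\ A g, cancel f g & cancel g f].
Hypothesis A_cont : forall f, A f -> continuous f.
Hypothesis A_incr : forall f, A f -> {homo f : x y / x < y}.
Hypothesis A_translates : forall f, A f -> forall x, f (x + T) = f x + T.
Hypothesis A_free : forall f x, A f -> f x = x -> forall y, f y = y.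

Let ltA f x y : A f -> (f x < f y) = (x < y).
Proof. by move=> Af; apply: (leW_mono (le_mono (A_incr Af))). Qed.

Let leA f x y : A f -> (f x <= f y) = (x <= y).
Proof. by move=> Af; apply: (le_mono (A_incr Af)). Qed.

Let A_id : A id.
Proof.
have [g [Ag _ gK]] := A_inv A_shift.
by have := A_comp A_shift Ag; congr A; apply/funext => x; exact: gK.
Qed.

Let A_iter n f : A f -> A (iter n f).
Proof.
move=> Af; elim: n => [|n ih]; first exact: A_id.
by have := A_comp Af ih.
Qed.

(** A change of sign of f z - z would produce a fixed point. Comparing two elements at one point
    therefore compares them everywhere, which gives a total order invariant on both sides. *)
Lemma free_sign f x : A f -> x < f x -> forall y, y < f y.
Proof.
move=> Af xf y; rewrite ltNge; apply/negP => fy.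
have cg : continuous (fun z => f z - z).
  by move=> z; apply: cvgB; [exact: A_cont|exact: cvg_id].
have [z zI] : exists z, f z - z = 0.
  have [xy|yx] := leP x y.
    have [|z _ zE] := @IVT _ (fun z => f z - z) x y 0 xy (continuous_subspaceT cg).
      by rewrite ge_min le_max !subr_ge0 !subr_le0 fy (ltW xf) orbT.
    by exists z.
  have [|z _ zE] := @IVT _ (fun z => f z - z) y x 0 (ltW yx) (continuous_subspaceT cg).
    by rewrite ge_min le_max !subr_ge0 !subr_le0 fy (ltW xf) orbT.
  by exists z.
have /(A_free Af)/(_ x) fx : f z = z by apply/eqP; rewrite -subr_eq0 zI.
by rewrite fx ltxx in xf.
Qed.

Lemma free_lt f g x : A f -> A g -> f x < g x -> forall y, f y < g y.
Proof.
move=> Af Ag fg y; have [f' [Af' fK f'K]] := A_inv Af.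
have := @free_sign (f' \o g) x (A_comp Af' Ag).
rewrite /= -(ltA _ _ Af) f'K => /(_ fg y).
by rewrite -(ltA _ _ Af) f'K.
Qed.

Lemma free_eq f g x : A f -> A g -> f x = g x -> f = g.
Proof.
move=> Af Ag fg; have [f' [Af' fK f'K]] := A_inv Af.
apply/funext => y.
have := @A_free (f' \o g) x (A_comp Af' Ag); rewrite /= -fg fK => /(_ erefl y) yE.
by rewrite -[in LHS]yE f'K.
Qed.

Lemma free_le f g x : A f -> A g -> f x <= g x -> forall y, f y <= g y.
Proof.
move=> Af Ag; rewrite le_eqVlt => /predU1P[/free_eq->//|fg y].
exact/ltW/(free_lt Af Ag fg).
Qed.

Definition moves_up f := A f /\ 0 < f 0.

(** A bounded orbit would increase to a fixed point. *)
Lemma moves_up_unbounded f B : moves_up f -> exists n, B < iter n f 0.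
Proof.
move=> [Af f0]; apply: contrapT => /forallNP nB.
have [|e [fe _ _ _]] := orbit_limit (A_cont Af) (A_incr Af) f0 (B := B).
  by move=> j; have /negP := nB j; rewrite -leNgt.
by have := free_sign Af f0 e; rewrite fe ltxx.
Qed.

Lemma archimedean_bracket f B : moves_up f -> 0 <= B ->
  exists n, iter n f 0 <= B < iter n.+1 f 0.
Proof.
move=> pf B0.
have ex : exists n, B < iter n f 0 by exact: moves_up_unbounded.
have [n nB min] := ex_minnP ex.
case: n nB min => [|n] nB min; first by rewrite ltNge B0 in nB.
exists n; rewrite nB andbT leNgt; apply/negP => /min.
by rewrite ltnn.
Qed.

(** Dividing f by the largest power of d that does not exceed it at 0 leaves an element moving 0 by
    less than d does, hence fixing 0. So f is a power of d, with exponent below N because f 0 <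
    T. *)
Lemma least_positive_finite d : moves_up d ->
  (forall c, moves_up c -> d 0 <= c 0) -> finite_set [set f | A f /\ 0 <= f 0 < T].
Proof.
move=> pd least; have [Ad d0] := pd.
have [N NT] := moves_up_unbounded T pd.
apply: (@sub_finite_set _ _ ((fun n => iter n d) @` `I_N)); last first.
  exact/finite_image/finite_II.
move=> f [Af /andP[f0 fT]].
have [n /andP[n1 n2]] := archimedean_bracket pd f0.
have An := A_iter n Ad.
have [g [Ag gK Kg]] := A_inv An.
have gf0 : 0 <= g (f 0) by rewrite -(leA _ _ An) Kg.
have gfd : g (f 0) < d 0 by rewrite -(ltA _ _ An) Kg -iterSr.
have gE : g (f 0) = 0.
  apply/eqP; rewrite eq_le gf0 andbT leNgt; apply/negP => gfp.
  have := least (g \o f) (conj (A_comp Ag Af) gfp).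
  by rewrite /= leNgt gfd.
have fE : iter n d 0 = f 0 by rewrite -[RHS]Kg gE.
exists n; last exact: free_eq An Af fE.
rewrite /= ltnNge; apply/negP => Nn.
suff : iter N d 0 <= iter n d 0 by move=> h; lra.
elim: n Nn {n1 n2 An g Ag gK Kg gf0 gfd gE fE} => [|n ih].
  by rewrite leqn0 => /eqP ->.
rewrite leq_eqVlt => /predU1P[->//|/ih h]; apply: le_trans h _.
exact/ltW/(free_sign Ad d0).
Qed.

Section NoLeast.
Hypothesis no_least : forall d, moves_up d -> exists2 c, moves_up c & c 0 < d 0.

(** Choose u strictly between the identity and c, and write c = u v; the smaller of u and v has its
    square below c. *)
Lemma moves_up_halving c : moves_up c -> exists2 d, moves_up d & forall x, d (d x) <= c x.
Proof.
move=> pc; have [Ac c0] := pc.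
have [u [Au u0] uc] := no_least pc.
have [u' [Au' uK Ku]] := A_inv Au.
pose v := u' \o c; have Av : A v := A_comp Au' Ac.
have cE x : c x = u (v x) by rewrite /v /= Ku.
have v0 : 0 < v 0.
  by rewrite -(ltA _ _ Au) -cE.
have [uv|/ltW vu] := leP (u 0) (v 0).
  by exists u => // x; rewrite cE leA//; exact: (free_le Au Av uv).
by exists v => // x; rewrite cE; exact: (free_le Av Au vu).
Qed.

Lemma moves_up_root n c : moves_up c -> exists2 d, moves_up d & forall x, iter n d x <= c x.
Proof.
elim: n c => [|n ih] c pc.
  by exists c => // x; apply: ltW; case: pc => Ac c0; exact: (free_sign Ac c0).
have [u pu uc] := moves_up_halving pc; have [v pv vu] := ih u pu.
have [[Au u0] [Av v0]] := (pu, pv).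
have [uv|/ltW vu0] := leP (u 0) (v 0).
  exists u => // x; apply: le_trans (uc x); rewrite /= leA//.
  apply: le_trans (vu x).
  elim: n {ih vu} x => //= n ih x; apply: le_trans (free_le Au Av uv _) _.
  by rewrite leA.
exists v => // x; apply: le_trans (uc x).
by apply: le_trans (free_le Av Au vu0 _) _; rewrite leA//; exact: vu.
Qed.

Lemma no_least_roots n : (0 < n)%N -> exists d, A d /\ 0 < iter n d 0 < T.
Proof.
move=> n0; have [|c pc cT] := no_least (d := fun x => x + T).
  by split; rewrite ?add0r.
have [d [Ad d0] dc] := moves_up_root n pc.
exists d; split => //; apply/andP; split; last first.
  by apply: le_lt_trans (dc 0) _; rewrite add0r in cT.
case: n n0 {dc} => // n _; elim: n => // n ih.
exact: lt_trans ih (free_sign Ad d0 _).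
Qed.

(** The translation by T commutes with every element, so commutation may be tested after moving both
    elements to the right. *)
Lemma shift_nonneg f : A f -> exists g n, [/\ A g, 0 <= g 0 & forall x, g x = f x + T *+ n].
Proof.
move=> Af; pose s := fun x => x + T.
have sE n x : iter n s x = x + T *+ n.
  by elim: n => [|n ih]; rewrite ?mulr0n ?addr0//= ih /s mulrSr addrA.
have [n nf] : exists n, - f 0 < iter n s 0.
  by apply: moves_up_unbounded; split; rewrite /s ?add0r.
rewrite sE add0r in nf.
exists (iter n s \o f), n; split => [||x]; last by rewrite /= sE.
  exact: A_comp (A_iter n A_shift) Af.
by rewrite /= sE; lra.
Qed.

(** Otherwise the commutator c of f and g moves points up, and some d moving up has d^2 <= c.
    Bracketing f and g at 0 between the powers d^m, d^(m+1) and d^n, d^(n+1) gives f g < d^(m+n+2)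
    <= d^2 g f <= c g f = f g at 0. *)
Lemma holder_le f g : A f -> A g -> 0 <= f 0 -> 0 <= g 0 -> f (g 0) <= g (f 0).
Proof.
move=> Af Ag f0 g0; rewrite leNgt; apply/negP => gf_fg.
have [w [Aw wK _]] := A_inv (A_comp Ag Af).
pose c := (f \o g) \o w.
have Ac : A c := A_comp (A_comp Af Ag) Aw.
have wE : w (g (f 0)) = 0 := wK 0.
have cE : c (g (f 0)) = f (g 0) by rewrite /c /= wE.
have pc : moves_up c.
  split => //; apply: (free_lt A_id Ac (x := g (f 0))).
  by rewrite cE.
have [d pd dc] := moves_up_halving pc; have [Ad d0] := pd.
have [m /andP[m1 m2]] := archimedean_bracket pd f0.
have [n /andP[n1 n2]] := archimedean_bracket pd g0.
have Am := A_iter m Ad; have An := A_iter n Ad.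
have s1 : f (g 0) < iter m.+1 d (g 0) by exact: (free_lt Af (A_iter m.+1 Ad) m2).
have s2 : iter m.+1 d (g 0) < iter m.+1 d (iter n.+1 d 0) by rewrite ltA//; exact: A_iter.
have s3 : iter m.+1 d (iter n.+1 d 0) = d (d (iter n d (iter m d 0))).
  by rewrite -iterD -!iterS -iterD; congr (iter _ d 0); rewrite addSn addnS addnC.
have s4 : d (d (iter n d (iter m d 0))) <= d (d (g (f 0))).
  rewrite !leA//; apply: le_trans (free_le An Ag n1 _) _.
  by rewrite leA.
have := dc (g (f 0)); rewrite cE => s5.
by rewrite s3 in s2; have := lt_trans s1 (lt_le_trans s2 (le_trans s4 s5)); rewrite ltxx.
Qed.

Lemma no_least_comm f g : A f -> A g -> f \o g = g \o f.
Proof.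
move=> Af Ag.
have [f1 [m [Af1 f10 f1E]]] := shift_nonneg Af; have [g1 [n [Ag1 g10 g1E]]] := shift_nonneg Ag.
have tr h k x : A h -> h (x + T *+ k) = h x + T *+ k.
  move=> Ah; elim: k => [|k ih]; first by rewrite !mulr0n !addr0.
  by rewrite !mulrSr !addrA A_translates// ih.
apply: (free_eq (A_comp Af Ag) (A_comp Ag Af) (x := 0)) => /=.
have : f1 (g1 0) = g1 (f1 0).
  by apply/eqP; rewrite eq_le (holder_le Af1 Ag1 f10 g10) (holder_le Ag1 Af1 g10 f10).
rewrite !f1E !g1E !tr//; move: (f (g 0)) (g (f 0)) (T *+ m) (T *+ n) => a1 a2 a3 a4; lra.
Qed.

End NoLeast.

Theorem holder_finite :
  ((forall f g, A f -> A g -> f \o g = g \o f) ->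
    exists2 d, (0 < d)%N & forall f, A f -> exists k : int, iter d f 0 = T * k%:~R) ->
  finite_set [set f | A f /\ 0 <= f 0 < T].
Proof.
move=> ex.
have [[d [pd least]]|none] := pselect (exists d, moves_up d /\ forall c, moves_up c -> d 0 <= c 0).
  exact: least_positive_finite least.
have no_least d : moves_up d -> exists2 c, moves_up c & c 0 < d 0.
  move=> pd; apply: contrapT => nc; apply: none; exists d; split => // c pc.
  by rewrite leNgt; apply/negP => cd; apply: nc; exists c.
have [d d0 Hd] := ex (no_least_comm no_least).
have [f [Af /andP[f0 fT]]] := no_least_roots no_least d0.
have [k kE] := Hd f Af; rewrite kE in f0 fT.
have k0 : 0 < k by move: f0; rewrite pmulr_rgt0// ltr0z.
have k1 : k < 1 by rewrite -(ltr_int R) -(ltr_pM2l T0) mulr1.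
by move: k k0 k1 {kE f0 fT}; case=> [[|[|?]]|].
Qed.

End HolderGroups.

(** * Freeness of the lifted action *)

Section NoAdvance.
Variable R : realType.
Notation mu := (@lebesgue_measure R).
Notation plane := (measurableTypeR R * measurableTypeR R)%type.
Notation mu2 := (mu \x mu)%E.
Notation tau := (2 * @pi R).
Variables (Phi H : R -> R).
Hypothesis HPhi : c1_lift Phi.
Hypotheses (PhiK : cancel Phi H) (HK : cancel H Phi).
Variables (b p : R).
Hypotheses (b0 : 0 < b) (pE : p = b^-1) (p2 : 2 < p).
Variable X : nat -> plane -> R.
Hypothesis goodX : forall n, periodic_mfun (X n).
Variables (theta C C' : R).
Hypothesis theta01 : 0 <= theta < 1.
Hypothesis C0 : 0 <= C.
Hypothesis almost_fixed : forall n,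
  (pow_energy mu2 (strip 0) p (fun z => pull b Phi (X n) z - X n z)%R <= (C * theta ^+ n)%:E)%E.
Hypothesis near_kern : forall n,
  (pow_energy mu2 (strip 0) p (fun z => X n z - kern b z)%R <= C'%:E)%E.

(** A multiple of 2 pi brings y between the fixed points x0 and x0 + 2 pi; the second bounds the
    orbit of y, which thus increases to a fixed point e. *)
Lemma no_advance x0 y : Phi x0 = x0 -> Phi y <= y.
Proof.
move=> fix0; rewrite leNgt; apply/negP => yadv.
have [k /andP[k1 k2]] := reduce_mod_tau x0 y.
set y' := y + _ in k1 k2.
have yadv' : y' < Phi y' by rewrite (translates_int (lift_translates HPhi)) ltrD2r.
have orbB j : iter j Phi y' <= x0 + tau.
  elim: j => [|j ih] /=; first exact: ltW.
  have -> : x0 + tau = Phi (x0 + tau) by rewrite (lift_translates HPhi) fix0.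
  by rewrite (le_mono (lift_incr HPhi)).
have [e [fixe ex0 orb_lt orb_cvg]] :=
  orbit_limit (lift_continuous HPhi) (lift_incr HPhi) yadv' orbB.
exact: (advance_between_fixed_absurd HPhi PhiK HK b0 pE p2 goodX theta01 C0 almost_fixed near_kern
  fix0 fixe k1 ex0 yadv' orb_lt orb_cvg).
Qed.

End NoAdvance.

Section LiftRigidity.
Variable R : realType.
Notation mu := (@lebesgue_measure R).
Notation plane := (measurableTypeR R * measurableTypeR R)%type.
Notation mu2 := (mu \x mu)%E.
Notation tau := (2 * @pi R).
Variables (G : groupType) (F : G -> R -> R).
Hypothesis HF : forall g, c1_lift (F g).
Hypothesis FM : forall g h, exists k : int, forall x,
  F (g * h)%g x = F g (F h x) + tau * k%:~R.
Variables (a b p : R).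
Hypotheses (b0 : 0 < b) (ba : b < a) (pE : p = b^-1) (p2 : 2 < p).
Hypothesis hol : forall g, exists C : R, forall s t,
  `|derive1 (F g) s - derive1 (F g) t| <= C * `|s - t| `^ a.
Variables (V : finType) (phi : V -> G) (e : rel V) (i : V -> V) (k : nat).
Hypothesis phi_inj : injective phi.
Hypothesis phi_inv : forall v, phi (i v) = ((phi v)^-1)%g.
Hypothesis link : forall u v, e u v <-> exists x, phi x = ((phi u)^-1 * phi v)%g.
Hypothesis degree : forall v, #|[pred u | e u v]| = k.+1.
Hypothesis V0 : (0 < #|V|)%N.
Hypothesis generated : forall H : set G, subgroup_set H -> (forall v, H (phi v)) ->
  forall g, H g.
Variable theta : R.
Hypothesis theta01 : 0 <= theta < 1.
Hypothesis poincare : forall (f : V -> R) (m : R), \sum_x f x = #|V|%:R * m ->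
    k.+1%:R * \sum_x `|f x - m| `^ p <=
      theta * \sum_x \sum_y (e x y)%:R * `|f x - f y| `^ p.

Let b1 : b <= 1.
Proof.
have := p2; rewrite pE -(ltr_pM2r b0) mulVf ?gt_eqF//; move: b b0 => B B0 h; lra.
Qed.

Let X : nat -> plane -> R := half_step_iter (lift_map F) (lift_weight F b) phi (kern b).

Let mstrip : measurable (strip 0 : set plane) := measurable_strip 0.

Let good_measurable (f : plane -> R) : periodic_mfun f -> measurable_fun setT f.
Proof. by case. Qed.

Let goodX n : periodic_mfun (X n).
Proof.
exact: (@good_iter _ _ R G (lift_map F) (lift_weight F b) (@periodic_mfun R) (@periodic_mfun_linear R)
  (@periodic_mfun_wcomp R G F HF b) V phi (kern b) (periodic_mfun_kern b)).
Qed.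

Let displacement_kern :
  (displacement mu2 (strip 0) p (lift_map F) (lift_weight F b) phi (kern b) < +oo)%E.
Proof.
by apply: lte_sum_pinfty => v _; exact: (kern_energy_lty HF b0 pE ba b1 hol).
Qed.

Let invariantX g := almost_invariant (good := @periodic_mfun R) mstrip p2
  good_measurable (@periodic_mfun_linear R)
  (@periodic_mfun_wcomp R G F HF b) (@lift_wcomp1 R G F HF FM b)
  (@lift_wcompM R G F HF FM b) (@lift_energy_wcomp R G F HF FM b p b0 pE)
  phi_inj phi_inv link degree V0 theta01 poincare generated
  (periodic_mfun_kern b) displacement_kern g.

Let boundedX := iter_bounded (good := @periodic_mfun R) mstrip p2
  good_measurable (@periodic_mfun_linear R)
  (@periodic_mfun_wcomp R G F HF b) (@lift_wcomp1 R G F HF FM b)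
  (@lift_wcompM R G F HF FM b) (@lift_energy_wcomp R G F HF FM b p b0 pE)
  phi_inj phi_inv link degree V0 theta01 poincare
  (periodic_mfun_kern b) displacement_kern.

Lemma c1_lift_addr (f : R -> R) (c : R) : c1_lift f -> c1_lift (fun x => f x + c).
Proof.
move=> Hf; have D : derive1 (fun x => f x + c) = derive1 f.
  by apply/funext => x; apply: derive1_addr; exact: lift_derivable.
split; rewrite ?D.
- by move=> x y xy; rewrite ltrD2r; exact: lift_incr.
- by move=> x; apply: derivableD => //; exact: lift_derivable.
- exact: lift_derive_cont.
- exact: lift_derive_gt0.
- by move=> x; rewrite (lift_translates Hf) addrAC.
Qed.

Lemma lift_le_of_fixed g (j : int) x0 : F g x0 + tau * j%:~R = x0 ->
  forall y, F g y + tau * j%:~R <= y.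
Proof.
move=> fix0 y; pose Phi x := F g x + tau * j%:~R.
have HPhi : c1_lift Phi by exact: c1_lift_addr.
have [H [FK KF]] := lift_bij HF FM g.
(* An element acts through the lift of its inverse, so [pull b Phi] is the action of g^-1. *)
have [C C0 HC] := invariantX (g^-1)%g.
have [C' HC'] := boundedX.
apply: (@no_advance R Phi (fun x => H (x - tau * j%:~R)) HPhi _ _ b p b0 pE p2 X goodX
  theta C C' theta01 C0 _ HC' x0 y fix0).
- by move=> x; rewrite /Phi addrK FK.
- by move=> x; rewrite /Phi KF subrK.
move=> n.
have -> : pull b Phi (X n) = wcomp (lift_map F) (lift_weight F b) (g^-1)%g (X n); last exact: HC.
have [_ pX] := goodX n; move: (X n) pX => f pf.
apply/funext => z; rewrite /wcomp /lift_map /lift_weight invgK /pull /Phi.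
rewrite (diag_periodic_int pf) !derive1_addr//; exact: lift_derivable.
Qed.

(** The fixed point of the lift is also one of its inverse, and the inequality for the inverse is
    the missing one. *)
Theorem lift_free g (j : int) x0 : F g x0 + tau * j%:~R = x0 ->
  forall y, F g y + tau * j%:~R = y.
Proof.
move=> fix0 y; apply/eqP; rewrite eq_le (lift_le_of_fixed fix0)/=.
have [l Hl] := lift_inv HF FM g.
have inv x : F (g^-1)%g (F g x + tau * j%:~R) + tau * (- j - l)%:~R = x.
  rewrite (translates_int (lift_translates (HF _))) Hl intrB intrN mulrBr mulrN.
  by move: (tau * j%:~R) (tau * l%:~R) => A B; lra.
rewrite -[leLHS]inv; apply: (@lift_le_of_fixed _ _ x0).
by rewrite -[X in F _ X]fix0 inv.
Qed.

End LiftRigidity.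

(** * Finiteness of the image *)

Section FiniteRange.
Variables (R : realType) (G : groupType) (h : G -> circle R -> circle R) (F : G -> R -> R).
Notation tau := (2 * @pi R).
Hypothesis hM : forall g1 g2, h (g1 * g2)%g = h g1 \o h g2.
Hypothesis HF : forall g, c1_lift (F g).
Hypothesis FM : forall g1 g2, exists k : int, forall x,
  F (g1 * g2)%g x = F g1 (F g2 x) + tau * k%:~R.
Hypothesis hF : forall g t, h g (circle_exp t) = circle_exp (F g t).
Hypothesis F_free : forall g (j : int) x0, F g x0 + tau * j%:~R = x0 ->
  forall y, F g y + tau * j%:~R = y.
Hypothesis exponent : (forall x y, h (x * y)%g = h (y * x)%g) ->
  exists2 d : nat, (0 < d)%N & forall g, h (g ^+ d)%g = h 1%g.

(** All lifts of the image: an extension of it by the translations by multiples of 2 pi, to which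
    Hölder's argument applies. *)
Let A : set (R -> R) := [set f | exists g (j : int), f = fun x => F g x + tau * j%:~R].

Let A_shift : A (fun x => x + tau).
Proof.
have [k Hk] := lift_one HF FM; exists 1%g, (1 - k); apply/funext => x.
by rewrite Hk intrB mulrBr mulr1; move: (tau) (tau * k%:~R) => a c; lra.
Qed.

Let A_comp f f' : A f -> A f' -> A (f \o f').
Proof.
move=> [g [j ->]] [g' [j' ->]]; have [k Hk] := FM g g'.
exists (g * g')%g, (j' + j - k); apply/funext => x /=.
rewrite (translates_int (lift_translates (HF _))) Hk intrB intrD mulrBr mulrDr.
by move: (tau * j%:~R) (tau * j'%:~R) (tau * k%:~R) => u v w; lra.
Qed.

Let A_incr f : A f -> {homo f : x y / x < y}.
Proof. by move=> [g [j ->]] x y xy; rewrite ltrD2r; exact: (lift_incr (HF g)). Qed.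

Let A_left_inv f : A f -> exists f', A f' /\ cancel f f'.
Proof.
move=> [g [j ->]]; have [l Hl] := lift_inv HF FM g.
exists (fun x => F (g^-1)%g x + tau * (- j - l)%:~R); split; first by exists (g^-1)%g, (- j - l).
move=> x; rewrite (translates_int (lift_translates (HF _))) Hl intrB intrN mulrBr mulrN.
by move: (tau * j%:~R) (tau * l%:~R) => u v; lra.
Qed.

Let A_inv f : A f -> exists f', [/\ A f', cancel f f' & cancel f' f].
Proof.
move=> /A_left_inv[f' [Af' fK]]; exists f'; split => // x.
have inj : injective f' by apply: inc_inj; exact: le_mono (A_incr Af').
by apply: inj; rewrite fK.
Qed.

Let A_cont f : A f -> continuous f.
Proof. by move=> [g [j ->]]; exact/lift_continuous/c1_lift_addr. Qed.

Let A_translates f : A f -> forall x, f (x + tau) = f x + tau.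
Proof. by move=> [g [j ->]] x; rewrite (lift_translates (HF g)) addrAC. Qed.

Let A_free f x : A f -> f x = x -> forall y, f y = y.
Proof. by move=> [g [j ->]]; exact: F_free. Qed.

Let A_exponent : (forall f g, A f -> A g -> f \o g = g \o f) ->
  exists2 d, (0 < d)%N & forall f, A f -> exists k : int, iter d f 0 = tau * k%:~R.
Proof.
move=> comm; have AF g : A (F g) by exists g, 0; apply/funext => x; rewrite mulr0 addr0.
have [|d d0 Hd] := exponent.
  move=> x y; apply/funext => z; have [t <-] := circle_exp_surj z.
  rewrite !hM /= !hF; congr circle_exp; exact: (congr1 (@^~ t) (comm _ _ (AF x) (AF y))).
exists d => // f [g [j fE]].
have [k0 Hk0] := lift_one HF FM.
have hiter n t : circle_exp (iter n f t) = h (g ^+ n)%g (circle_exp t).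
  elim: n => [|n ih]; first by rewrite expg0 hF Hk0 circle_exp_int.
  by rewrite expgS hM /= -ih hF fE circle_exp_int.
have [|k Hk] := @circle_exp_inj_int R (iter d f 0) 0.
  by rewrite hiter Hd hF Hk0 circle_exp_int.
by exists k; rewrite Hk add0r.
Qed.

(** Each element of the image has a lift sending 0 into [0, 2 pi[, this lift determines it, and only
    finitely many lifts do so. *)
Lemma finite_range : finite_set (range h).
Proof.
have fin := holder_finite (tau_gt0 R) A_shift A_comp A_inv A_cont A_incr A_translates
  A_free A_exponent.
pose angle (z : circle R) : R := projT1 (cid (circle_exp_surj z)).
have angleK z : circle_exp (angle z) = z := projT2 (cid (circle_exp_surj z)).
apply: (sub_finite_set _ (finite_image (fun f z => circle_exp (f (angle z))) fin)).
move=> _ [g _ <-]; have [j jP] := reduce_mod_tau 0 (F g 0); rewrite add0r in jP.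
exists (fun x => F g x + tau * j%:~R); first by split => //; exists g, j.
by apply/funext => z; rewrite circle_exp_int -hF angleK.
Qed.

End FiniteRange.

Lemma bip_degree (A B : finType) (I : A -> B -> bool) (n : nat) :
  (forall L, #|[pred P | I P L]| = n) -> (forall P, #|[pred L | I P L]| = n) ->
  forall v, #|[pred u | bip_edge I u v]| = n.
Proof.
move=> rows cols [P|L]; rewrite -sum1_card big_sumType /=.
  by rewrite big_pred0 ?add0n; [rewrite sum1_card -[RHS](cols P)|].
by rewrite [X in (_ + X)%N]big_pred0 ?addn0; [rewrite sum1_card -[RHS](rows L)|].
Qed.

(* For b = 1/p the required inequality says that b exceeds the threshold, which lies
   strictly between 0 and 1/2. *)
Lemma exponent_choice (R : realType) (q : nat) (alpha : R) : (1 < q)%N ->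
  let lam : R := 1 - Num.sqrt q%:R / (q%:R + 1) in
  (2^-1 * ln (2 * (q%:R ^+ 2 + q%:R + 1) * (q%:R + 1)) - ln 2 - ln (Num.sqrt lam))
    / (ln (q%:R ^+ 2 + q%:R + 1) + ln (q%:R + 1)) < alpha ->
  exists b, [/\ 0 < b, b < alpha, 2 < b^-1 &
    (b^-1 / 2 - 1) * ln ((q%:R ^+ 2 + q%:R + 1) * (q%:R + 1)) < b^-1 / 2 * ln (2 * lam)].
Proof.
move=> q1 lam.
have Q2 : 2 <= q%:R :> R by rewrite ler_nat.
(* From (sqrt q - 1)^2 > 0 the eigenvalue of the link exceeds 1/2, which places the threshold below
   1/2. *)
have lam_gt : 1 < 2 * lam.
  have q0 : (0 : R) < q%:R + 1 by lra.
  have sq : Num.sqrt q%:R ^+ 2 = q%:R :> R by rewrite sqr_sqrtr; lra.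
  have s0 : 0 <= Num.sqrt q%:R :> R by exact: sqrtr_ge0.
  suff : Num.sqrt q%:R / (q%:R + 1) < 2^-1 :> R by rewrite /lam; lra.
  rewrite ltr_pdivrMr//; rewrite expr2 in sq; move: sq s0 Q2.
  by move: (Num.sqrt _) => s; move: (q%:R : R) => Q sq s0 Q2; nra.
have lam_le : lam <= 1 by rewrite /lam lerBlDr lerDl divr_ge0 ?sqrtr_ge0//; lra.
have lnsqrt : ln (Num.sqrt lam) = 2^-1 * ln lam.
  have s0 : 0 < Num.sqrt lam by rewrite sqrtr_gt0; lra.
  have : ln (Num.sqrt lam ^+ 2) = ln lam by rewrite sqr_sqrtr//; lra.
  rewrite expr2 lnM ?posrE// => <-; move: (ln _) => u; lra.
set P := q%:R ^+ 2 + q%:R + 1; set Q := q%:R + 1.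
have P2 : 2 <= P by rewrite /P expr2; move: (q%:R : R) Q2 => x ?; nra.
have Q3 : 2 <= Q by rewrite /Q; lra.
rewrite -mulrA lnsqrt !lnM ?posrE; try by [lra|nra].
set L := ln P + ln Q; set l := ln 2 + ln lam => halpha.
have l0 : 0 < l by rewrite /l -lnM ?posrE ?ln_gt0//; lra.
have lL : l < L.
  rewrite /l /L -!lnM ?posrE; try lra.
  by rewrite ltr_ln ?posrE; try lra; nra.
(* In terms of L, the logarithm of the number of edges, and l = ln (2 lam), the threshold is (L - l)
   / (2 L); the inequality required of b is b > (L - l) / (2 L). *)
set th := (_ / _) in halpha.
have thE : th * (2 * L) = L - l.
  rewrite /th; have L0 : L != 0 by rewrite gt_eqF//; lra.
  rewrite mulrCA divfK// /l; lra.
have th0 : 0 < th by nra.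
have th2 : th < 2^-1 by nra.
pose m := Num.min alpha 2^-1; have ma : m <= alpha by rewrite ge_min lexx.
have m2 : m <= 2^-1 by rewrite ge_min lexx orbT.
have thm : th < m by rewrite lt_min halpha.
pose b := (th + m) / 2; have b0 : 0 < b by rewrite /b; lra.
exists b; split => //; [rewrite /b; lra| |].
  by rewrite -[ltLHS]invrK ltf_pV2 ?posrE//; rewrite /b; lra.
have bth : th < b by rewrite /b; lra.
have bV : b^-1 * b = 1 by rewrite mulVf// gt_eqF.
have bV0 : 0 < b^-1 by rewrite invr_gt0.
by move: bV bV0; move: (b^-1) => c cb c0; nra.
Qed.

(** The projective plane enters through its counting properties, as an incidence structure between
    points and lines. The generators inherit inversion and the triangle relations from S through the
    bijection [phi]. *)
Theorem incidence_link_finite_range (R : realType) (G : groupType) (A B : finType)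
    (I : A -> B -> bool) (q : nat) (S : set G) (phi : A + B -> G)
    (alpha : R) (h : G -> circle R -> circle R) :
  (1 < q)%N -> #|A| = (q ^ 2 + q + 1)%N ->
  (forall L, #|[pred P | I P L]| = q.+1) -> (forall P, #|[pred L | I P L]| = q.+1) ->
  (forall P Q, P != Q -> #|[pred L | I P L && I Q L]| = 1%N) ->
  symmetric_set S -> generating S -> set_bij [set: A + B] S phi ->
  (forall u v, bip_edge I u v <-> link_edge S (phi u) (phi v)) ->
  (2^-1 * ln (2 * (q%:R ^+ 2 + q%:R + 1) * (q%:R + 1))
       - ln 2 - ln (Num.sqrt (1 - Num.sqrt q%:R / (q%:R + 1))))
    / (ln (q%:R ^+ 2 + q%:R + 1) + ln (q%:R + 1)) < alpha ->
  hom_to_Diff_plus alpha h -> finite_set (range h).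
Proof.
move=> q1 cardA rows cols common symS genS [phiS phi_inj phi_surj] phi_link halpha [hD hM].
have [b [b0 ba p2 hp]] := exponent_choice q1 halpha.
have [theta theta01 poincare] := link_poincare q1 cardA rows common p2 hp.
have inj : injective phi by move=> u v uv; apply: phi_inj => //; rewrite inE.
have Sphi s : S s -> exists v, phi v = s by move=> /phi_surj[v _ <-]; exists v.
have inv_ex v : exists w, phi w = ((phi v)^-1)%g by apply/Sphi/symS/phiS.
pose i v := projT1 (cid (inv_ex v)).
have phi_inv v : phi (i v) = ((phi v)^-1)%g := projT2 (cid (inv_ex v)).
have link u v : bip_edge I u v <-> exists x, phi x = ((phi u)^-1 * phi v)%g.
  rewrite phi_link; split => [/Sphi//|[x xE]].
  by rewrite /link_edge -xE; exact: phiS.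
have degree := bip_degree rows cols.
have V0 : (0 < #|{: A + B}|)%N by rewrite card_sum cardA; lia.
have generated (H : set G) : subgroup_set H -> (forall v, H (phi v)) -> forall g, H g.
  move=> sH Hphi g; have : [set: G] g by [].
  rewrite -genS; apply; split => // s /Sphi[v <-]; exact: Hphi.
have lifts g := diff_c1_lift (hD g).
pose F g := projT1 (cid (lifts g)).
have HF g : c1_lift (F g) by rewrite /F; case: cid => /= f [].
have hF g t : h g (circle_exp t) = circle_exp (F g t) by rewrite /F; case: cid => /= f [].
have hol g : exists C : R, forall s t, `|derive1 (F g) s - derive1 (F g) t| <= C * `|s - t| `^ alpha.
  by rewrite /F; case: cid => /= f [].
have FM g1 g2 : exists k : int, forall x, F (g1 * g2)%g x = F g1 (F g2 x) + (2 * @pi R) * k%:~R.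
  apply: (@lifts_differ _ (h (g1 * g2)%g) (F (g1 * g2)%g) (F g1 \o F g2)).
    by split; [exact/lift_continuous|exact: hF].
  split; last by move=> t; rewrite hM /= !hF.
  by move=> x; apply: continuous_comp; exact: lift_continuous.
apply: (finite_range hM HF FM hF).
  exact: (lift_free HF FM b0 ba erefl p2 hol inj phi_inv link degree V0 generated theta01 poincare).
move=> hC.
have [d d0 Hd] := abelian_image_exponent inj phi_inv link degree theta01 poincare generated.
exists d => // g; apply: (Hd _ h _ hC) => x y x' y' xx' yy'.
by rewrite !hM xx' yy'.
Qed.

Theorem corollary7p2 (R : realType) (q p k : nat)
  (hp : prime p) (hk : (0 < k)%N) (hq : q = (p ^ k)%N)
  (G : groupType) (hG : A2tilde_group G q)
  (alpha : R)
  (halpha :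
    (2^-1 * ln (2 * (q%:R ^+ 2 + q%:R + 1) * (q%:R + 1))
       - ln 2 - ln (Num.sqrt (1 - Num.sqrt q%:R / (q%:R + 1))))
    / (ln (q%:R ^+ 2 + q%:R + 1) + ln (q%:R + 1)) < alpha)
  (h : G -> circle R -> circle R) (hh : hom_to_Diff_plus alpha h) :
  finite_set (range h).
Proof.
have [S [_ symS _ genS [F [Fq [phi [phi_bij phi_link]]]]]] := hG.
have q1 := card_finField_gt1 F; have cardA := card_points F.
have rows := @card_points_on_line F; have cols := @card_lines_through F.
rewrite Fq in q1 cardA rows cols.
exact: (incidence_link_finite_range q1 cardA rows cols (@card_common_lines F) symS genS
  phi_bij phi_link halpha hh).
Qed.
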